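(* For every $p$ that is a prime number or zero, the theory $\mathrm{ACFC}_p$ is $\omega$-stable.
   Context: A character $\chi:F\to K$ between integral domains is a map with $\chi(ab)=\chi(a)\chi(b)$ for all $a,b\in F$, $\chi(0)=0$ and $\chi(1)=1$. A structure $(F,K;\chi)$ of this kind is a structure in the $2$-sorted language $L$, which consists of two disjoint copies of the language of rings (one for each sort) augmented by a unary function symbol $\chi$ from the first sort to the second. For $n\ge 1$, $\alpha\in F^n$ and $k\in\mathbb{N}^n$ put $\alpha^k=\alpha_1^{k_1}\cdots\alpha_n^{k_n}$. The tuple $\alpha$ is multiplicatively dependent if $\alpha^k=\alpha^l$ for some distinct $k,l\in\mathbb{N}^n$, and multiplicatively independent otherwise. A character $\chi:F\to K$ is generic if it is injective and, for every $n\ge1$ and every multiplicatively independent $\alpha\in F^n$, the tuple $\chi(\alpha)=(\chi(\alpha_1),\dots,\chi(\alpha_n))$ is algebraically independent, in the fraction field of $K$, over its prime field. $\mathrm{ACFC}$ is a recursive set of $\forall\exists$-sentences of $L$ whose models are exactly the structures $(F,K;\chi)$ with $F,K$ algebraically closed fields, $\mathrm{char}(K)=0$ and $\chi$ a generic character. For $p$ prime or zero, $\mathrm{ACFC}_p$ is $\mathrm{ACFC}$ together with sentences expressing $\mathrm{char}(F)=p$. *)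

(* Defs.v *)
From mathcomp Require Import all_boot all_order all_algebra.
From mathcomp Require Import mpoly.
From mathcomp Require Import boolp classical_sets functions cardinality.

Set Implicit Arguments.
Unset Strict Implicit.
Unset Printing Implicit Defensive.

Import GRing.Theory.
Local Open Scope classical_set_scope.
Local Open Scope ring_scope.

(** * Generic characters *)

Definition is_character (F K : idomainType) (chi : F -> K) : Prop :=
  [/\ forall a b, chi (a * b) = chi a * chi b, chi 0 = 0 & chi 1 = 1].

Definition tuple_pow (F : idomainType) n (alpha : n.-tuple F)
    (k : n.-tuple nat) : F :=
  \prod_(i < n) tnth alpha i ^+ tnth k i.

Definition mult_dependent (F : idomainType) n (alpha : n.-tuple F) : Prop :=
  exists k l : n.-tuple nat, k <> l /\ tuple_pow alpha k = tuple_pow alpha l.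

(* The prime field of E, as the intersection of all its subfields. *)
Definition in_prime_field (E : fieldType) (x : E) : Prop :=
  forall S : {pred E}, GRing.divring_closed S -> x \in S.

Definition alg_independent_over_prime_field (E : fieldType) n
    (beta : n.-tuple E) : Prop :=
  forall P : {mpoly E[n]},
    (forall mu : 'X_{1..n}, in_prime_field P@_mu) ->
    P.@[tnth beta] = 0 -> P = 0.

Definition is_generic (F K : idomainType) (chi : F -> K) : Prop :=
  injective chi /\
  forall n (alpha : n.-tuple F), (0 < n)%N -> ~ mult_dependent alpha ->
    alg_independent_over_prime_field
      [tuple of [seq (tofrac (chi a) : {fraction K}) | a <- alpha]].

(** * The two-sorted language *)

(* Terms of the language of rings {0, 1, +, -, *} over a type of atoms. *)
Inductive rterm (X : Type) : Type :=
| TAtom of X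
| TZero
| TOne
| TAdd of rterm X & rterm X
| TOpp of rterm X
| TMul of rterm X & rterm X.
Arguments TZero {X}.
Arguments TOne {X}.

(* CF and CK are the types of constant symbols added to L in each sort (L     *)
(* itself is the case CF = CK = void), and m and n are the numbers of         *)
(* variables of each sort that may occur.                                     *)
Inductive atomF (CF : Type) (m : nat) : Type :=
| FVar of 'I_m
| FConst of CF.

Inductive atomK (CF CK : Type) (m n : nat) : Type :=
| KVar of 'I_n
| KConst of CK
| KChi of rterm (atomF CF m).

(* In FEx and KEx the bound variable is the one of index ord0 in its sort,    *)
(* the free variables being shifted by one.  Other connectives and the        *)
(* universal quantifiers are the usual classical abbreviations.               *)
Inductive formula (CF CK : Type) : nat -> nat -> Type :=
| FEq m n of rterm (atomF CF m) & rterm (atomF CF m) : formula CF CK m n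
| KEq m n of rterm (atomK CF CK m n) & rterm (atomK CF CK m n) :
    formula CF CK m n
| Not m n of formula CF CK m n : formula CF CK m n
| And m n of formula CF CK m n & formula CF CK m n : formula CF CK m n
| FEx m n of formula CF CK m.+1 n : formula CF CK m n
| KEx m n of formula CF CK m n.+1 : formula CF CK m n.

Definition sentence (CF CK : Type) : Type := formula CF CK 0 0.

Definition theory : Type := set (sentence void void).

(** * Structures and satisfaction *)

Record ring_ops (T : Type) : Type := RingOps {
  rzero : T;
  rone : T;
  radd : T -> T -> T;
  ropp : T -> T;
  rmul : T -> T -> T
}.

Record lstructure : Type := LStructure {
  sortF : Type;
  sortK : Type;
  opsF : ring_ops sortF;
  opsK : ring_ops sortK;
  chi_of : sortF -> sortK
}.

Fixpoint eval_rterm (X T : Type) (ops : ring_ops T) (e : X -> T)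
    (t : rterm X) : T :=
  match t with
  | TAtom x => e x
  | TZero => rzero ops
  | TOne => rone ops
  | TAdd t1 t2 => radd ops (eval_rterm ops e t1) (eval_rterm ops e t2)
  | TOpp t1 => ropp ops (eval_rterm ops e t1)
  | TMul t1 t2 => rmul ops (eval_rterm ops e t1) (eval_rterm ops e t2)
  end.

Definition eval_atomF (M : lstructure) (CF : Type) (cF : CF -> sortF M)
    m (v : 'I_m -> sortF M) (a : atomF CF m) : sortF M :=
  match a with
  | FVar i => v i
  | FConst c => cF c
  end.

Definition eval_atomK (M : lstructure) (CF CK : Type)
    (cF : CF -> sortF M) (cK : CK -> sortK M)
    m n (v : 'I_m -> sortF M) (w : 'I_n -> sortK M)
    (a : atomK CF CK m n) : sortK M :=
  match a with
  | KVar j => w j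
  | KConst c => cK c
  | KChi t => chi_of (eval_rterm (opsF M) (eval_atomF cF v) t)
  end.

Definition env_cons (T : Type) (x : T) m (v : 'I_m -> T) (i : 'I_m.+1) : T :=
  if unlift ord0 i is Some j then v j else x.

Definition env_nil (T : Type) (i : 'I_0) : T :=
  let: Ordinal k lt_k_0 := i in False_rect T (notF lt_k_0).

Fixpoint sat (M : lstructure) (CF CK : Type)
    (cF : CF -> sortF M) (cK : CK -> sortK M)
    m n (phi : formula CF CK m n) :
    ('I_m -> sortF M) -> ('I_n -> sortK M) -> Prop :=
  match phi in formula _ _ m n
    return ('I_m -> sortF M) -> ('I_n -> sortK M) -> Prop with
  | FEq _ _ s t => fun v _ =>
      eval_rterm (opsF M) (eval_atomF cF v) s =
      eval_rterm (opsF M) (eval_atomF cF v) t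
  | KEq _ _ s t => fun v w =>
      eval_rterm (opsK M) (eval_atomK cF cK v w) s =
      eval_rterm (opsK M) (eval_atomK cF cK v w) t
  | Not _ _ phi1 => fun v w => ~ sat cF cK phi1 v w
  | And _ _ phi1 phi2 => fun v w =>
      sat cF cK phi1 v w /\ sat cF cK phi2 v w
  | FEx _ _ phi1 => fun v w =>
      exists x : sortF M, sat cF cK phi1 (env_cons x v) w
  | KEx _ _ phi1 => fun v w =>
      exists y : sortK M, sat cF cK phi1 v (env_cons y w)
  end.

Definition sat_sentence (M : lstructure) (CF CK : Type)
    (cF : CF -> sortF M) (cK : CK -> sortK M) (s : sentence CF CK) : Prop :=
  sat cF cK s (@env_nil _) (@env_nil _).

Definition models (M : lstructure) (T : theory) : Prop :=
  forall s, T s -> sat_sentence (@of_void (sortF M)) (@of_void (sortK M)) s.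

(** * Types and omega-stability *)

Section Types.

Variables (M : lstructure) (AF : set (sortF M)) (AK : set (sortK M)).

(* The formulas of L_A, where A = (AF, AK): one constant per element of A.    *)
Local Notation formulaA := (formula {x | AF x} {y | AK y}).
Local Notation sentenceA := (sentence {x | AF x} {y | AK y}).

(* Th_A(M) *)
Definition theory_over : set sentenceA :=
  [set s | sat_sentence (M := M) sval sval s].

(* p is consistent with Th_A(M), the variables of p being interpreted by      *)
(* (v, w) in the L_A-structure (N, cF, cK).                                   *)
Definition type_over m n (p : set (formulaA m n)) : Prop :=
  exists (N : lstructure)
         (cF : {x | AF x} -> sortF N) (cK : {y | AK y} -> sortK N)
         (v : 'I_m -> sortF N) (w : 'I_n -> sortK N),
    (forall s, theory_over s -> sat_sentence cF cK s) /\
    (forall phi, p phi -> sat cF cK phi v w).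

(* S_{m,n}^M(A): the complete types over A in m variables of the first sort   *)
(* and n variables of the second sort.                                        *)
Definition complete_types m n : set (set (formulaA m n)) :=
  [set p | type_over p /\ forall phi, p phi \/ p (Not phi)].

End Types.
Arguments complete_types M AF AK m n : clear implicits.

Definition omega_stable (T : theory) : Prop :=
  forall M : lstructure, models M T ->
  forall (AF : set (sortF M)) (AK : set (sortK M)),
    countable AF -> countable AK ->
    forall m n, countable (complete_types M AF AK m n).

(** * The theories ACFC and ACFC_p *)

Definition ops_of_ring (R : nzRingType) : ring_ops R :=
  RingOps (0 : R) 1 +%R -%R *%R.

Definition lstructure_of (F K : nzRingType) (chi : F -> K) : lstructure :=
  LStructure (ops_of_ring F) (ops_of_ring K) chi.

Definition is_ACFC_structure (M : lstructure) : Prop :=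
  exists (F K : closedFieldType) (chi : F -> K),
    [/\ [pchar K] =i pred0, is_character chi, is_generic chi
      & M = lstructure_of chi].

(* ACFC is determined, up to logical equivalence, by its class of models. *)
Definition axiomatizes_ACFC (T : theory) : Prop :=
  forall M : lstructure, models M T <-> is_ACFC_structure M.

Definition nat_rterm (X : Type) (k : nat) : rterm X :=
  iter k (TAdd TOne) TZero.

Definition FEq_nat0 (k : nat) : sentence void void :=
  FEq void 0 (nat_rterm _ k) TZero.

(* Sentences expressing char(F) = p in a field F, for p prime or zero. *)
Definition char_axioms (p : nat) : theory :=
  if p == 0%N then [set s | exists k : nat, s = Not (FEq_nat0 k.+1)]
  else [set FEq_nat0 p].

Definition ACFC_char (ACFC : theory) (p : nat) : theory :=
  ACFC `|` char_axioms p.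

(* Main.v *)
Require Import Defs.
From mathcomp Require Import all_boot all_order all_algebra.
From mathcomp Require Import boolp classical_sets functions cardinality.
From HB Require Import structures.
From mathcomp Require Import filter mpoly ring zify.

(** Fix a model (F, K; chi) and a countable set A of parameters. Types over A
    are counted by a back-and-forth argument between pairs (F0, K0) of
    countable algebraically closed subfields of F and K with chi(F0)
    contained in K0.

    What makes such a pair manageable is that chi is free over it
    [free_over]: if H is a multiplicative subgroup of F that contains F0 and
    all the roots of its elements, and chi x is algebraic over K0 and chi(H),
    then x is in H. Generic characters are free over the empty pair
    [generic_free], exchange for algebraic dependence propagates freeness
    [free_over_extend, free_over_adjoin], and every countable set is contained
    in a countable pair over which chi is free [free_over_countable].
    Freeness has a linear form [free_lin_indep]: a vanishing sum of terms
    q * chi r, with q in K0, splits into vanishing sums, one for each class of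
    the r modulo F0. So if F1 extends F0, the ring generated by K0 and chi(F1)
    is determined up to isomorphism by K0 and the extension F1 of F0. Hence an
    isomorphism between two pairs extends to any x transcendental over F0
    [partial_iso_addF], and to any y transcendental over K0 and chi(F)
    [partial_iso_addK]; an element of K that is algebraic over K0 and chi(F)
    is reached by adding finitely many elements of F.

    Such extensions exist on both sides if the structures are ample: F is
    uncountable, and K is not algebraic over the union of chi(F) and any
    countable set. Ultrapowers over the natural numbers are ample
    [big_structure], as sums of many independent values of chi are not
    algebraic over few values of chi [image_small]. Therefore partial
    isomorphisms between pairs in ample structures preserve all formulas
    [partial_iso_sat].

    A type over A is realised in some structure N that satisfies the theory of
    M over A. An ultrapower of N contains a copy of M over A, with the same
    first-order properties [joint_embedding], and further ultrapowers make it
    ample. They are again structures with a generic character, because the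
    class of such structures is axiomatised. Freeness over a pair (F0, K0) of
    M containing A persists in the extension [free_over_transfer], so the back
    and forth can start from (F0, K0), with one fixed ample extension of M on
    the other side. There the elements needed are chosen as a function of the
    pair reached so far, so countably many countable pairs suffice to realise
    all types over A [countable_types]. *)

Set Implicit Arguments.
Unset Strict Implicit.
Unset Printing Implicit Defensive.
Import GRing.Theory.
Local Open Scope classical_set_scope.
Local Open Scope ring_scope.

(** * Subfields and algebraic closure inside a field *)

(** The ambient ring is not required to be a field: in a product F * F' of two
    fields, a subfield is the graph of an isomorphism between a subfield of F
    and a subfield of F'. *)
Record subfield (A : comUnitRingType) := Subfield {
  sf_set :> A -> Prop;
  sf_1 : sf_set 1;
  sf_B : forall a b, sf_set a -> sf_set b -> sf_set (a - b);
  sf_M : forall a b, sf_set a -> sf_set b -> sf_set (a * b);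
  sf_V : forall a, sf_set a -> sf_set a^-1;
  sf_unit : forall a, sf_set a -> a != 0 -> a \is a GRing.unit }.

Section SubfieldType.
Variables (A : comUnitRingType) (S : subfield A).

Definition sf_mem : {pred A} := fun a => `[< S a >].

Lemma sf_closed : GRing.divring_closed sf_mem.
Proof.
split=> [|a b|a b]; rewrite !unfold_in.
- by apply/asboolP; apply: sf_1.
- by move=> /asboolP ha /asboolP hb; apply/asboolP; apply: sf_B.
- by move=> /asboolP ha /asboolP hb; apply/asboolP; apply: sf_M => //; apply: sf_V.
Qed.

HB.instance Definition _ := GRing.isDivringClosed.Build A sf_mem sf_closed.

Definition sf_type := {a : A | a \in sf_mem}.
HB.instance Definition _ := SubChoice.on sf_type.
HB.instance Definition _ := [SubChoice_isSubComUnitRing of sf_type by <:].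

Definition sfval (x : sf_type) : A := sval x.
Lemma sfval_inj : injective sfval. Proof. exact: val_inj. Qed.
Lemma sfval_B : zmod_morphism sfval. Proof. by []. Qed.
Lemma sfval_M : monoid_morphism sfval. Proof. by []. Qed.
HB.instance Definition _ :=
  GRing.isZmodMorphism.Build sf_type A sfval sfval_B.
HB.instance Definition _ :=
  GRing.isMonoidMorphism.Build sf_type A sfval sfval_M.

Lemma sfP (x : sf_type) : S (sfval x).
Proof. by have := valP x; rewrite unfold_in => /asboolP. Qed.

Lemma sf_memP a : S a -> a \in sf_mem.
Proof. by move=> h; rewrite unfold_in; apply/asboolP. Qed.

Lemma sf_fieldP (x : sf_type) : x != 0 -> x \is a GRing.unit.
Proof.
move=> x0; have Sx : S (sfval x) by apply: sfP.
have xu : sfval x \is a GRing.unit by apply: (sf_unit Sx); apply: contra_neq x0 => e; apply: sfval_inj; rewrite e rmorph0.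
have Sy : (sfval x)^-1 \in sf_mem by apply: sf_memP; apply: sf_V.
pose y : sf_type := exist (fun a => a \in sf_mem) _ Sy.
apply/unitrP; exists y; split; apply: sfval_inj.
- rewrite rmorphM rmorph1; exact: mulVr.
- rewrite rmorphM rmorph1; exact: mulrV.
Qed.

HB.instance Definition _ := GRing.ComUnitRing_isField.Build sf_type sf_fieldP.

Definition sf_sub a (h : S a) : sf_type := exist (fun a => a \in sf_mem) a (sf_memP h).

End SubfieldType.

Section LiftPoly.
Variables (A : comUnitRingType) (S : subfield A).

Lemma lift_poly (p : {poly A}) : (forall i, S p`_i) ->
  exists q : {poly sf_type S}, map_poly (@sfval _ S) q = p.
Proof.
move=> Sp; exists (\poly_(i < size p) sf_sub (Sp i)).
apply/polyP=> i; rewrite coef_map coef_poly; case: ifP => [_|] //.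
by move=> /negbT; rewrite -leqNgt => /(nth_default 0) ->; rewrite raddf0.
Qed.

End LiftPoly.

Section Frac.
Variables (A : comUnitRingType) (T : set A).
Hypotheses (T1 : T 1) (TB : forall a b, T a -> T b -> T (a - b))
  (TM : forall a b, T a -> T b -> T (a * b))
  (TU : forall a, T a -> a != 0 -> a \is a GRing.unit).

Definition fracs : set A :=
  [set x | exists a b, [/\ T a, T b, b != 0 & x = a / b]].

Lemma fracs_sub : T `<=` fracs.
Proof. by move=> a Ta; exists a, 1; split; rewrite ?divr1 ?oner_neq0. Qed.

Let TMn0 a b : T a -> T b -> a != 0 -> b != 0 -> a * b != 0.
Proof.
move=> Ta Tb a0 b0; apply/eqP => ab0; move/eqP: b0; apply.
by rewrite -[b](mulKr (TU Ta a0)) ab0 mulr0.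
Qed.

Lemma fracs_B a b : fracs a -> fracs b -> fracs (a - b).
Proof.
move=> [a1 [a2 [Ta1 Ta2 a20 ->]]] [b1 [b2 [Tb1 Tb2 b20 ->]]].
exists (a1 * b2 - b1 * a2), (a2 * b2); split; [| exact: TM|exact: TMn0|].
  by apply: TB; apply: TM.
have ua := TU Ta2 a20; have ub := TU Tb2 b20.
rewrite invrM // mulrBl; congr (_ - _).
  by rewrite mulrA mulrK // .
by rewrite [b2^-1 * _]mulrC mulrA mulrK.
Qed.

Lemma fracs_M a b : fracs a -> fracs b -> fracs (a * b).
Proof.
move=> [a1 [a2 [Ta1 Ta2 a20 ->]]] [b1 [b2 [Tb1 Tb2 b20 ->]]].
exists (a1 * b1), (a2 * b2); split; [exact: TM | exact: TM|exact: TMn0|].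
have ua := TU Ta2 a20; have ub := TU Tb2 b20.
by rewrite invrM // mulrACA [_^-1 * b2^-1]mulrC.
Qed.

Lemma fracs_V a : fracs a -> fracs a^-1.
Proof.
move=> [a1 [a2 [Ta1 Ta2 a20 ->]]].
have ua := TU Ta2 a20.
have [->|a10] := eqVneq a1 0.
  rewrite mul0r; exists 0, 1; split; rewrite ?oner_neq0 //.
    by rewrite -(subrr (1 : A)); apply: TB.
  by rewrite mul0r invr0.
exists a2, a1; split=> //.
by rewrite invrM ?invrK ?unitrV // TU.
Qed.

Lemma fracs_U a : fracs a -> a != 0 -> a \is a GRing.unit.
Proof.
move=> [a1 [a2 [Ta1 Ta2 a20 ->]]] n0.
have ua := TU Ta2 a20; rewrite unitrM unitrV ua andbT TU //.
by apply: contra_neq n0 => ->; rewrite mul0r.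
Qed.

Definition frac_subfield : subfield A :=
  @Subfield A fracs (fracs_sub T1) fracs_B fracs_M fracs_V fracs_U.

End Frac.

Section Rgen.
Variable (R : nzRingType).
Implicit Type S : set R.

Inductive rgen S : R -> Prop :=
| rgen_in a of S a : rgen S a
| rgen_1 : rgen S 1
| rgen_B a b of rgen S a & rgen S b : rgen S (a - b)
| rgen_M a b of rgen S a & rgen S b : rgen S (a * b).

Lemma rgen_0 S : rgen S 0.
Proof. by rewrite -(subrr (1 : R)); apply: rgen_B; apply: rgen_1. Qed.
Lemma rgen_N S a : rgen S a -> rgen S (- a).
Proof. by rewrite -sub0r; apply: rgen_B; apply: rgen_0. Qed.
Lemma rgen_D S a b : rgen S a -> rgen S b -> rgen S (a + b).
Proof. by move=> ha hb; rewrite -[b]opprK; apply: rgen_B => //; apply: rgen_N. Qed.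
Lemma rgen_sum S (I : Type) (r : seq I) (P : pred I) (F : I -> R) :
  (forall i, P i -> rgen S (F i)) -> rgen S (\sum_(i <- r | P i) F i).
Proof. by move=> H; apply: big_ind => //; [exact: rgen_0 | exact: rgen_D]. Qed.
Lemma rgen_X S a n : rgen S a -> rgen S (a ^+ n).
Proof.
by move=> ha; elim: n => [|n IH]; rewrite ?expr0 ?exprS; [exact: rgen_1|exact: rgen_M].
Qed.

Lemma rgen_least S (T : R -> Prop) : (forall a, S a -> T a) -> T 1 ->
  (forall a b, T a -> T b -> T (a - b)) ->
  (forall a b, T a -> T b -> T (a * b)) -> forall a, rgen S a -> T a.
Proof. by move=> h1 h2 h3 h4 a; elim=> //; auto. Qed.

Lemma rgen_mono S S' : S `<=` S' -> rgen S `<=` rgen S'.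
Proof.
move=> ss; apply: rgen_least; [|exact: rgen_1|exact: rgen_B|exact: rgen_M].
by move=> a /ss; apply: rgen_in.
Qed.

Lemma rgen_fin S a : rgen S a -> exists2 s : seq R,
  (forall x, x \in s -> S x) & rgen [set` s] a.
Proof.
have cat2 b c (o : R -> R -> R) :
    (forall T : set R, rgen T b -> rgen T c -> rgen T (o b c)) ->
    (exists2 s : seq R, (forall x, x \in s -> S x) & rgen [set` s] b) ->
    (exists2 s : seq R, (forall x, x \in s -> S x) & rgen [set` s] c) ->
    exists2 s : seq R, (forall x, x \in s -> S x) & rgen [set` s] (o b c).
  move=> ho [s1 s1S h1] [s2 s2S h2]; exists (s1 ++ s2).
    by move=> x; rewrite mem_cat => /orP[/s1S|/s2S].
  by apply: ho; [apply: rgen_mono h1|apply: rgen_mono h2] => x /= xs;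
    rewrite mem_cat xs ?orbT.
elim=> [b Sb||b c _ IHb _ IHc|b c _ IHb _ IHc].
- by exists [:: b]; [move=> x; rewrite inE => /eqP -> | apply: rgen_in; rewrite /= inE].
- by exists [::] => //; apply: rgen_1.
- by apply: (cat2 _ _ (fun b c => b - c)) => // T; apply: rgen_B.
- by apply: (cat2 _ _ (fun b c => b * c)) => // T; apply: rgen_M.
Qed.

(** Stages with union rgen S, each of them countable when S is. *)
Fixpoint rgen_level S n : set R :=
  if n is m.+1 then
    (rgen_level S m `|` ((fun z : R * R => z.1 - z.2) @` (rgen_level S m `*` rgen_level S m)))
     `|` ((fun z : R * R => z.1 * z.2) @` (rgen_level S m `*` rgen_level S m))
  else S `|` [set 1].

Lemma countableU T (A B : set T) : countable A -> countable B -> countable (A `|` B).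
Proof.
move=> cA cB; rewrite -bigcup2E; apply: bigcup_countable => // -[|[|i]] _ //=.
Qed.

Lemma countable_image T U (f : T -> U) (A : set T) :
  countable A -> countable (f @` A).
Proof. by apply: sub_countable; apply: card_image_le. Qed.

Lemma countable_sub T (A B : set T) : A `<=` B -> countable B -> countable A.
Proof. by move=> /subset_card_le; apply: sub_countable. Qed.

Lemma rgen_countable S : countable S -> countable (rgen S).
Proof.
move=> cS; have: countable (\bigcup_(n in @setT nat) rgen_level S n).
  apply: bigcup_countable => // n _; elim: n => [|n IH] /=.
    by apply: countableU => //; apply: countable1.
  by apply: countableU; [apply: countableU => //|];
    apply: countable_image; apply: countableX.
apply: countable_sub.
have lS m n : (m <= n)%N -> rgen_level S m `<=` rgen_level S n.
  move=> /subnK <-; elim: (n - m)%N => [|k IH]; rewrite ?addSn // => x /IH hx.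
  by left; left.
have two m n a b : rgen_level S m a -> rgen_level S n b ->
    rgen_level S (maxn m n) a /\ rgen_level S (maxn m n) b.
  by move=> ha hb; split; [apply: lS ha|apply: lS hb]; rewrite ?leq_maxl ?leq_maxr.
apply: rgen_least.
- by move=> a Sa; exists 0%N => //; left.
- by exists 0%N => //; right.
- move=> a b [m _ ha] [n _ hb]; exists (maxn m n).+1 => //.
  by have [h1 h2] := two _ _ _ _ ha hb; left; right; exists (a, b).
- move=> a b [m _ ha] [n _ hb]; exists (maxn m n).+1 => //.
  by have [h1 h2] := two _ _ _ _ ha hb; right; exists (a, b).
Qed.

End Rgen.

Section Acl.
Variable (K : fieldType).
Implicit Type S : set K.

(** The coefficients lie in the subring generated by S rather than in the
    subfield. By clearing denominators this changes nothing, and a relation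
    over the subring is one that a term of the language can express. *)
Definition acl S : set K := [set y | exists p : {poly K},
  [/\ p != 0, forall i, rgen S p`_i & root p y]].

Definition fgen S : subfield K :=
  frac_subfield (rgen_1 S) (@rgen_B _ S) (@rgen_M _ S)
    (fun a _ a0 => etrans (unitfE a) a0).

Lemma common_denom S n (c : nat -> K) : (forall i, fgen S (c i)) ->
  exists d, [/\ rgen S d, d != 0 & forall i, (i < n)%N -> rgen S (d * c i)].
Proof.
move=> hc; elim: n => [|n [d [hd d0 hi]]].
  by exists 1; split=> //; [exact: rgen_1 | rewrite oner_neq0].
have [a [b [ha hb b0 e]]] := hc n.
exists (b * d); split; [exact: rgen_M|by rewrite mulf_neq0|move=> i].
rewrite ltnS leq_eqVlt => /orP[/eqP ->|/hi h]; last first.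
  by rewrite -mulrA; apply: rgen_M.
rewrite e mulrAC mulrCA divff // mulr1 mulrC.
exact: rgen_M.
Qed.

Lemma aclP S y : acl S y <-> algebraicOver (@sfval _ _ : sf_type (fgen S) -> K) y.
Proof.
split=> [[p [p0 hp py]]|[q q0 qy]].
  have [|q qp] := @lift_poly _ (fgen S) p; first by move=> i; apply: fracs_sub; [exact: rgen_1|].
  exists q; last by rewrite qp.
  by apply: contra_neq p0 => q0; rewrite -qp q0 rmorph0.
have [|d [hd d0 hi]] := @common_denom S (size q) (fun i => sfval q`_i).
  by move=> i; apply: sfP.
exists (d *: map_poly (@sfval _ _) q); split.
- by rewrite scaler_eq0 negb_or d0 map_poly_eq0.
- move=> i; rewrite coefZ coef_map; have [/hi //|h] := ltnP i (size q).
  by rewrite nth_default // raddf0 mulr0; apply: rgen_0.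
- by rewrite rootE hornerZ (rootP qy) mulr0.
Qed.

Lemma acl_rgen S : rgen S `<=` acl S.
Proof.
move=> a Sa; exists ('X - a%:P); rewrite polyXsubC_eq0 root_XsubC; split=> // i.
rewrite coefB coefX coefC; apply: rgen_B.
  by case: (i == 1%N); [exact: rgen_1|exact: rgen_0].
by case: (i == 0%N) => //; exact: rgen_0.
Qed.

Lemma acl_in S : S `<=` acl S.
Proof. by move=> a Sa; apply: acl_rgen; apply: rgen_in. Qed.

Lemma acl_mono S S' : S `<=` S' -> acl S `<=` acl S'.
Proof.
by move=> ss y [p [p0 hp py]]; exists p; split=> // i; apply: rgen_mono (hp i).
Qed.

Lemma acl_1 S : acl S 1. Proof. by apply: acl_rgen; apply: rgen_1. Qed.
Lemma acl_0 S : acl S 0. Proof. by apply: acl_rgen; apply: rgen_0. Qed.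
Lemma acl_B S a b : acl S a -> acl S b -> acl S (a - b).
Proof. by rewrite !aclP; apply: algebraic_sub. Qed.
Lemma acl_M S a b : acl S a -> acl S b -> acl S (a * b).
Proof. by rewrite !aclP; apply: algebraic_mul. Qed.
Lemma acl_V S a : acl S a -> acl S a^-1.
Proof. by rewrite !aclP; apply: algebraic_inv. Qed.
Lemma acl_N S a : acl S a -> acl S (- a).
Proof. by rewrite -sub0r; apply: acl_B; apply: acl_0. Qed.
Lemma acl_D S a b : acl S a -> acl S b -> acl S (a + b).
Proof. by move=> ha hb; rewrite -[b]opprK; apply: acl_B => //; apply: acl_N. Qed.
Lemma acl_sum S (I : Type) (r : seq I) (P : pred I) (F : I -> K) :
  (forall i, P i -> acl S (F i)) -> acl S (\sum_(i <- r | P i) F i).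
Proof. by move=> H; apply: big_ind => //; [exact: acl_0 | exact: acl_D]. Qed.

Definition acl_field S : subfield K :=
  @Subfield K (acl S) (acl_1 S) (@acl_B S) (@acl_M S) (@acl_V S)
    (fun a _ a0 => etrans (unitfE a) a0).

Lemma acl_root S (p : {poly K}) y : p != 0 -> (forall i, acl S p`_i) ->
  root p y -> acl S y.
Proof.
move=> p0 hp py; apply/aclP/integral_algebraic.
apply: (integral_root p0 py); apply/integral_poly => i.
by apply/integral_algebraic/aclP.
Qed.

Lemma acl_sub S T : S `<=` acl T -> acl S `<=` acl T.
Proof.
move=> ST y [p [p0 hp py]]; apply: (acl_root p0 _ py) => i.
by apply: rgen_least (hp i); [|exact: acl_1|exact: acl_B|exact: acl_M].
Qed.

Lemma acl_fin S y : acl S y -> exists2 s : seq K,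
  (forall x, x \in s -> S x) & acl [set` s] y.
Proof.
move=> [p [p0 hp py]].
have [s sS hs] : exists2 s : seq K, (forall x, x \in s -> S x) &
    forall i, (i < size p)%N -> rgen [set` s] p`_i.
  elim: (size p) => [|n [s sS hs]]; first by exists [::].
  have [s' sS' hs'] := rgen_fin (hp n); exists (s ++ s').
    by move=> x; rewrite mem_cat => /orP[/sS|/sS'].
  move=> i; rewrite ltnS leq_eqVlt => /orP[/eqP ->|/hs h];
    [move: hs'|move: h]; apply: rgen_mono => x /= xs; by rewrite mem_cat xs ?orbT.
exists s => //; exists p; split=> // i.
have [/hs //|h] := ltnP i (size p); rewrite nth_default //; exact: rgen_0.
Qed.

Lemma rgen_adjoin S x a : rgen (S `|` [set x]) a ->
  exists2 f : {poly K}, (forall i, rgen S f`_i) & f.[x] = a.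
Proof.
elim=> [b [Sb|->]||b c _ [f hf <-] _ [g hg <-]|b c _ [f hf <-] _ [g hg <-]].
- exists b%:P; rewrite ?hornerC // => i; rewrite coefC; case: ifP => _ //;
    [exact: rgen_in|exact: rgen_0].
- exists 'X; rewrite ?hornerX // => i; rewrite coefX; case: eqP => _ //;
    [exact: rgen_1|exact: rgen_0].
- exists 1; rewrite ?hornerC // => i; rewrite coef1; case: eqP => _ //;
    [exact: rgen_1|exact: rgen_0].
- by exists (f - g); rewrite ?hornerD ?hornerN // => i; rewrite coefB; apply: rgen_B.
- exists (f * g); rewrite ?hornerM // => i; rewrite coefM.
  by apply: rgen_sum => j _; apply: rgen_M.
Qed.

(** The relation P(x, y) = 0 over S is a polynomial Q in x with coefficients
    in S[y]. If Q were zero, each of its coefficients would be a relation for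
    y over S, hence trivial, and P would be trivial as well. *)
Lemma acl_exchange S x y :
  acl (S `|` [set x]) y -> ~ acl S y -> acl (S `|` [set y]) x.
Proof.
move=> [p [p0 hp py]] nSy.
have /choice[f hf] : forall i, exists g : {poly K},
    (forall j, rgen S g`_j) /\ g.[x] = p`_i.
  by move=> i; have [g h1 h2] := rgen_adjoin (hp i); exists g.
pose Q := \sum_(i < size p) y ^+ i *: f i.
have [Q0|Q0] := eqVneq Q 0; last first.
  exists Q; split=> //.
  - move=> j; rewrite coef_sum; apply: rgen_sum => i _; rewrite coefZ.
    apply: rgen_M; first by apply: rgen_X; apply: rgen_in; right.
    by apply: (@rgen_mono _ S); [left|apply: (hf i).1].
  - have /rootP := py; rewrite horner_coef => e.
    apply/rootP; rewrite horner_sum -[RHS]e; apply: eq_bigr => i _.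
    by rewrite hornerZ (hf i).2 mulrC.
case/negP: p0; apply/eqP/polyP => i; rewrite coef0.
have [h|h] := ltnP i (size p); last by rewrite nth_default.
rewrite -(hf i).2; suff -> : f i = 0 by rewrite horner0.
apply/polyP => j; rewrite coef0.
pose g := \poly_(k < size p) (f k)`_j.
have [g0|g0] := eqVneq g 0.
  by have := coef_poly (size p) (fun k => (f k)`_j) i; rewrite -/g g0 coef0 h.
case: nSy; exists g; split=> //.
- by move=> k; rewrite coef_poly; case: ifP => _; [apply: (hf k).1|apply: rgen_0].
- apply/rootP; rewrite horner_poly.
  have := congr1 (fun q : {poly K} => q`_j) Q0; rewrite coef0 coef_sum => e; rewrite -[RHS]e.
  by apply: eq_bigr => k _; rewrite coefZ mulrC.
Qed.

End Acl.

Lemma countable_seqs (T : eqType) (C : set T) : countable C ->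
  countable [set s : seq T | forall x, x \in s -> C x].
Proof.
move=> /countable_injP[f finj]; apply/countable_injP.
exists (fun s => pickle (map f s)) => s t; rewrite !inE /= => sC tC.
move=> /(pcan_inj pickleK).
elim: s t sC tC => [|a s IH] [|b t] //= sC tC [eab est]; congr (_ :: _).
  by apply: finj => //; rewrite inE; [apply: sC|apply: tC]; rewrite inE eqxx.
by apply: IH => // x xs; [apply: sC|apply: tC]; rewrite inE xs orbT.
Qed.

Lemma acl_countable (K : closedFieldType) (S : set K) :
  countable S -> countable (acl S).
Proof.
move=> cS.
pose C := [set p : {poly K} | p != 0 /\ forall i, rgen S p`_i].
have cC : countable C.
  have /countable_injP[f finj] := countable_seqs (rgen_countable cS).
  have polyC p : C p -> polyseq p \in [set s : seq K | forall x, x \in s -> rgen S x].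
    by move=> [_ hp]; rewrite inE => x /(nthP 0)[i _ <-].
  apply/countable_injP; exists (fun p : {poly K} => f p) => p q.
  rewrite [p \in _]inE [q \in _]inE => /asboolP Cp /asboolP Cq /(finj _ _ (polyC p Cp) (polyC q Cq)).
  exact: val_inj.
have : countable (\bigcup_(p in C) [set y | root p y]).
  apply: bigcup_countable => // p [p0 _].
  have [r er] := closed_field_poly_normal p.
  apply: (@countable_sub _ _ [set` r]); last by apply: finite_set_countable.
  by move=> y /=; rewrite er rootZ ?lead_coef_eq0 // root_prod_XsubC.
by apply: countable_sub => y [p [p0 hp py]]; exists p.
Qed.

(** * Partial isomorphisms between two fields *)

Definition dom (U V : Type) (R : U * V -> Prop) : set U := [set x | exists y, R (x, y)].
Definition ran (U V : Type) (R : U * V -> Prop) : set V := [set y | exists x, R (x, y)].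

Section Graph.
Variables (F F' : fieldType).
Local Notation FF := (F * F')%type.
Implicit Type R : subfield FF.

Section One.
Variable R : subfield FF.

(** A nonzero pair in R is a unit, so neither of its coordinates is zero.
    Hence the two projections of R are injective. *)
Lemma graph_0 x x' : R (x, x') -> (x = 0) <-> (x' = 0).
Proof.
move=> Rx; have [e|ne] := eqVneq (x, x') 0; first by case: e => -> ->.
have /andP[/= ux ux'] := sf_unit Rx ne.
by split=> e; [move: ux|move: ux']; rewrite e unitr0.
Qed.

Lemma pairV (b1 : F) (b2 : F') : ((b1, b2) : FF) \is a GRing.unit ->
  ((b1, b2) : FF)^-1 = (b1^-1, b2^-1).
Proof.
move=> u; apply: (mulrI u); rewrite mulrV //.
by have /andP[/= u1 u2] := u; congr (_, _) => /=; rewrite mulrV.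
Qed.

Definition pr1 (z : sf_type R) : F := (sfval z).1.
Definition pr2 (z : sf_type R) : F' := (sfval z).2.
Lemma pr1_B : zmod_morphism pr1. Proof. by []. Qed.
Lemma pr1_M : monoid_morphism pr1. Proof. by []. Qed.
Lemma pr2_B : zmod_morphism pr2. Proof. by []. Qed.
Lemma pr2_M : monoid_morphism pr2. Proof. by []. Qed.
HB.instance Definition _ := GRing.isZmodMorphism.Build _ _ pr1 pr1_B.
HB.instance Definition _ := GRing.isMonoidMorphism.Build _ _ pr1 pr1_M.
HB.instance Definition _ := GRing.isZmodMorphism.Build _ _ pr2 pr2_B.
HB.instance Definition _ := GRing.isMonoidMorphism.Build _ _ pr2 pr2_M.

Lemma graph_pr (z : sf_type R) : R (pr1 z, pr2 z).
Proof. by have := sfP z; rewrite /pr1 /pr2; case: (sfval z). Qed.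
Lemma dom_pr1 z : dom R (pr1 z).
Proof. by exists (pr2 z); apply: graph_pr. Qed.
Lemma ran_pr2 z : ran R (pr2 z).
Proof. by exists (pr1 z); apply: graph_pr. Qed.

Lemma graph_lift x x' : R (x, x') -> exists z : sf_type R, pr1 z = x /\ pr2 z = x'.
Proof. by move=> h; exists (sf_sub h). Qed.

Lemma rgen_dom : rgen (dom R) `<=` dom R.
Proof.
apply: rgen_least => //; first by exists 1; apply: (sf_1 R).
- by move=> a b [a' ha] [b' hb]; exists (a' - b'); apply: (sf_B ha hb).
- by move=> a b [a' ha] [b' hb]; exists (a' * b'); apply: (sf_M ha hb).
Qed.

Lemma lift_pr1 (p : {poly F}) : (forall i, dom R p`_i) ->
  exists q : {poly sf_type R}, map_poly pr1 q = p.
Proof.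
move=> hp; have /choice[z hz] : forall i, exists z : sf_type R, pr1 z = p`_i.
  by move=> i; have [x' h] := hp i; have [z [h1 _]] := graph_lift h; exists z.
exists (\poly_(i < size p) z i).
apply/polyP=> i; rewrite coef_map coef_poly; case: ifP => [_|]; first exact: hz.
by move=> /negbT; rewrite -leqNgt => /(nth_default 0) ->; rewrite raddf0.
Qed.

Lemma acl_dom x : acl (dom R) x <->
  exists2 q : {poly sf_type R}, q != 0 & root (map_poly pr1 q) x.
Proof.
split=> [[p [p0 hp px]]|[q q0 qx]].
  have [|q qp] := @lift_pr1 p; first by move=> i; apply: rgen_dom.
  by exists q; rewrite ?qp //; apply: contra_neq p0 => q0; rewrite -qp q0 raddf0.
exists (map_poly pr1 q); split=> //; first by rewrite map_poly_eq0.
by move=> i; rewrite coef_map; apply: rgen_in; apply: dom_pr1.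
Qed.

Lemma acl_ran_root x' (q : {poly sf_type R}) : q != 0 ->
  root (map_poly pr2 q) x' -> acl (ran R) x'.
Proof.
move=> q0 qx; exists (map_poly pr2 q); split=> //; first by rewrite map_poly_eq0.
by move=> i; rewrite coef_map; apply: rgen_in; apply: ran_pr2.
Qed.
End One.

Section FracGraph.
Variables (T : set FF).
Hypotheses (T1 : T 1) (TB : forall a b, T a -> T b -> T (a - b))
  (TM : forall a b, T a -> T b -> T (a * b))
  (T0 : forall x x', T (x, x') -> x = 0 <-> x' = 0).

(** The fractions of a subring T on which the two coordinates vanish
    simultaneously form a partial isomorphism. *)
Lemma frac_graph : exists R : subfield FF,
  [/\ T `<=` R, dom R `<=` acl (dom T) & ran R `<=` acl (ran T)].
Proof.
have TU (a : FF) : T a -> a != 0 -> a \is a GRing.unit.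
  case: a => x x' Tx ne; have h := T0 Tx.
  have x0 : x != 0.
    by apply: contra_neq ne => e; rewrite e (h.1 e).
  have x'0 : x' != 0 by apply: contra_neq x0 => e; rewrite (h.2 e).
  by apply/andP; rewrite !unitfE.
exists (frac_subfield T1 TB TM TU); split.
- exact: fracs_sub.
- move=> x [x' [[a1 a2] [[b1 b2] [Ta Tb b0 e]]]].
  have u := TU _ Tb b0.
  have -> : x = a1 / b1.
    by rewrite pairV // in e; case: e.
  by apply: acl_M; [|apply: acl_V]; apply: acl_in; eexists; eauto.
- move=> x [x' [[a1 a2] [[b1 b2] [Ta Tb b0 e]]]].
  have u := TU _ Tb b0.
  have -> : x = a2 / b2.
    by rewrite pairV // in e; case: e.
  by apply: acl_M; [|apply: acl_V]; apply: acl_in; eexists; eauto.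
Qed.
End FracGraph.

Definition extends R (R1 : subfield FF) x x' :=
  [/\ (R : set FF) `<=` R1, R1 (x, x'), dom R1 `<=` acl (dom R `|` [set x])
    & ran R1 `<=` acl (ran R `|` [set x'])].

(** The evaluations of corresponding polynomials at x and x' form a subring of
    the product, whose fractions are the required extension. *)
Lemma graph_adjoin R x x' :
  (forall q : {poly sf_type R},
     root (map_poly (@pr1 R) q) x <-> root (map_poly (@pr2 R) q) x') ->
  exists R1, extends R R1 x x'.
Proof.
move=> H; pose f (q : {poly sf_type R}) : FF :=
  ((map_poly (@pr1 R) q).[x], (map_poly (@pr2 R) q).[x']).
have f1 : f 1 = 1 by rewrite /f !rmorph1 !hornerC.
have fB p q : f (p - q) = f p - f q.
  by rewrite /f !rmorphB !hornerD !hornerN.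
have fM p q : f (p * q) = f p * f q.
  by rewrite /f !rmorphM !hornerM.
have fC z : f z%:P = sfval z.
  by rewrite /f !map_polyC !hornerC [RHS]surjective_pairing.
have fX : f 'X = (x, x') by rewrite /f !map_polyX !hornerX.
have [||||R1 [TR dR rR]] := @frac_graph (range f).
- by exists 1.
- by move=> _ _ [p _ <-] [q _ <-]; exists (p - q).
- by move=> _ _ [p _ <-] [q _ <-]; exists (p * q).
- move=> a a' [q _ [<- <-]]; have [h1 h2] := H q.
  by split=> /eqP e; apply/eqP; [apply: h1|apply: h2].
exists R1; split.
- by move=> z hz; apply: TR; exists (sf_sub hz)%:P => //; rewrite fC.
- by apply: TR; exists 'X.
- apply: (subset_trans dR); apply: acl_sub => a [a' [q _ [<- _]]].
  rewrite horner_coef; apply: acl_sum => i _; apply: acl_M; last first.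
    by apply: acl_rgen; apply: rgen_X; apply: rgen_in; right.
  by apply: acl_in; left; rewrite coef_map; apply: dom_pr1.
- apply: (subset_trans rR); apply: acl_sub => a' [a [q _ [_ <-]]].
  rewrite horner_coef; apply: acl_sum => i _; apply: acl_M; last first.
    by apply: acl_rgen; apply: rgen_X; apply: rgen_in; right.
  by apply: acl_in; left; rewrite coef_map; apply: ran_pr2.
Qed.

Lemma graph_adjoin_trans R x x' : ~ acl (dom R) x -> ~ acl (ran R) x' ->
  exists R1, extends R R1 x x'.
Proof.
move=> nx nx'; apply: graph_adjoin => q; have [->|q0] := eqVneq q 0.
  by rewrite !raddf0 !root0.
split=> h; first by case: nx; apply/acl_dom; exists q.
by case: nx'; apply: acl_ran_root h.
Qed.

End Graph.

(** For x' one takes a root of the image of a polynomial of least degree that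
    vanishes at x. *)
Lemma graph_adjoin_alg (F : fieldType) (F' : closedFieldType)
    (R : subfield (F * F')%type) x : acl (dom R) x ->
  exists x' R1, acl (ran R) x' /\ extends R R1 x x'.
Proof.
move=> /acl_dom[q0 q00 q0x].
pose P n := `[< exists q : {poly sf_type R},
  [/\ q != 0, root (map_poly (@pr1 _ _ R) q) x & size q = n] >].
have exP : exists n, P n by exists (size q0); apply/asboolP; exists q0.
case: (ex_minnP exP) => n /asboolP[p [p0 px sp]] minp.
have minq q : q != 0 -> root (map_poly (@pr1 _ _ R) q) x -> (size p <= size q)%N.
  by move=> h1 h2; rewrite sp; apply: minp; apply/asboolP; exists q.
have sp1 : size p != 1%N.
  apply/eqP => s1; have /size_poly1P[c c0 e] : size p == 1%N by apply/eqP.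
  by move: px; rewrite e map_polyC rootC fmorph_eq0 (negPf c0).
have [x' px'] : exists x', root (map_poly (@pr2 _ _ R) p) x'.
  by apply/closed_rootP; rewrite size_map_poly.
have [|R1 hR1] := @graph_adjoin _ _ R x x'; last first.
  by exists x', R1; split=> //; apply: acl_ran_root px'.
move=> q.
have dv1 (r : {poly sf_type R}) : p %| r -> root (map_poly (@pr1 _ _ R) r) x.
  by move=> /dvdpP[s ->]; rewrite rmorphM rootM px orbT.
have dv2 (r : {poly sf_type R}) : p %| r -> root (map_poly (@pr2 _ _ R) r) x'.
  by move=> /dvdpP[s ->]; rewrite rmorphM rootM px' orbT.
have root_dv r : root (map_poly (@pr1 _ _ R) r) x -> p %| r.
  move=> rx; have [e|h] := eqVneq (r %% p) 0; first by apply/modp_eq0P.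
  suff /(minq _ h) : root (map_poly (@pr1 _ _ R) (r %% p)) x.
    by rewrite leqNgt ltn_modp p0.
  move: rx; rewrite {1}(divp_eq r p) rmorphD rmorphM rootE hornerD hornerM.
  by rewrite (rootP px) mulr0 add0r.
split=> [/root_dv/dv2 //|qx'].
have [//|/negP nqx] := boolP (root (map_poly (@pr1 _ _ R) q) x).
(* p is irreducible by minimality, hence coprime to any q it does not divide *)
suff cpq : coprimep p q.
  have := cpq; rewrite -(coprimep_map (@pr2 _ _ R)) => /coprimep_root /(_ px').
  by rewrite (rootP qx') eqxx.
have /dvdpP[s ps] := dvdp_gcdl p q.
have /dvdpP[t qt] := dvdp_gcdr p q.
have s0 : s != 0 by apply: contra_neq p0 => e; rewrite ps e mul0r.
have g0 : gcdp p q != 0 by rewrite gcdp_eq0 (negPf p0).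
move: (px); rewrite {1}ps rmorphM rootM => /orP[sx|gx].
  have := minq _ s0 sx; rewrite {1}ps size_mul // /coprimep.
  have : (0 < size (gcdp p q))%N by rewrite size_poly_gt0.
  have : (0 < size s)%N by rewrite size_poly_gt0.
  case: (size s) => // a _; case: (size (gcdp p q)) => // b _.
  by rewrite addnS /= addSn ltnS -{2}[a]addn0 leq_add2l leqn0 => /eqP ->.
by case: nqx; rewrite qt rmorphM rootM gx orbT.
Qed.

Section Swap.
Variables (F F' : fieldType) (R : subfield (F * F')%type).

Definition swap_graph : subfield (F' * F)%type.
Proof.
exists (fun z => R (z.2, z.1)).
- exact: (sf_1 R).
- by move=> [a a'] [b b'] ha hb; exact: (sf_B ha hb).
- by move=> [a a'] [b b'] ha hb; exact: (sf_M ha hb).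
- move=> [a a'] /= h; have [[-> ->]|ne] := eqVneq ((a', a) : F * F') 0.
    have -> : ((0, 0) : F' * F)^-1 = 0 by exact: (@invr0 (F' * F)%type).
    by have := sf_B (sf_1 R) (sf_1 R); rewrite subrr.
  have u := sf_unit h ne; have /andP[/= u1 u2] := u.
  have := sf_V h; rewrite !pairV //.
  by apply/andP.
- move=> [a a'] /= h ne.
  have /andP[u1 u2] : ((a', a) : F * F') \is a GRing.unit.
    by apply: (sf_unit h); apply: contra_neq ne => -[-> ->].
  by apply/andP.
Defined.
End Swap.

Section GraphAcl.
Variables (F F' : closedFieldType) (R : subfield (F * F')%type).
Local Notation FF := (F * F')%type.

(** In an extension that is maximal among those algebraic on both sides,
    graph_adjoin_alg and its mirror image leave nothing algebraic to adjoin. *)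
Lemma graph_acl : exists R1 : subfield FF,
  [/\ (R : set FF) `<=` R1, dom R1 = acl (dom R) & ran R1 = acl (ran R)].
Proof.
(* The empty set is the union of the empty chain. *)
pose P (A : set FF) := A = set0 \/ exists R1 : subfield FF, [/\ A = R1,
  (R : set FF) `<=` R1, dom R1 `<=` acl (dom R) & ran R1 `<=` acl (ran R)].
have [|A [PA maxA]] := @Zorn_bigcup _ P.
  move=> C CP totC.
  have [[A0 CA0 nA0]|nC] := pselect (exists2 A0, C A0 & A0 <> set0); last first.
    left; apply/seteqP; split=> // z [A CA Az]; case: nC; exists A => // e.
    by rewrite e in Az.
  right.
  have CR A : C A -> A <> set0 -> exists R1 : subfield FF, [/\ A = R1,
     (R : set FF) `<=` R1, dom R1 `<=` acl (dom R) & ran R1 `<=` acl (ran R)].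
    by move=> /CP[->|].
  have in2 z1 z2 : (\bigcup_(X in C) X) z1 -> (\bigcup_(X in C) X) z2 ->
      exists2 R1 : subfield FF, C R1 & R1 z1 /\ R1 z2.
    move=> [A CA Az1] [B CB Bz2].
    have [AB|BA] := totC A B CA CB.
      have [R1 [e _ _ _]] := CR B CB (fun e => eq_ind _ (fun B : set FF => B z2) Bz2 _ e).
      by exists R1; rewrite -e //; split=> //; apply: AB.
    have [R1 [e _ _ _]] := CR A CA (fun e => eq_ind _ (fun B : set FF => B z1) Az1 _ e).
    by exists R1; rewrite -e //; split=> //; apply: BA.
  have [R0 [e0 RR0 _ _]] := CR _ CA0 nA0.
  unshelve eexists (@Subfield _ (\bigcup_(X in C) X) _ _ _ _ _).
  - by exists A0 => //; rewrite e0; apply: (sf_1 R0).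
  - move=> a b ha hb; have [R1 C1 [h1 h2]] := in2 _ _ ha hb.
    by exists R1 => //; apply: (sf_B h1 h2).
  - move=> a b ha hb; have [R1 C1 [h1 h2]] := in2 _ _ ha hb.
    by exists R1 => //; apply: (sf_M h1 h2).
  - move=> a ha; have [R1 C1 [h1 _]] := in2 _ _ ha ha.
    by exists R1 => //; apply: (sf_V h1).
  - move=> a ha; have [R1 C1 [h1 _]] := in2 _ _ ha ha.
    exact: (sf_unit h1).
  split=> //=.
  - by move=> z Rz; exists A0 => //; rewrite e0; apply: RR0.
  - move=> x [x' [A CA Az]].
    have [R1 [e _ dR _]] := CR A CA (fun e => eq_ind _ (fun B : set FF => B (x, x')) Az _ e).
    by apply: dR; exists x'; rewrite -e.
  - move=> x' [x [A CA Az]].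
    have [R1 [e _ _ rR]] := CR A CA (fun e => eq_ind _ (fun B : set FF => B (x, x')) Az _ e).
    by apply: rR; exists x; rewrite -e.
have PR : P R by right; exists R; split=> //; apply: acl_in.
case: PA => [A0|[R1 [eA RR1 dR1 rR1]]].
  case: (maxA R _ PR); rewrite A0; split=> // /(_ 1); apply.
  exact: (sf_1 R).
have step (R2 : subfield FF) x x' : acl (dom R) x -> acl (ran R) x' ->
    extends R1 R2 x x' -> R1 (x, x').
  move=> hx hx' [R12 R2x d2 r2].
  apply: contrapT => nR1; case: (maxA R2).
    by rewrite eA; split=> // /(_ (x, x')) /(_ R2x).
  right; exists R2; split=> //.
  - exact: subset_trans R12.
  - apply: (subset_trans d2); apply: acl_sub => z [/dR1 //|->//].
  - apply: (subset_trans r2); apply: acl_sub => z [/rR1 //|->//].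
exists R1; split=> //.
- apply/seteqP; split=> // x hx.
  have hx1 : acl (dom R1) x.
    by apply: acl_mono hx => z [z' Rz]; exists z'; apply: RR1.
  have [x' [R2 [hx' ext]]] := graph_adjoin_alg hx1.
  exists x'; apply: (step R2) ext => //.
  by apply: acl_sub hx'.
- apply/seteqP; split=> // x' hx'.
  have hx1 : acl (dom (swap_graph R1)) x'.
    by apply: acl_mono hx' => z' [z Rz]; exists z; apply: RR1.
  have [x [R2 [hx [e1 e2 e3 e4]]]] := graph_adjoin_alg hx1.
  exists x; apply: (step (swap_graph R2)) => //.
  - by apply: acl_sub hx.
  - by split=> // -[z z'] Rz; apply: e1.
Qed.

End GraphAcl.

Section GraphOperations.
Variables (F F' : fieldType) (R : subfield (F * F')%type).

Lemma graph_fun x y y' : R (x, y) -> R (x, y') -> y = y'.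
Proof.
move=> h h'; have : R (x - x, y - y') := sf_B h h'.
by move=> /graph_0[e _]; apply/eqP; rewrite -subr_eq0 e // subrr.
Qed.

Lemma graph_eq x y x' y' : R (x, x') -> R (y, y') -> x = y <-> x' = y'.
Proof.
move=> h h'; have : R (x - y, x' - y') := sf_B h h'.
move=> /graph_0[e1 e2]; split=> /eqP; rewrite -subr_eq0 => /eqP.
  by move=> /e1/eqP; rewrite subr_eq0 => /eqP.
by move=> /e2/eqP; rewrite subr_eq0 => /eqP.
Qed.

Lemma graph_div x y x' y' : R (x, x') -> R (y, y') -> R (x / y, x' / y').
Proof.
move=> h h'; have [y0|y0] := eqVneq y 0.
  have /graph_0[/(_ y0) y'0 _] := h'.
  by rewrite y0 y'0 !invr0 !mulr0; have := sf_B h h; rewrite subrr.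
have ne : ((y, y') : (F * F')%type) != 0 by apply: contra_neq y0 => -[].
have := sf_M h (sf_V h'); rewrite pairV //; exact: sf_unit h' ne.
Qed.

Lemma graph_0in : R 0.
Proof. by have := sf_B (sf_1 R) (sf_1 R); rewrite subrr. Qed.

Lemma graph_D z z' : R z -> R z' -> R (z + z').
Proof.
move=> h h'; rewrite -[z']opprK; apply: sf_B => //.
by rewrite -sub0r; apply: sf_B => //; apply: graph_0in.
Qed.

Lemma graph_sum (T : Type) (l : seq T) (P : pred T) (a : T -> F) (a' : T -> F') :
  (forall s, P s -> R (a s, a' s)) ->
  R (\sum_(s <- l | P s) a s, \sum_(s <- l | P s) a' s).
Proof.
move=> h; apply: (big_ind2 (fun x x' => R (x, x'))) => //; first exact: graph_0in.
by move=> x x' y y' hx hy; exact: (graph_D hx hy).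
Qed.
End GraphOperations.

(** * Isolated multiplicative subgroups *)

Definition uncountable (T : Type) := forall C : set T, countable C -> exists x, ~ C x.

Section Isolated.
Variable F : closedFieldType.
Implicit Types (S H : set F) (x y z : F).

(** The nonzero elements of H form a subgroup of the multiplicative group with
    torsion-free quotient. As F is algebraically closed, its multiplicative
    group modulo torsion is a rational vector space, and the isolated H are
    its subspaces. *)
Record isolated H : Prop := Isolated {
  iso0 : H 0;
  iso1 : H 1;
  isoM : forall a b, H a -> H b -> H (a * b);
  isoV : forall a, H a -> H a^-1;
  isoR : forall a n, H (a ^+ n.+1) -> H a }.

Lemma iso_div H a b : isolated H -> H a -> H b -> H (a / b).
Proof. by move=> iH ha hb; apply: (isoM iH) => //; apply: (isoV iH). Qed.

Lemma iso_divl H a b : isolated H -> b != 0 -> H b -> H (a / b) -> H a.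
Proof. by move=> iH b0 hb hab; rewrite -[a](divfK b0); apply: (isoM iH). Qed.

Lemma isoX H a n : isolated H -> H a -> H (a ^+ n).
Proof.
move=> iH ha; elim: n => [|n IH]; first by rewrite expr0; apply: (iso1 iH).
by rewrite exprS; apply: (isoM iH).
Qed.

Lemma isoZ H a (k : int) : isolated H -> H a -> H (a ^ k).
Proof.
move=> iH ha; case: k => n; first exact: isoX.
by apply: (isoV iH); apply: (isoX n.+1).
Qed.

Lemma iso_rootZ H a (k : int) : isolated H -> k != 0 -> H (a ^ k) -> H a.
Proof.
move=> iH; case: k => [[|n]|n] // _; first exact: (isoR iH).
by move=> /(isoV iH); rewrite /exprz invrK; apply: (isoR iH).
Qed.

Lemma nth_rootE (x : F) n : exists y, y ^+ n.+1 = x.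
Proof.
have : size ('X^(n.+1) - x%:P : {poly F}) != 1%N.
  by rewrite size_XnsubC.
move=> /closed_rootP[y]; rewrite rootE !hornerE subr_eq0 => /eqP h.
by exists y.
Qed.

Lemma acl_isolated S : isolated (acl S).
Proof.
split; [exact: acl_0|exact: acl_1|exact: acl_M|exact: acl_V|].
move=> a n han; apply: (@acl_root _ _ ('X^(n.+1) - (a ^+ n.+1)%:P)).
- by rewrite -size_poly_gt0 size_XnsubC.
- move=> i; rewrite coefB coefXn coefC; apply: acl_B.
    by case: eqP => _; [exact: acl_1|exact: acl_0].
  by case: eqP => _ //; exact: acl_0.
- by rewrite rootE !hornerE subrr.
Qed.

Definition hull S : set F := [set x | forall H, isolated H -> S `<=` H -> H x].

Lemma hull_iso S : isolated (hull S).
Proof.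
split=> [H iH _|H iH _|a b ha hb H iH SH|a ha H iH SH|a n ha H iH SH].
- exact: (iso0 iH).
- exact: (iso1 iH).
- by apply: (isoM iH); [apply: ha|apply: hb].
- by apply: (isoV iH); apply: ha.
- by apply: (@isoR _ iH _ n); apply: ha.
Qed.

Lemma hull_in S : S `<=` hull S.
Proof. by move=> x Sx H _; apply. Qed.

Lemma hull_least S H : isolated H -> S `<=` H -> hull S `<=` H.
Proof. by move=> iH SH x; apply. Qed.

Lemma hull_countable S : countable S -> countable (hull S).
Proof.
move=> /acl_countable; apply: countable_sub.
by apply: hull_least; [exact: acl_isolated|exact: acl_in].
Qed.

(** The explicit form of the hull of H and z. *)
Definition hull1 H z : set F :=
  [set y | y = 0 \/ exists n k c, [/\ H c, c != 0 & y ^+ n.+1 = z ^ k * c]].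

Lemma hull1_iso H z : isolated H -> z != 0 -> isolated (hull1 H z).
Proof.
move=> iH z0; split.
- by left.
- by right; exists 0%N, 0, 1; rewrite oner_neq0 expr1 expr0z mul1r; split=> //; apply: (iso1 iH).
- move=> a b [->|[n1 [k1 [c1 [h1 c10 e1]]]]]; first by left; rewrite mul0r.
  move=> [->|[n2 [k2 [c2 [h2 c20 e2]]]]]; first by left; rewrite mulr0.
  right; exists (n1.+1 * n2.+1).-1, (k1 * n2.+1%:Z + k2 * n1.+1%:Z),
    (c1 ^+ n2.+1 * c2 ^+ n1.+1); split.
  + by apply: (isoM iH); apply: isoX.
  + by rewrite mulf_neq0 ?expf_neq0.
  rewrite prednK ?muln_gt0 // exprMn {1}exprM [in b ^+ _]mulnC exprM e1 e2.
  by rewrite !exprMn expfzDr // -!exprz_exp -!exprnP mulrACA.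
- move=> a [->|[n1 [k1 [c1 [h1 c10 e1]]]]]; first by left; rewrite invr0.
  right; exists n1, (- k1), c1^-1; split; [exact: (isoV iH)|by rewrite invr_neq0|].
  by rewrite exprVn e1 invfM -invr_expz.
- move=> a n [/eqP|[n1 [k1 [c1 [h1 c10 e1]]]]].
    by rewrite expf_eq0 => /andP[_ /eqP ->]; left.
  right; exists (n.+1 * n1.+1).-1, k1, c1; split=> //.
  by rewrite prednK ?muln_gt0 // exprM.
Qed.

Lemma hull1_sub H z : isolated H -> H `<=` hull1 H z.
Proof.
move=> iH x hx; have [->|x0] := eqVneq x 0; first by left.
by right; exists 0%N, 0, x; rewrite expr0z expr1 mul1r.
Qed.

Lemma hull1_in H z : isolated H -> hull1 H z z.
Proof.
move=> iH; right; exists 0%N, 1, 1; rewrite oner_neq0 expr1z mulr1 expr1.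
by split=> //; apply: (iso1 iH).
Qed.

Lemma hull1_exchange H z y : isolated H -> z != 0 -> hull1 H z y -> ~ H y ->
  hull1 H y z.
Proof.
move=> iH z0 [->|[n [k [c [hc c0 e]]]]] nHy; first by case: nHy; apply: (iso0 iH).
have k0 : k != 0.
  apply: contra_notN nHy => /eqP k0; apply: (@isoR _ iH _ n).
  by rewrite e k0 expr0z mul1r.
have ek : z ^ k = y ^+ n.+1 / c by rewrite e mulfK.
right; case: k k0 ek {e} => [[|k]|k] // _ ek.
  exists k, n.+1, c^-1; split; [exact: (isoV iH)|by rewrite invr_neq0|].
  exact: ek.
exists k, (- n.+1%:Z), c; split=> //.
by rewrite -[LHS]invrK -[(_ ^+ k.+1)^-1]/(z ^ Negz k) ek invfM invrK -exprnN.
Qed.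

Lemma hullU1 S z y : hull (S `|` [set z]) y -> z != 0 -> hull1 (hull S) z y.
Proof.
move=> h z0; apply: h; first exact: hull1_iso (hull_iso S) z0.
move=> x [Sx|->]; last by apply: hull1_in; apply: hull_iso.
by apply: hull1_sub; [exact: hull_iso|exact: hull_in].
Qed.

Lemma hull1_hull S z y : z != 0 -> hull1 (hull S) z y -> hull (S `|` [set z]) y.
Proof.
move=> z0 hy H iH SzH.
have Hz : H z by apply: SzH; right.
case: hy => [->|[n [k [c [hc c0 e]]]]]; first exact: (iso0 iH).
apply: (@isoR _ iH _ n); rewrite e; apply: (isoM iH); first exact: isoZ.
by apply: hc => // x Sx; apply: SzH; left.
Qed.

Lemma hull_exchange S z y : hull (S `|` [set z]) y -> ~ hull S y ->
  hull (S `|` [set y]) z.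
Proof.
move=> h nSy; have [->|z0] := eqVneq z 0; first exact: (iso0 (hull_iso _)).
have y0 : y != 0.
  by apply: contra_notN nSy => /eqP ->; apply: (iso0 (hull_iso _)).
by apply: hull1_hull => //; apply: hull1_exchange (hullU1 h z0) nSy => //; apply: hull_iso.
Qed.

(** In the rational vector space attached to F modulo H0, a subspace that is
    maximal among those avoiding rho is a hyperplane, and rho spans a
    complement. *)
Lemma max_isolated H0 rho : isolated H0 -> ~ H0 rho ->
  exists H, [/\ isolated H, H0 `<=` H, ~ H rho &
    forall z, z != 0 -> exists n k c, [/\ H c, c != 0 & z ^+ n.+1 = rho ^ k * c]].
Proof.
move=> iH0 nH0.
have rho0 : rho != 0 by apply: contra_notN nH0 => /eqP ->; apply: (iso0 iH0).
(* The empty set is the union of the empty chain. *)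
pose P (H : set F) := H = set0 \/ [/\ isolated H, H0 `<=` H & ~ H rho].
have [|H [PH maxH]] := @Zorn_bigcup _ P.
  move=> C CP totC.
  have [[A CA nA]|nC] := pselect (exists2 A0, C A0 & A0 <> set0); last first.
    left; apply/seteqP; split=> // z [A CA Az]; case: nC; exists A => // e.
    by rewrite e in Az.
  right.
  have CR B z : C B -> B z -> [/\ isolated B, H0 `<=` B & ~ B rho].
    by move=> /CP[->|].
  have CI B z : C B -> B z -> isolated B by move=> h1 /(CR _ _ h1)[].
  have CA' : [/\ isolated A, H0 `<=` A & ~ A rho] by case: (CP _ CA).
  case: CA' => iA HA _; split.
  - split.
    + by exists A => //; apply: (iso0 iA).
    + by exists A => //; apply: (iso1 iA).
    + move=> a b [B CB Ba] [D CD Db]; have [BD|DB] := totC B D CB CD.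
        by exists D => //; apply: (isoM (CI _ _ CD Db)) => //; apply: BD.
      by exists B => //; apply: (isoM (CI _ _ CB Ba)) => //; apply: DB.
    + by move=> a [B CB Ba]; exists B => //; apply: (isoV (CI _ _ CB Ba)).
    + by move=> a n [B CB Ba]; exists B => //; apply: (@isoR _ (CI _ _ CB Ba) _ n).
  - by move=> x Hx; exists A => //; apply: HA.
  - by move=> [B CB Br]; case: (CR _ _ CB Br).
case: PH => [He|[iH H0H nHr]].
  case: (maxH H0); last by right; split.
  by rewrite He; split=> // /(_ 1); apply; apply: (iso1 iH0).
exists H; split=> // z z0.
have [hz|nhz] := pselect (H z).
  by exists 0%N, 0, z; rewrite expr0z expr1 mul1r.
have nPz : ~ P (hull1 H z).
  apply: maxH; split; last by move=> /(_ z (hull1_in z iH)).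
  exact: hull1_sub.
have hr : hull1 H z rho.
  apply: contrapT => nr; apply: nPz; right; split=> //; first exact: hull1_iso.
  exact: (subset_trans H0H (hull1_sub z iH)).
by have [e|//] := hull1_exchange iH z0 hr nHr; rewrite e eqxx in z0.
Qed.

Fixpoint mult_indep H (ts : seq F) : Prop :=
  if ts is t :: ts' then ~ H t /\ mult_indep (hull (H `|` [set t])) ts' else True.

Lemma mult_indep_notin H ts t : isolated H -> mult_indep H ts -> t \in ts -> ~ H t.
Proof.
elim: ts H => //= a ts IH H iH [na hts]; rewrite inE => /orP[/eqP -> //|tts] Ht.
by apply: (IH _ (hull_iso _) hts tts); apply: hull_in; left.
Qed.

Lemma mult_indep_uniq H ts : isolated H -> mult_indep H ts -> uniq ts.
Proof.
elim: ts H => //= a ts IH H iH [na hts]; rewrite (IH _ (hull_iso _) hts) andbT.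
apply/negP => /(mult_indep_notin (hull_iso _) hts); apply.
by apply: hull_in; right.
Qed.

Lemma mult_indep_ratio H ts t t' : isolated H -> mult_indep H ts ->
  t \in ts -> t' \in ts -> H (t / t') -> t = t'.
Proof.
elim: ts H => //= a ts IH H iH [na hts].
have iH' := hull_iso (H `|` [set a]).
have Ha : hull (H `|` [set a]) a by apply: hull_in; right.
have HH x : H x -> hull (H `|` [set a]) x by move=> Hx; apply: hull_in; left.
have a0 : a != 0 by apply: contra_notN na => /eqP ->; apply: (iso0 iH).
rewrite !inE => /orP[/eqP ->|ht] /orP[/eqP ->|ht'] // hr.
- case: (mult_indep_notin iH' hts ht'); rewrite -[t']invrK; apply: (isoV iH').
  apply: (iso_divl iH' (_ : a^-1 != 0)); rewrite ?invr_neq0 //; first exact: (isoV iH').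
  by rewrite invrK mulrC; apply: HH.
- case: (mult_indep_notin iH' hts ht).
  by apply: (iso_divl iH' a0 Ha); apply: HH.
- exact: (IH _ iH' hts ht ht' (HH _ hr)).
Qed.

Lemma hull_split H (xs : seq F) t : hull (H `|` [set` xs]) t -> ~ hull H t ->
  exists xs1 x xs2, [/\ xs = xs1 ++ x :: xs2, hull (H `|` [set` xs1] `|` [set x]) t
    & ~ hull (H `|` [set` xs1]) t].
Proof.
elim/last_ind: xs => [|xs x IH] ht nt.
  by case: nt; apply: hull_least ht; [exact: hull_iso|move=> z [|//]; exact: hull_in].
have [h|nh] := pselect (hull (H `|` [set` xs]) t).
  have [xs1 [y [xs2 [-> h1 h2]]]] := IH h nt.
  by exists xs1, y, (rcons xs2 x); rewrite rcons_cat rcons_cons.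
exists xs, x, [::]; rewrite cats1; split=> //.
apply: hull_least ht; first exact: hull_iso.
move=> z [hz|/=]; first by apply: hull_in; left; left.
rewrite mem_rcons inE => /orP[/eqP ->|hz]; apply: hull_in; first by right.
by left; right.
Qed.

(** A first member t of ts can be exchanged for some x among the xs; the hull
    of H and t then replaces H. *)
Lemma steinitz H (xs ts : seq F) : mult_indep H ts ->
  isolated H -> (forall t, t \in ts -> hull (H `|` [set` xs]) t) ->
  (size ts <= size xs)%N.
Proof.
elim: ts H xs => //= t ts IH H xs [nt hts] iH hall.
have [||xs1 [x [xs2 [exs h1 h2]]]] := @hull_split H xs t.
- by apply: hall; rewrite inE eqxx.
- by move=> h; apply: nt; apply: (h H).
have hx := hull_exchange h1 h2.
rewrite exs size_cat /= addnS ltnS -size_cat; apply: (IH _ _ hts (hull_iso _)).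
move=> t' ht'; have := hall t'; rewrite inE ht' orbT => /(_ isT).
apply: hull_least; first exact: hull_iso.
have sub1 z : z \in xs1 -> hull (hull (H `|` [set t]) `|` [set` xs1 ++ xs2]) z.
  by move=> hz; apply: hull_in; right; rewrite /= mem_cat hz.
have subH z : hull (H `|` [set t]) z -> hull (hull (H `|` [set t]) `|` [set` xs1 ++ xs2]) z.
  by move=> hz; apply: hull_in; left.
move=> z [hz|/=]; first by apply: subH; apply: hull_in; left.
rewrite exs mem_cat inE => /or3P[/sub1 //|/eqP ->|hz]; last first.
  by apply: hull_in; right; rewrite /= mem_cat hz orbT.
apply: hull_least hx; first exact: hull_iso.
move=> y [[hy|/= /sub1 //]|->]; apply: subH; apply: hull_in; first by left.
by right.
Qed.

Lemma mult_indep_exists H n : uncountable F ->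
  countable H -> exists ts, mult_indep H ts /\ size ts = n.
Proof.
move=> uncF; elim: n H => [|n IH] H cH; first by exists [::].
have [t nt] := uncF _ cH.
have [|ts [h1 h2]] := IH (hull (H `|` [set t])).
  by apply: hull_countable; apply: countableU.
by exists (t :: ts); rewrite /= h2.
Qed.

End Isolated.

(** * Characters free over a pair of sets *)

Section FreeOver.
Variables (F K : closedFieldType) (chi : F -> K).
Hypothesis chiP : is_character chi.
Implicit Types (H : set F) (S : set K).

Lemma chiM a b : chi (a * b) = chi a * chi b. Proof. by case: chiP. Qed.
Lemma chi0 : chi 0 = 0. Proof. by case: chiP. Qed.
Lemma chi1 : chi 1 = 1. Proof. by case: chiP. Qed.
Lemma chi_neq0 a : a != 0 -> chi a != 0.
Proof.
move=> a0; apply/eqP => e; have := chiM a a^-1.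
by rewrite divff // chi1 e mul0r => /eqP; rewrite oner_eq0.
Qed.
Lemma chiV a : chi a^-1 = (chi a)^-1.
Proof.
have [->|a0] := eqVneq a 0; first by rewrite invr0 chi0 invr0.
apply: (mulfI (chi_neq0 a0)).
by rewrite -chiM divff ?chi1 ?divff // chi_neq0.
Qed.
Lemma chiX a n : chi (a ^+ n) = chi a ^+ n.
Proof. by elim: n => [|n IH]; rewrite ?expr0 ?chi1 // !exprS chiM IH. Qed.

(** Independence of S0 and the image of chi: over chi(H), the set S0 makes no
    further value of chi algebraic. The quantification over all isolated H
    above H0 makes the notion stable under enlarging H0 and adding values of
    chi to S0. *)
Definition free_over H0 S0 := forall H, isolated H -> H0 `<=` H ->
  forall x, acl (S0 `|` (chi @` H)) (chi x) -> H x.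

Lemma free_over_extend H0 S0 H1 S1 : free_over H0 S0 -> H0 `<=` H1 ->
  S1 `<=` acl (S0 `|` (chi @` H1)) -> free_over H1 S1.
Proof.
move=> G H01 S01 H iH H1H x hx; apply: (G H iH (subset_trans H01 H1H)).
apply: acl_sub hx => z [/S01|hz]; last by apply: acl_in; right.
by apply: acl_mono => y [|[h /H1H]]; [left|right; exists h].
Qed.

(** If the addition of y made some chi x algebraic, exchange would make y
    algebraic over S0 and the image of chi. *)
Lemma free_over_adjoin H0 S0 y : free_over H0 S0 -> ~ acl (S0 `|` range chi) y ->
  free_over H0 (S0 `|` [set y]).
Proof.
move=> G ny H iH H0H x hx; apply: contrapT => nHx.
have n1 : ~ acl (S0 `|` (chi @` H)) (chi x) by move=> /(G H iH H0H).
apply: ny; have := @acl_exchange _ (S0 `|` (chi @` H)) y (chi x).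
move=> /(_ _ n1) h; apply: acl_mono (h _).
  by move=> z [[|[h' _ <-]]|->]; [left|right; exists h'|right; exists x].
by apply: acl_mono hx => z [[]|]; [left; left|right|left; right].
Qed.

(** When P selects one class of the r s modulo H0, this is a form of linear
    independence over S0 of values of chi in distinct classes. Unions of
    classes are what the inductions below can handle. *)
Definition lin_indep_mod H0 S0 := forall (T : eqType) (l : seq T) (q : T -> K) (r : T -> F)
    (P : pred T),
  (forall s, s \in l -> S0 (q s)) -> (forall s, s \in l -> r s != 0) ->
  (forall a b, a \in l -> b \in l -> H0 (r a / r b) -> P a = P b) ->
  \sum_(s <- l) q s * chi (r s) = 0 ->
  \sum_(s <- l | P s) q s * chi (r s) = 0.

(** Finitely many elements of the rational line spanned by rho modulo H are
    integral powers of one root h of rho. *)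
Lemma common_root (T : eqType) (l : seq T) (z : T -> F) H rho :
  isolated H -> rho != 0 ->
  (forall s, s \in l -> exists n k c, [/\ H c, c != 0 & z s ^+ n.+1 = rho ^ k * c]) ->
  exists h n, h ^+ n.+1 = rho /\ forall s, s \in l -> exists e : int, H (z s / h ^ e).
Proof.
move=> iH rho0; elim: l => [|s l IH] hz; first by exists rho, 0%N.
have [|h [n [eh he]]] := IH; first by move=> t tl; apply: hz; rewrite inE tl orbT.
have [m [k [c [Hc c0 ez]]]] := hz s (mem_head _ _).
have [h' eh'] := nth_rootE h m.
have h'0 : h' != 0.
  by apply: contra_neq rho0 => e; rewrite -eh -eh' e !expr0n.
exists h', (m.+1 * n.+1).-1; split; first by rewrite prednK // exprM eh'.
move=> t; rewrite inE => /orP[/eqP ->|tl]; last first.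
  by have [e He] := he t tl; exists (m.+1%:Z * e); rewrite -exprz_exp -exprnP eh'.
exists (n.+1%:Z * k); apply: (@isoR _ _ iH _ m).
have erho : (h' ^ (n.+1%:Z * k)) ^+ m.+1 = rho ^ k.
  rewrite -eh -eh' [LHS]exprnP [(h' ^+ _) ^+ _]exprnP exprnP !exprz_exp.
  by rewrite mulrC mulrA.
rewrite expr_div_n ez erho mulrAC divff ?mul1r //.
by rewrite expfz_neq0.
Qed.

(** Induction on the number of terms. If two terms lie in different classes,
    max_isolated gives an H that separates them and modulo which all the terms
    are powers of a single h outside H. As chi h is transcendental over S0 and
    chi(H), the relation is a trivial polynomial in chi h, so the terms with
    exponent zero form a strictly shorter relation and the others another one. *)
Lemma free_lin_indep H0 S0 : isolated H0 -> free_over H0 S0 -> lin_indep_mod H0 S0.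
Proof.
move=> iH0 G T l; have [n] := ubnP (size l); elim: n l => // n IH l.
rewrite ltnS => szl q r P Sq r0 satP sum0.
have [sameP|] := pselect (forall a b, a \in l -> b \in l -> P a = P b).
  case: l sameP sum0 {szl Sq r0 satP} => [|a l] sameP sum0; first by rewrite big_nil.
  have eP s : s \in a :: l -> P s = P a by move=> h; apply: sameP; rewrite ?mem_head.
  rewrite big_seq_cond; have [Pa|nPa] := boolP (P a).
    rewrite -[RHS]sum0 [RHS]big_seq_cond; apply: eq_bigl => s.
    by rewrite andbT; case: (boolP (s \in _)) => //= /eP ->.
  by rewrite big1 // => s /andP[/eP ->]; rewrite (negPf nPa).
move=> /existsNP[a /existsNP[b /not_implyP[la /not_implyP[lb nPab]]]].
pose z s := r s / r a.
have ra0 := r0 a la.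
have z0 s : s \in l -> z s != 0 by move=> /r0 h; rewrite mulf_neq0 ?invr_neq0.
have nH0 : ~ H0 (z b) by move=> /(satP b a lb la) e; apply: nPab.
have [H [iH H0H nHr allz]] := max_isolated iH0 nH0.
have [|h [N [eh he]]] := @common_root _ l z H (z b) iH (z0 b lb).
  by move=> s sl; apply: allz; apply: z0.
have h0 : h != 0.
  by apply: contra_neq (z0 b lb) => e; rewrite -eh e expr0n.
have nHh : ~ H h by move=> Hh; apply: nHr; rewrite -eh; apply: isoX.
have Hh0 (k : int) : H (h ^ k) -> k = 0.
  by move=> hk; apply: contrapT => /eqP k0; apply: nHh; apply: iso_rootZ hk.
have /choice[e eP] : forall s, exists e : int, s \in l -> H (z s / h ^ e).
  move=> s; have [/he[e He]|ns] := boolP (s \in l); first by exists e.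
  by exists 0.
have ea : e a = 0.
  apply: Hh0; rewrite -[h ^ _]invrK; apply: (isoV iH).
  by have := eP a la; rewrite /z divff // mul1r.
have eb : e b != 0.
  apply/eqP => eb0; have := eP b lb; rewrite eb0 expr0z divr1 => /nHr //.
have esat s t : s \in l -> t \in l -> H0 (r s / r t) -> e s = e t.
  move=> sl tl /H0H hst; apply/eqP; rewrite -subr_eq0; apply/eqP/Hh0.
  have hes := eP s sl; have het := eP t tl.
  have -> : h ^ (e s - e t) = (r s / r t) * (z t / h ^ e t) / (z s / h ^ e s).
    rewrite expfzDr // /z -invr_expz.
    have := r0 s sl; have := r0 t tl; have := expfz_neq0 (e s) h0.
    have := expfz_neq0 (e t) h0; move: ra0.
    move: (h ^ e s) (h ^ e t) (r s) (r t) (r a) => u v x y w w0 v0 u0 y0 x0.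
    by field; rewrite u0 w0 x0 v0 y0.
  by apply: iso_div => //; apply: (isoM iH).
(* The term a has exponent 0 and the term b has not. *)
pose Q s := e s == 0.
have sumQ : \sum_(s <- l | Q s) q s * chi (r s) = 0.
  (* M makes all the exponents nonnegative. *)
  pose M := \sum_(s <- l) absz (e s).
  pose m s := absz (e s + M%:Z).
  have em s : s \in l -> (m s)%:Z = e s + M%:Z.
    move=> sl; have : (absz (e s) <= M)%N by rewrite /M (big_rem s sl) leq_addr.
    by rewrite /m; lia.
  pose c s := q s * chi (z s / h ^ e s).
  pose p := \sum_(s <- l) c s *: 'X^(m s).
  have p0 : p = 0.
    apply: contrapT => /eqP p0; apply: nHh; apply: (G H iH H0H).
    apply: (acl_root p0); last first.
      apply/rootP; rewrite horner_sum.
      rewrite -[RHS](mulr0 (chi (h ^+ M / r a))) -[in RHS]sum0 mulr_sumr.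
      rewrite big_seq [RHS]big_seq; apply: eq_bigr => s sl.
      rewrite hornerZ hornerXn /c -chiX -mulrA -chiM [RHS]mulrCA -chiM.
      congr (_ * chi _).
      have -> : h ^+ m s = h ^ e s * h ^+ M.
        by rewrite [h ^+ M]exprnP [LHS]exprnP em // expfzDr.
      by rewrite /z; have := expfz_neq0 (e s) h0 => h1; field; rewrite ra0.
    move=> i; rewrite coef_sum big_seq; apply: acl_sum => s sl.
    rewrite coefZ coefXn; apply: acl_M; last first.
      by case: eqP => _; [exact: acl_1|exact: acl_0].
    apply: acl_M; apply: acl_in; first by left; apply: Sq.
    by right; exists (z s / h ^ e s) => //; apply: eP.
  have := congr1 (fun p : {poly K} => p`_M * chi (r a)) p0.
  rewrite coef0 mul0r coef_sum mulr_suml => es; rewrite -[RHS]es.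
  rewrite big_mkcond big_seq [RHS]big_seq; apply: eq_bigr => s sl.
  rewrite coefZ coefXn -[M == m s]/(Posz M == Posz (m s)) em // -[Posz M]add0r.
  rewrite (inj_eq (addIr _)) eq_sym /Q; case: eqP => [es0|_].
    by rewrite mulr1 /c es0 expr0z divr1 /z -mulrA -chiM divfK.
  by rewrite mulr0 mul0r.
have sumNQ : \sum_(s <- l | ~~ Q s) q s * chi (r s) = 0.
  by move: sum0; rewrite (bigID Q) /= sumQ add0r.
have sub (R : pred T) : \sum_(s <- l | R s) q s * chi (r s) = 0 ->
    has (predC R) l -> \sum_(s <- l | R s && P s) q s * chi (r s) = 0.
  move=> sumR hasR; rewrite -big_filter_cond; apply: IH.
  - rewrite size_filter; apply: leq_trans szl.
    by rewrite -(count_predC R l) -[X in (X < _)%N]addn0 ltn_add2l -has_count.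
  - by move=> s; rewrite mem_filter => /andP[_ /Sq].
  - by move=> s; rewrite mem_filter => /andP[_ /r0].
  - by move=> s t; rewrite !mem_filter => /andP[_ sl] /andP[_ tl]; apply: satP.
  - by rewrite big_filter.
rewrite (bigID Q) /=.
under eq_bigl do rewrite andbC.
rewrite sub //; last by apply/hasP; exists b => //=; rewrite /Q.
under eq_bigl do rewrite andbC.
rewrite sub ?addr0 //; apply/hasP; exists a => //=; by rewrite /Q ea.
Qed.

End FreeOver.

(** * Bases of finite and countable sets, and the size of the image *)

Section LocalCharacter.
Variables (F K : closedFieldType) (chi : F -> K).
Hypothesis chiP : is_character chi.
Implicit Types (H : set F) (S : set K).
Local Notation free_over := (free_over chi).

Definition chi_comb H S : set K := [set a | exists l : seq (K * F),
  [/\ forall z, z \in l -> S z.1, forall z, z \in l -> H z.2 /\ z.2 != 0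
    & a = \sum_(z <- l) z.1 * chi z.2]].

Lemma rgen_chi_comb H S : isolated H -> S 1 ->
  (forall a b, S a -> S b -> S (a - b)) -> (forall a b, S a -> S b -> S (a * b)) ->
  rgen (S `|` (chi @` H)) `<=` chi_comb H S.
Proof.
move=> iH S1 SB SM; have S0 : S 0 by rewrite -(subrr (1 : K)); apply: SB.
have SN a : S a -> S (- a) by rewrite -sub0r; apply: SB.
apply: rgen_least.
- move=> a [Sa|[h Hh <-]].
    exists [:: (a, 1)]; rewrite big_seq1 /= (chi1 chiP) mulr1.
    by split=> // z; rewrite inE => /eqP -> //=; rewrite oner_neq0; split=> //; apply: (iso1 iH).
  have [->|h0] := eqVneq h 0; first by exists [::]; rewrite big_nil (chi0 chiP).
  exists [:: (1, h)]; rewrite big_seq1 mul1r.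
  by split=> // z; rewrite inE => /eqP -> //=.
- exists [:: (1, 1)]; rewrite big_seq1 /= (chi1 chiP) mulr1.
  by split=> // z; rewrite inE => /eqP -> //=; rewrite oner_neq0; split=> //; apply: (iso1 iH).
- move=> a b [l [l1 l2 ->]] [m [m1 m2 ->]].
  exists (l ++ [seq (- z.1, z.2) | z <- m]); split.
  + move=> z; rewrite mem_cat => /orP[/l1 //|/mapP[w /m1 h ->]]; exact: SN.
  + by move=> z; rewrite mem_cat => /orP[/l2 //|/mapP[w /m2 h ->]].
  + rewrite big_cat big_map /=; congr (_ + _); rewrite -sumrN.
    by apply: eq_bigr => z _; rewrite mulNr.
- move=> a b [l [l1 l2 ->]] [m [m1 m2 ->]].
  exists [seq (z.1 * w.1, z.2 * w.2) | z <- l, w <- m]; split.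
  + by move=> z /allpairsP[[u v] /= [/l1 hu /m1 hv ->]]; apply: SM.
  + move=> z /allpairsP[[u v] /= [/l2[hu u0] /m2[hv v0] ->]].
    by split; [apply: (isoM iH)|rewrite mulf_neq0].
  + rewrite big_allpairs_dep /= big_distrl /=; apply: eq_bigr => z _.
    rewrite big_distrr /=; apply: eq_bigr => w _.
    by rewrite (chiM chiP) mulrACA.
Qed.

(** A polynomial relation for chi x over the ring spanned by S0 and chi(H) is
    a linear relation between values of chi at products h * x ^+ i. If x is
    not in H, terms with different i lie in different classes modulo H0, so
    all the coefficients of the polynomial vanish. *)
Lemma lin_indep_free H0 S0 : isolated H0 -> S0 1 ->
  (forall a b, S0 a -> S0 b -> S0 (a - b)) ->
  (forall a b, S0 a -> S0 b -> S0 (a * b)) -> lin_indep_mod chi H0 S0 -> free_over H0 S0.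
Proof.
move=> iH0 S1 SB SM li H iH H0H x [p [p0 hp px]]; apply: contrapT => nHx.
have x0 : x != 0 by apply: contra_notN nHx => /eqP ->; apply: (iso0 iH).
have /choice[l hl] : forall i, exists l : seq (K * F),
  [/\ forall z, z \in l -> S0 z.1, forall z, z \in l -> H z.2 /\ z.2 != 0
    & p`_i = \sum_(z <- l) z.1 * chi z.2].
  by move=> i; apply: (rgen_chi_comb iH S1 SB SM); apply: hp.
pose L := [seq (i, z) | i <- iota 0 (size p), z <- l i].
pose q (s : nat * (K * F)) := s.2.1.
pose r (s : nat * (K * F)) := s.2.2 * x ^+ s.1.
have Lq s : s \in L -> S0 (q s).
  by move=> /allpairsPdep[i [z [_ zl ->]]]; have [h _ _] := hl i; apply: h.
have Lr s : s \in L -> r s != 0.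
  move=> /allpairsPdep[i [z [_ zl ->]]]; have [_ h _] := hl i.
  by rewrite mulf_neq0 ?expf_neq0 //; case: (h z zl).
have LH s : s \in L -> H s.2.2 /\ s.2.2 != 0.
  by move=> /allpairsPdep[i [z [_ zl ->]]]; have [_ h _] := hl i; apply: h.
have inner i : \sum_(z <- l i) q (i, z) * chi (r (i, z)) = p`_i * chi x ^+ i.
  have [_ _ ->] := hl i; rewrite mulr_suml; apply: eq_bigr => z _.
  by rewrite /q /r (chiM chiP) (chiX chiP) mulrA.
have sum0 : \sum_(s <- L) q s * chi (r s) = 0.
  rewrite big_allpairs_dep /=.
  under eq_bigr do rewrite inner.
  have := rootP px; rewrite horner_coef => e; rewrite -[RHS]e.
  by rewrite -(big_mkord xpredT (fun i => p`_i * chi x ^+ i)) /index_iota subn0.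
case/negP: p0; apply/eqP/polyP => j; rewrite coef0.
have [jp|jp] := ltnP j (size p); last by rewrite nth_default.
have := li _ L q r (fun s => s.1 == j) Lq Lr _ sum0.
have sat (a b : nat * (K * F)) : a \in L -> b \in L -> H0 (r a / r b) ->
    (a.1 == j) = (b.1 == j).
  move=> /LH[Ha a0] /LH[Hb b0] /H0H hr.
  have [-> //|ne] := eqVneq a.1 b.1; case: nHx.
  apply: (@iso_rootZ _ H _ (a.1%:Z - b.1%:Z) iH); first by lia.
  have -> : x ^ (a.1%:Z - b.1%:Z) = r a / r b * b.2.2 / a.2.2.
    rewrite /r expfzDr // -invr_expz -!exprnP.
    have := expf_neq0 a.1 x0; have := expf_neq0 b.1 x0 => xb xa.
    by field; rewrite a0 b0 xb.
  by apply: iso_div => //; apply: (isoM iH).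
move=> /(_ sat); rewrite big_mkcond big_allpairs_dep /=.
rewrite (bigD1_seq j) ?mem_iota ?iota_uniq //= eqxx inner big1 => [|i ij].
  by rewrite addr0 => /eqP; rewrite mulf_eq0 expf_eq0 (negPf (chi_neq0 chiP x0)) andbF orbF => /eqP.
by rewrite (negPf ij) big1.
Qed.

(** The elements of qs are added in turn. One that is algebraic over the image
    of chi and the previous ones is so through finitely many elements of F,
    which are put into B; free_over_adjoin takes care of the others. *)
Lemma free_over_finite (qs : seq K) : free_over set0 set0 ->
  exists B : seq F, free_over [set` B] [set` qs].
Proof.
move=> G0; elim: qs => [|y qs [B GB]].
  by exists [::]; apply: (free_over_extend G0) => // z.
have [hy|ny] := pselect (acl ([set` qs] `|` range chi) y); last first.
  exists B; apply: (free_over_extend (free_over_adjoin GB ny)) => // z /=.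
  by rewrite inE => /orP[/eqP ->|zq]; apply: acl_in; left; [right|left].
have [s sS hs] := acl_fin hy.
have /choice[f fP] : forall z, exists x, range chi z -> chi x = z.
  by move=> z; have [[x _ <-]|n] := pselect (range chi z); [exists x|exists 0 => /n].
exists (B ++ map f s); apply: (free_over_extend GB).
  by move=> z /= zB; rewrite mem_cat zB.
move=> z /=; rewrite inE => /orP[/eqP ->|zq]; last by apply: acl_in; left.
apply: acl_mono hs => w /= ws; case: (sS w ws) => [wq|wr]; first by left.
by right; exists (f w); [rewrite /= mem_cat map_f ?orbT|apply: fP].
Qed.

(** A failure of freeness involves finitely many elements of A only, so the
    union of the bases of the finite subsets of A is a basis. *)
Lemma free_over_countable (A : set K) : free_over set0 set0 -> countable A ->
  exists B : set F, countable B /\ free_over B A.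
Proof.
move=> G0 cA; have /choice[f fP] := fun qs => @free_over_finite qs G0.
exists (\bigcup_(qs in [set s : seq K | forall x, x \in s -> A x]) [set` f qs]).
split; first by apply: bigcup_countable => [|qs _]; [exact: countable_seqs|exact: finite_set_countable].
move=> H iH BH x hx; have [s sS hs] := acl_fin hx.
(* qs keeps the parameters in A; the others lie in chi(H). *)
pose qs := [seq y <- s | `[< A y >]].
apply: (fP qs H iH).
  move=> z zq; apply: BH; exists qs => //= y.
  by rewrite mem_filter => /andP[/asboolP].
apply: acl_mono hs => w /= ws; have [Aw|nAw] := pselect (A w).
  by left; rewrite /= mem_filter ws andbT; apply/asboolP.
by case: (sS w ws) => // hw; right.
Qed.

(** For y one takes a sum of values chi t, for n + 1 elements t that are
    multiplicatively independent over a basis of qs. By steinitz some t lie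
    outside the hull of n given elements xs. If y were algebraic over qs and
    chi(xs), the values chi t for these t would sum to zero, by linear
    independence modulo that hull; but modulo the hull of the basis the t lie
    in distinct classes, so each of these values would be zero. *)
Lemma image_small (qs : seq K) n : free_over set0 set0 ->
  uncountable F ->
  exists y, forall xs : seq F, (size xs <= n)%N ->
    ~ acl ([set` qs] `|` (chi @` [set` xs])) y.
Proof.
move=> G0 uncF; have [B GB] := free_over_finite qs G0.
have [|ts [ind sts]] := @mult_indep_exists _ (hull [set` B]) n.+1 uncF.
  by apply: hull_countable; apply: finite_set_countable.
have iB := hull_iso [set` B].
exists (\sum_(t <- ts) chi t) => xs sxs hy.
set y := \sum_(t <- ts) chi t in hy.
pose H := hull (hull [set` B] `|` [set` xs]).
have iH : isolated H := hull_iso _.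
have [t0 t0ts nHt0] : exists2 t, t \in ts & ~ H t.
  apply: contrapT => nex; have := @steinitz _ _ xs ts ind iB.
  rewrite sts leqNgt ltnS sxs => /(_ _) /negP; apply=> // t tts.
  by apply: contrapT => nt; apply: nex; exists t.
have BH : hull [set` B] `<=` H by move=> z hz; apply: hull_in; left.
have GH : free_over H (acl ([set` qs] `|` (chi @` H))).
  by apply: (free_over_extend GB) => // z zB; apply: BH; apply: hull_in.
have liH := free_lin_indep chiP iH GH.
have ts0 t : t \in ts -> t != 0.
  move=> tts; apply/eqP => t0'; apply: (mult_indep_notin iB ind tts).
  by rewrite t0'; apply: (iso0 iB).
pose q (o : option F) := if o is Some _ then 1 else - y.
pose r (o : option F) := if o is Some t then t else 1.
have sumH : \sum_(t <- ts | `[< ~ H t >]) chi t = 0.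
  have := liH _ (None :: map Some ts) q r (fun o => `[< ~ H (r o) >]).
  rewrite !big_cons !big_map /= asboolF; last by apply; apply: (iso1 iH).
  have e1 (P : pred F) : \sum_(j <- ts | P j) 1 * chi j = \sum_(j <- ts | P j) chi j.
    by apply: eq_bigr => t _; rewrite mul1r.
  rewrite !e1 -/y (chi1 chiP) mulr1 addNr; apply=> //.
  - move=> o; rewrite inE => /orP[/eqP -> /=|/mapP[t _ ->]]; last exact: acl_1.
    by apply: acl_N; apply: acl_mono hy => z [|[x xxs <-]]; [left|right; exists x => //; apply: hull_in; right].
  - by move=> o; rewrite inE => /orP[/eqP -> /=|/mapP[t tts ->]]; rewrite ?oner_neq0 ?ts0.
  - have r0 o : o \in None :: map Some ts -> r o != 0.
      by rewrite inE => /orP[/eqP -> /=|/mapP[t tts ->]]; rewrite ?oner_neq0 ?ts0.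
    move=> o o' /r0 ro /r0 ro' hr; apply/asboolP/asboolP; apply: contra_not => h.
      exact: (iso_divl iH ro' h).
    rewrite -[r o'](divfK ro); apply: (isoM iH) => //.
    by rewrite -invf_div; apply: (isoV iH).
have liB : lin_indep_mod chi (hull [set` B]) (acl set0).
  apply: (free_lin_indep chiP iB); apply: (free_over_extend G0) => // z.
  by apply: acl_mono.
pose ts' := [seq t <- ts | `[< ~ H t >]].
have := liB _ ts' (fun=> 1) id (pred1 t0).
have sub t : t \in ts' -> t \in ts by rewrite mem_filter => /andP[].
have e1 (P : pred F) : \sum_(j <- ts' | P j) 1 * chi j = \sum_(j <- ts' | P j) chi j.
  by apply: eq_bigr => t _; rewrite mul1r.
rewrite !e1 big_filter sumH.
have -> : \sum_(j <- ts' | pred1 t0 j) chi j = chi t0.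
  rewrite big_mkcond (bigD1_seq t0) /= ?filter_uniq ?(mult_indep_uniq iB ind) //; last first.
    by rewrite mem_filter t0ts andbT; apply/asboolP.
  by rewrite eqxx big1 ?addr0 // => t /negPf ->.
move=> h; have /eqP := chi_neq0 chiP (ts0 t0 t0ts); apply; apply: h => //.
- by move=> *; apply: acl_1.
- by move=> t /sub /ts0.
- move=> t t' /sub tts /sub t'ts hr.
  by rewrite (mult_indep_ratio iB ind tts t'ts hr).
Qed.

End LocalCharacter.

(** * Generic characters are free over the empty pair *)

Section MultDep.
Variable F : closedFieldType.

Lemma tuple_pow_cons n (a : F) (alpha : n.-tuple F) (k : n.+1.-tuple nat) :
  tuple_pow [tuple of a :: alpha] k
  = a ^+ tnth k ord0 * tuple_pow alpha [tuple tnth k (lift ord0 i) | i < n].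
Proof.
rewrite /tuple_pow big_ord_recl tnth0; congr (_ * _).
by apply: eq_bigr => i _; rewrite tnthS tnth_mktuple.
Qed.

Lemma tuple_pow_neq0 n (alpha : n.-tuple F) k :
  (forall a, a \in alpha -> a != 0) -> tuple_pow alpha k != 0.
Proof.
by move=> h; apply/prodf_neq0 => i _; apply/expf_neq0/h/mem_tnth.
Qed.

(** The dependence has to involve a, since alpha is independent; the smaller
    exponent of a can be cancelled. *)
Lemma dep_head n (a : F) (alpha : n.-tuple F) : a != 0 ->
  ~ mult_dependent alpha -> mult_dependent [tuple of a :: alpha] ->
  exists d k l, a ^+ d.+1 * tuple_pow alpha k = tuple_pow alpha l.
Proof.
move=> a0 nd [k [l [nkl]]]; rewrite !tuple_pow_cons.
wlog le : k l nkl / (tnth k ord0 <= tnth l ord0)%N.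
  move=> W e; have [h|/ltnW h] := leqP (tnth k ord0) (tnth l ord0); first exact: W e.
  exact: (W l k (fun e' => nkl (esym e')) h (esym e)).
set k' := mktuple _; set l' := mktuple _.
move=> e; move: le; rewrite leq_eqVlt => /orP[/eqP e0|lt].
  case: nd; exists k', l'; split; last first.
    by move: e; rewrite e0; apply: mulfI; rewrite expf_neq0.
  move=> ekl; apply: nkl; apply: eq_from_tnth => i.
  have [j ->|->] := unliftP ord0 i; last by [].
  by have := congr1 (fun t => tnth t j) ekl; rewrite !tnth_mktuple.
exists (tnth l ord0 - tnth k ord0).-1, l', k'.
rewrite prednK ?subn_gt0 //; apply: (@mulfI _ (a ^+ tnth k ord0)).
  by rewrite expf_neq0.
by rewrite e mulrA -exprD subnKC // ltnW.
Qed.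

End MultDep.

Section Generic.
Variables (F K : closedFieldType) (chi : F -> K).
Hypothesis chiP : is_character chi.

Lemma acl_tuple_pow n (alpha : n.-tuple F) k S :
  (forall a, a \in alpha -> acl S (chi a)) -> acl S (chi (tuple_pow alpha k)).
Proof.
move=> h; rewrite /tuple_pow; elim/big_ind: _ => [||i _].
- by rewrite (chi1 chiP); apply: acl_1.
- by move=> a b ha hb; rewrite (chiM chiP); apply: acl_M.
- rewrite (chiX chiP); apply: (isoX _ (acl_isolated S)).
  exact/h/mem_tnth.
Qed.

(** An element that depends multiplicatively on those already kept can be
    dropped: its value under chi is a root of a quotient of monomials in
    theirs. *)
Lemma indep_sublist (hs : seq F) : exists hs' : seq F,
  [/\ {subset hs' <= hs}, forall a, a \in hs' -> a != 0,
     ~ mult_dependent (in_tuple hs')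
   & forall a, a \in hs -> acl (chi @` [set` hs']) (chi a)].
Proof.
elim: hs => [|a hs [hs' [h1 h0 h2 h3]]].
  by exists [::]; split=> // -[k [l [n _]]]; apply: n; apply: eq_from_tnth => -[].
have [a0|a0] := eqVneq a 0.
  exists hs'; split=> // x; first by move=> /h1 xhs; rewrite inE xhs orbT.
  rewrite inE a0 => /orP[/eqP ->|/h3 //].
  by rewrite (chi0 chiP); apply: acl_0.
have [dep|ndep] := pselect (mult_dependent [tuple of a :: in_tuple hs']).
  exists hs'; split=> // x; first by move=> /h1 xhs; rewrite inE xhs orbT.
  rewrite inE => /orP[/eqP ->|/h3 //].
  have [d [k [l e]]] := dep_head a0 h2 dep.
  have hp m : acl (chi @` [set` hs']) (chi (tuple_pow (in_tuple hs') m)).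
    by apply: acl_tuple_pow => b hb; apply: acl_in; exists b.
  apply: (@isoR _ _ (acl_isolated _) _ d).
  rewrite -(chiX chiP).
  have -> : a ^+ d.+1 = tuple_pow (in_tuple hs') l / tuple_pow (in_tuple hs') k.
    by rewrite -e mulfK // tuple_pow_neq0.
  by rewrite (chiM chiP) (chiV chiP); apply: acl_M; [|apply: acl_V].
exists (a :: hs'); split.
- by move=> x; rewrite !inE => /orP[->//|/h1 ->]; rewrite orbT.
- by move=> x; rewrite inE => /orP[/eqP ->|/h0].
- by have -> : in_tuple (a :: hs') = [tuple of a :: in_tuple hs'] by apply: val_inj.
- move=> x; rewrite inE => /orP[/eqP ->|/h3 h].
    by apply: acl_in; exists a => //=; rewrite inE eqxx.
  by apply: acl_mono h => _ [b hb <-]; exists b => //=; rewrite inE hb orbT.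
Qed.

Definition int_coef n (E : fieldType) (P : {mpoly E[n]}) :=
  forall mu, exists z : int, P@_mu = z%:~R.

Lemma int_coef1 n (E : fieldType) : int_coef (1 : {mpoly E[n]}).
Proof. by move=> mu; rewrite mcoeff1; exists (Posz (mu == 0%MM)). Qed.
Lemma int_coefB n (E : fieldType) (P Q : {mpoly E[n]}) :
  int_coef P -> int_coef Q -> int_coef (P - Q).
Proof.
move=> hP hQ mu; have [a ea] := hP mu; have [b eb] := hQ mu.
by exists (a - b); rewrite mcoeffB ea eb rmorphB.
Qed.
Lemma int_coefM n (E : fieldType) (P Q : {mpoly E[n]}) :
  int_coef P -> int_coef Q -> int_coef (P * Q).
Proof.
move=> hP hQ mu; rewrite mcoeffM.
elim/big_ind: _ => [|x y [a ->] [b ->]|i _]; first by exists 0.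
  by exists (a + b); rewrite rmorphD.
have [a ea] := hP i.1; have [b eb] := hQ i.2.
by exists (a * b); rewrite ea eb rmorphM.
Qed.
Lemma int_coefX n (E : fieldType) (i : 'I_n) : int_coef ('X_i : {mpoly E[n]}).
Proof. by move=> mu; rewrite mcoeffX; exists (Posz (U_(i)%MM == mu)). Qed.

Lemma int_coef_prime n (E : fieldType) (P : {mpoly E[n]}) :
  int_coef P -> forall mu, in_prime_field P@_mu.
Proof.
move=> hP mu S [S1 SB SV]; have [z ->] := hP mu.
have S0 : 0 \in S by rewrite -(subrr 1); apply: SB.
have SN x : x \in S -> - x \in S by rewrite -sub0r; apply: SB.
have Sn n' : n'%:R \in S.
  elim: n' => // n' IH; rewrite -natr1 -[X in _ + X]opprK; apply: SB => //; exact: SN.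
case: z => m; first by rewrite -pmulrn.
by rewrite NegzE rmorphN /= -pmulrn; apply/SN/Sn.
Qed.

(** A nonconstant polynomial takes the value 1. *)
Lemma nonroot (p : {poly K}) : p != 0 -> exists z, p.[z] != 0.
Proof.
move=> p0; have [s1|s1] := eqVneq (size p) 1%N.
  have /size_poly1P[c c0 ->] : size p == 1%N by apply/eqP.
  by exists 0; rewrite hornerC.
have : size (p - 1) != 1%N.
  rewrite size_polyDl // size_polyN size_poly1.
  by rewrite ltn_neqAle eq_sym s1 size_poly_gt0.
move=> /closed_rootP[z /rootP e]; exists z.
move: e; rewrite hornerD hornerN hornerC => /eqP; rewrite subr_eq0 => /eqP ->.
exact: oner_neq0.
Qed.

(** Suppose chi x is algebraic over chi(H) and x is not in H. Then x and an
    independent sublist of the finitely many elements of H involved are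
    multiplicatively independent. The coefficients of the relation for chi x
    are integral polynomials in the values of chi on that sublist, so chi is
    not generic. *)
Lemma generic_free : is_generic chi -> free_over chi set0 set0.
Proof.
move=> [_ gen] H iH _ x hx; apply: contrapT => nHx.
have x0 : x != 0 by apply: contra_notN nHx => /eqP ->; apply: (iso0 iH).
have [s sS hs] := acl_fin hx.
have /choice[f fP] : forall z, exists y, (chi @` H) z -> H y /\ chi y = z.
  by move=> z; have [[y Hy <-]|n] := pselect ((chi @` H) z); [exists y|exists 0 => /n].
have sH z : z \in s -> H (f z) /\ chi (f z) = z by move=> /sS[//|/fP].
have [hs' [h1 h0 h2 h3]] := indep_sublist (map f s).
have hsH a : a \in hs' -> H a by move=> /h1 /mapP[z /sH[h _] ->].
have {hs hx} [p [p0 hp px]] : acl (chi @` [set` hs']) (chi x).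
  apply: acl_sub hs => z /= zs; have [_ <-] := sH z zs.
  by apply: h3; apply: map_f.
pose N := size hs'; pose al := in_tuple hs'.
have ndep : ~ mult_dependent [tuple of x :: al].
  move=> /(dep_head x0 h2)[d [k [l e]]]; apply: nHx.
  have hpow m : H (tuple_pow al m).
    rewrite /tuple_pow; elim/big_ind: _ => [||i _]; first exact: (iso1 iH).
      exact: (isoM iH).
    by apply: (isoX _ iH); apply/hsH/mem_tnth.
  apply: (@isoR _ _ iH _ d).
  have -> : x ^+ d.+1 = tuple_pow al l / tuple_pow al k.
    by rewrite -e mulfK // tuple_pow_neq0.
  exact: iso_div.
have := gen N.+1 [tuple of x :: al] isT ndep; set beta := [tuple of map _ _] => algi.
pose tf := @tofrac K.
pose good (v : 'I_N.+1 -> {fraction K}) :=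
  forall i : 'I_N, v (lift ord0 i) = tf (chi (tnth al i)).
have rep c : rgen (chi @` [set` hs']) c -> exists P : {mpoly {fraction K}[N.+1]},
    int_coef P /\ forall v, good v -> P.@[v] = tf c.
  elim=> [a [h hh <-]||a b _ [P [P1 P2]] _ [Q [Q1 Q2]]|a b _ [P [P1 P2]] _ [Q [Q1 Q2]]].
  - have /tnthP[i ->] : h \in al by [].
    by exists 'X_(lift ord0 i); split; [exact: int_coefX|move=> v gv; rewrite mevalXU].
  - by exists 1; split; [exact: int_coef1|move=> v gv; rewrite meval1 /tf rmorph1].
  - exists (P - Q); split; first exact: int_coefB.
    by move=> v gv; rewrite mevalB P2 // Q2 // /tf rmorphB.
  - exists (P * Q); split; first exact: int_coefM.
    by move=> v gv; rewrite mevalM P2 // Q2 // /tf rmorphM.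
have /choice[Pc hPc] : forall i, exists P : {mpoly {fraction K}[N.+1]},
    int_coef P /\ forall v, good v -> P.@[v] = tf p`_i.
  by move=> i; apply: rep.
pose P := \sum_(i < size p) Pc i * 'X_ord0 ^+ i.
have evP v z : good v -> v ord0 = tf z -> P.@[v] = tf p.[z].
  move=> gv v0; rewrite /P raddf_sum horner_coef /tf rmorph_sum /=.
  apply: eq_bigr => i _; rewrite mevalM (hPc i).2 //.
  by rewrite rmorphXn /= mevalXU v0 rmorphM rmorphXn.
(* P is nonzero because it has a nonzero value at any z that is not a root of
   p. *)
have [z pz] := nonroot p0.
pose v i := if unlift ord0 i is Some j then tf (chi (tnth al j)) else tf z.
have : P = 0.
  apply: algi; last first.
    rewrite (evP _ (chi x)); first by rewrite (rootP px) /tf rmorph0.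
      by move=> i; rewrite tnth_map tnthS.
    by rewrite tnth_map tnth0.
  apply: int_coef_prime; rewrite /P; elim/big_ind: _ => [||i _].
  - by move=> mu; exists 0; rewrite mcoeff0.
  - move=> P1 P2 hP1 hP2; rewrite -[P2]opprK; apply: int_coefB => //.
    by rewrite -sub0r; apply: int_coefB => // mu; exists 0; rewrite mcoeff0.
  - apply: int_coefM; first exact: (hPc i).1.
    elim: (i : nat) => [|m IH]; first by rewrite expr0; apply: int_coef1.
    by rewrite exprS; apply: int_coefM => //; apply: int_coefX.
have gv : good v by move=> i; rewrite /v liftK.
move=> P0; have := evP v z gv; rewrite /v unlift_none => /(_ erefl).
rewrite P0 raddf0 => /esym/eqP; rewrite /tf tofrac_eq0; exact/negP.
Qed.

End Generic.

(** * Existential closure, abstraction of constants and support of formulas *)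

Fixpoint ratoms (X : Type) (t : rterm X) : seq X :=
  match t with
  | TAtom x => [:: x]
  | TZero | TOne => [::]
  | TAdd a b | TMul a b => ratoms a ++ ratoms b
  | TOpp a => ratoms a
  end.

Fixpoint rmap (X Y : Type) (f : X -> Y) (t : rterm X) : rterm Y :=
  match t with
  | TAtom x => TAtom (f x)
  | TZero => TZero
  | TOne => TOne
  | TAdd a b => TAdd (rmap f a) (rmap f b)
  | TOpp a => TOpp (rmap f a)
  | TMul a b => TMul (rmap f a) (rmap f b)
  end.

Lemma eval_rmap X Y T (ops : ring_ops T) (f : X -> Y) (e : Y -> T) t :
  eval_rterm ops e (rmap f t) = eval_rterm ops (fun x => e (f x)) t.
Proof. by elim: t => //= [a -> b ->|a ->|a -> b ->]. Qed.

Lemma eval_rterm_in X T (ops : ring_ops T) (e e' : X -> T) t :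
  (forall x, List.In x (ratoms t) -> e x = e' x) ->
  eval_rterm ops e t = eval_rterm ops e' t.
Proof.
elim: t => //= [x|a IHa b IHb|a IHa|a IHa b IHb] h.
- by apply: h; left.
- by rewrite IHa ?IHb // => x hx; apply: h; apply: List.in_or_app; [right|left].
- by rewrite IHa.
- by rewrite IHa ?IHb // => x hx; apply: h; apply: List.in_or_app; [right|left].
Qed.

Lemma env_cons0 T (x : T) m (v : 'I_m -> T) : env_cons x v ord0 = x.
Proof. by rewrite /env_cons unlift_none. Qed.
Lemma env_consS T (x : T) m (v : 'I_m -> T) i : env_cons x v (lift ord0 i) = v i.
Proof. by rewrite /env_cons liftK. Qed.

Lemma env_consE T m (v : 'I_m.+1 -> T) :
  v = env_cons (v ord0) (fun i => v (lift ord0 i)).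
Proof.
apply: funext => i; have [j ->|->] := unliftP ord0 i; last by rewrite env_cons0.
by rewrite env_consS.
Qed.

Lemma env_cons_comp T T' (f : T -> T') (x : T) m (v : 'I_m -> T) :
  env_cons (f x) (fun i => f (v i)) = (fun i => f (env_cons x v i)).
Proof. by apply: funext => i; rewrite /env_cons; case: unlift. Qed.

Lemma env_nilE T (v v' : 'I_0 -> T) : v = v'.
Proof. by apply: funext => -[]. Qed.

Section Closure.
Variables (CF CK : Type).

Fixpoint exF m n : formula CF CK m n -> formula CF CK 0 n :=
  match m with 0 => fun phi => phi | m'.+1 => fun phi => exF (FEx phi) end.
Fixpoint exK m n : formula CF CK m n -> formula CF CK m 0 :=
  match n with 0 => fun phi => phi | n'.+1 => fun phi => exK (KEx phi) end.

Variables (N : lstructure) (cF : CF -> sortF N) (cK : CK -> sortK N).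

Lemma sat_exF m n (phi : formula CF CK m n) v w :
  sat cF cK (exF phi) v w <-> exists v', sat cF cK phi v' w.
Proof.
elim: m phi => [|m IH] phi /=.
  by split=> [h|[v' h]]; [exists v|]; rewrite ?(env_nilE v v').
rewrite IH; split=> [[v' [x hx]]|[v' h]]; first by exists (env_cons x v').
by exists (fun i => v' (lift ord0 i)), (v' ord0); rewrite -env_consE.
Qed.

Lemma sat_exK m n (phi : formula CF CK m n) v w :
  sat cF cK (exK phi) v w <-> exists w', sat cF cK phi v w'.
Proof.
elim: n phi w => [|n IH] phi w /=.
  by split=> [h|[w' h]]; [exists w|]; rewrite ?(env_nilE w w').
rewrite IH; split=> [[w' [x hx]]|[w' h]]; first by exists (env_cons x w').
by exists (fun i => w' (lift ord0 i)), (w' ord0); rewrite -env_consE.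
Qed.

Lemma sat_closure m n (phi : formula CF CK m n) :
  sat_sentence cF cK (exF (exK phi)) <-> exists v w, sat cF cK phi v w.
Proof.
rewrite /sat_sentence sat_exF.
by split=> -[v]; [move/sat_exK => h|move=> h; exists v; apply/sat_exK]; [exists v|].
Qed.
End Closure.

Lemma env_lshift T p (x : T) m (V : 'I_(m + p) -> T) :
  (fun i : 'I_m.+1 => env_cons x V (lshift p i)) = env_cons x (fun i => V (lshift p i)).
Proof.
apply: funext => i; have [j ->|->] := unliftP ord0 i.
  by rewrite env_consS -[RHS](env_consS x V); congr env_cons; apply: val_inj.
by rewrite env_cons0 -[RHS](env_cons0 x V); congr env_cons; apply: val_inj.
Qed.
Lemma env_rshift T p (x : T) m (V : 'I_(m + p) -> T) j :
  env_cons x V (rshift m.+1 j : 'I_(m.+1 + p)) = V (rshift m j).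
Proof. by rewrite -[RHS](env_consS x V); congr env_cons; apply: val_inj. Qed.

Definition abstract_val T r C (c : C -> T) m (V : 'I_(m + r) -> T) (z : 'I_r + C) : T :=
  match z with inl i => V (rshift m i) | inr c' => c c' end.

Lemma abstract_val_cons T r C (c : C -> T) m (V : 'I_(m + r) -> T) x z :
  abstract_val c (env_cons x V : 'I_(m.+1 + r) -> T) z = abstract_val c V z.
Proof. by case: z => //= i; rewrite env_rshift. Qed.

Section Abstract.
Variables (CF CK CF' CK' : Type) (p q : nat).
Variables (eF : CF -> 'I_p + CF') (eK : CK -> 'I_q + CK').

Definition abstractF m (a : atomF CF m) : atomF CF' (m + p) :=
  match a with
  | FVar i => FVar _ (lshift p i)
  | FConst c => match eF c with inl i => FVar _ (rshift m i) | inr c' => FConst _ c' end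
  end.
Definition abstractK m n (a : atomK CF CK m n) : atomK CF' CK' (m + p) (n + q) :=
  match a with
  | KVar i => KVar _ _ _ (lshift q i)
  | KConst c => match eK c with inl i => KVar _ _ _ (rshift n i) | inr c' => KConst _ _ _ c' end
  | KChi t => KChi _ _ (rmap (@abstractF m) t)
  end.

(** Constants become either variables, numbered after those of the formula, so
    that the bound variable keeps index 0, or constants of another signature. *)
Fixpoint abstract m n (phi : formula CF CK m n) : formula CF' CK' (m + p) (n + q) :=
  match phi with
  | FEq m n s t => FEq _ _ (rmap (@abstractF m) s) (rmap (@abstractF m) t)
  | KEq m n s t => KEq (rmap (@abstractK m n) s) (rmap (@abstractK m n) t)
  | Not m n f => Not (abstract f)
  | And m n f g => And (abstract f) (abstract g)
  | FEx m n f => FEx (abstract f : formula CF' CK' (m + p).+1 (n + q))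
  | KEx m n f => KEx (abstract f : formula CF' CK' (m + p) (n + q).+1)
  end.

Variables (N : lstructure) (cF : CF' -> sortF N) (cK : CK' -> sortK N).
Lemma eval_abstractF m (V : 'I_(m + p) -> sortF N) t :
  eval_rterm (opsF N) (eval_atomF cF V) (rmap (@abstractF m) t) =
  eval_rterm (opsF N)
    (eval_atomF (fun c => abstract_val cF V (eF c)) (fun i => V (lshift p i))) t.
Proof.
rewrite eval_rmap; congr eval_rterm; apply: funext => -[i|c] //=.
by case: (eF c).
Qed.

Lemma sat_abstract m n (phi : formula CF CK m n) (V : 'I_(m + p) -> sortF N)
    (W : 'I_(n + q) -> sortK N) :
  sat cF cK (abstract phi) V W <->
  sat (fun c => abstract_val cF V (eF c)) (fun c => abstract_val cK W (eK c)) phi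
    (fun i => V (lshift p i)) (fun i => W (lshift q i)).
Proof.
elim: m n / phi V W => /=.
- by move=> m n s t V W; rewrite !eval_abstractF.
- move=> m n s t V W; rewrite !eval_rmap.
  have -> : (fun x => eval_atomK cF cK V W (abstractK x)) =
      eval_atomK (fun c => abstract_val cF V (eF c)) (fun c => abstract_val cK W (eK c))
        (fun i => V (lshift p i)) (fun i => W (lshift q i)) => [|//].
  apply: funext => -[i|c|u] //=; first by case: (eK c).
  by rewrite eval_abstractF.
- by move=> m n f IH V W; rewrite IH.
- by move=> m n f IHf g IHg V W; rewrite IHf IHg.
- move=> m n f IH V W.
  have IH' x : sat cF cK (abstract f) (env_cons x V) W <-> _ := IH (env_cons x V) W.
  have e x : (fun c => abstract_val cF (env_cons x V : 'I_(m.+1 + p) -> _) (eF c)) =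
      (fun c => abstract_val cF V (eF c)) by apply: funext => c; rewrite abstract_val_cons.
  split=> -[x hx]; exists x.
    by have := (IH' x).1 hx; rewrite env_lshift e.
  by apply: (IH' x).2; rewrite env_lshift e.
- move=> m n f IH V W.
  have IH' x : sat cF cK (abstract f) V (env_cons x W) <-> _ := IH V (env_cons x W).
  have e x : (fun c => abstract_val cK (env_cons x W : 'I_(n.+1 + q) -> _) (eK c)) =
      (fun c => abstract_val cK W (eK c)) by apply: funext => c; rewrite abstract_val_cons.
  split=> -[x hx]; exists x.
    by have := (IH' x).1 hx; rewrite env_lshift e.
  by apply: (IH' x).2; rewrite env_lshift e.
Qed.
End Abstract.

Section Support.
Variables (CF CK : Type).

Definition consF m (t : rterm (atomF CF m)) : seq CF :=
  pmap (fun a => if a is FConst c then Some c else None) (ratoms t).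

Lemma In_pmap A B (f : A -> option B) (l : seq A) a b :
  List.In a l -> f a = Some b -> List.In b (pmap f l).
Proof.
elim: l => //= a' l IH [-> ->|h1 h2]; first by left.
by case: (f a') => [b'|]; [right|]; apply: IH.
Qed.

Lemma In_cat A (l1 l2 : seq A) a :
  List.In a (l1 ++ l2) <-> List.In a l1 \/ List.In a l2.
Proof. exact: List.in_app_iff. Qed.

Lemma eval_consF (N : lstructure) (cF cF' : CF -> sortF N) m v
    (t : rterm (atomF CF m)) :
  (forall c, List.In c (consF t) -> cF c = cF' c) ->
  eval_rterm (opsF N) (eval_atomF cF v) t = eval_rterm (opsF N) (eval_atomF cF' v) t.
Proof.
move=> h; apply: eval_rterm_in => -[i|c] //= hc; apply: h.
exact: In_pmap hc _.
Qed.

(** With this, an assignment only has to give names to finitely many elements. *)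
Lemma sat_support m n (phi : formula CF CK m n) :
  exists (lF : seq CF) (lK : seq CK),
  forall (N : lstructure) (cF cF' : CF -> sortF N) (cK cK' : CK -> sortK N) v w,
  (forall c, List.In c lF -> cF c = cF' c) ->
  (forall c, List.In c lK -> cK c = cK' c) ->
  sat cF cK phi v w <-> sat cF' cK' phi v w.
Proof.
elim: m n / phi => /=.
- move=> m n s t; exists (consF s ++ consF t), [::] => N cF cF' cK cK' v w h _.
  by rewrite !(@eval_consF N cF cF') // => c hc; apply: h; apply/In_cat; [right|left].
- move=> m n s t.
  pose lK (u : rterm (atomK CF CK m n)) :=
    pmap (fun a => if a is KConst c then Some c else None) (ratoms u).
  pose lF (u : rterm (atomK CF CK m n)) :=
    flatten (pmap (fun a => if a is KChi u then Some (consF u) else None) (ratoms u)).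
  have ev u N (cF cF' : CF -> sortF N) (cK cK' : CK -> sortK N) v w :
      (forall c, List.In c (lF u) -> cF c = cF' c) ->
      (forall c, List.In c (lK u) -> cK c = cK' c) ->
      eval_rterm (opsK N) (eval_atomK cF cK v w) u =
      eval_rterm (opsK N) (eval_atomK cF' cK' v w) u.
    move=> hF hK; apply: eval_rterm_in => -[i|c|x] //= hc.
      by apply: hK; apply: In_pmap hc _.
    congr chi_of; apply: eval_consF => c hc'; apply: hF.
    have : List.In (consF x) (pmap (fun a => if a is KChi u then Some (consF u) else None) (ratoms u)).
      exact: In_pmap hc _.
    rewrite /lF; elim: (pmap _ _) => //= l ls IH [->|/IH]; rewrite In_cat; by [left|right].
  exists (lF s ++ lF t), (lK s ++ lK t) => N cF cF' cK cK' v w hF hK.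
  by rewrite !(ev _ N cF cF' cK cK') // => c hc; by [apply: hF; apply/In_cat; auto|apply: hK; apply/In_cat; auto].
- by move=> m n f [lF [lK h]]; exists lF, lK => N cF cF' cK cK' v w hF hK; rewrite (h _ _ _ _ _ _ _ hF hK).
- move=> m n f [lF [lK h]] g [lF' [lK' h']]; exists (lF ++ lF'), (lK ++ lK').
  move=> N cF cF' cK cK' v w hF hK.
  rewrite (h _ cF cF' cK cK') ?(h' _ cF cF' cK cK') // => c hc;
  by [apply: hF; apply/In_cat; auto|apply: hK; apply/In_cat; auto].
- move=> m n f [lF [lK h]]; exists lF, lK => N cF cF' cK cK' v w hF hK.
  by split=> -[x hx]; exists x; move: hx; rewrite (h _ _ _ _ _ _ _ hF hK).
- move=> m n f [lF [lK h]]; exists lF, lK => N cF cF' cK cK' v w hF hK.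
  by split=> -[x hx]; exists x; move: hx; rewrite (h _ _ _ _ _ _ _ hF hK).
Qed.
End Support.

(** * Ultrapowers *)

Section Ultrapower.
Variables (I : Type) (U : set_system I).
Context {UF : UltraFilter U}.

(** Classes are taken as sets of functions, so that equality of germs is
    equality almost everywhere. *)
Definition germ (T : Type) : Type :=
  {S : set (I -> T) | exists f, S = [set g | U [set i | f i = g i]]}.

Definition cl T (f : I -> T) : germ T := exist _ _ (ex_intro _ f erefl).
Definition rep T (c : germ T) : I -> T := sval (cid (svalP c)).

Lemma repK T (c : germ T) : cl (rep c) = c.
Proof.
case: c => S h; apply: eq_exist; rewrite /rep /=.
by case: (cid _) => f /= ->.
Qed.

Lemma ultraI A B : U A -> U B -> U (A `&` B). Proof. exact: filterI. Qed.
Lemma ultraS A B : A `<=` B -> U A -> U B. Proof. exact: filterS. Qed.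
Lemma ultraT : U setT. Proof. exact: filterT. Qed.
Lemma ultra_ex A : U A -> exists i, A i.
Proof.
move=> UA; apply: contrapT => ne; apply: (@filter_not_empty _ U).
by apply: ultraS UA => i Ai; apply: ne; exists i.
Qed.
Lemma ultraN A : ~ U A <-> U (~` A).
Proof.
split=> [nA|UnA UA]; first by case: (in_ultra_setVsetC A UF).
by have [i []] := ultra_ex (ultraI UA UnA).
Qed.

Lemma cl_eq T (f g : I -> T) : cl f = cl g <-> U [set i | f i = g i].
Proof.
split=> [e|h].
  have : sval (cl f) f by rewrite /=; apply: ultraS ultraT => i.
  by rewrite e /=; apply: ultraS => i.
apply: eq_exist; apply/seteqP; split=> k /= hk.
  by apply: ultraS (ultraI h hk) => i [/= -> ->].
by apply: ultraS (ultraI h hk) => i [/= -> ->].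
Qed.

Lemma rep_cl T (f : I -> T) : U [set i | rep (cl f) i = f i].
Proof. by apply/cl_eq; rewrite repK. Qed.

Variable N : lstructure.

Definition upow_ops T (o : ring_ops T) : ring_ops (germ T) :=
  RingOps (cl (fun=> rzero o)) (cl (fun=> rone o))
    (fun a b => cl (fun i => radd o (rep a i) (rep b i)))
    (fun a => cl (fun i => ropp o (rep a i)))
    (fun a b => cl (fun i => rmul o (rep a i) (rep b i))).

(** When N is a model, that its ultrapower consists of fields comes from the
    theorem of Los and the axioms of the theory. *)
Definition upow : lstructure :=
  @LStructure (germ (sortF N)) (germ (sortK N)) (upow_ops (opsF N)) (upow_ops (opsK N))
    (fun a => cl (fun i => chi_of (rep a i))).

Lemma eval_upow X T (o : ring_ops T) (e : X -> I -> T) t :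
  eval_rterm (upow_ops o) (fun x => cl (e x)) t =
  cl (fun i => eval_rterm o (fun x => e x i) t).
Proof.
elim: t => //= [a -> b ->|a ->|a -> b ->]; apply/cl_eq.
- have h1 := rep_cl (fun i => eval_rterm o (fun x => e x i) a).
  have h2 := rep_cl (fun i => eval_rterm o (fun x => e x i) b).
  by apply: ultraS (ultraI h1 h2) => i [/= -> ->].
- have h1 := rep_cl (fun i => eval_rterm o (fun x => e x i) a).
  by apply: ultraS h1 => i /= ->.
- have h1 := rep_cl (fun i => eval_rterm o (fun x => e x i) a).
  have h2 := rep_cl (fun i => eval_rterm o (fun x => e x i) b).
  by apply: ultraS (ultraI h1 h2) => i [/= -> ->].
Qed.

Lemma chi_upow (f : I -> sortF N) :
  @chi_of upow (cl f) = cl (fun i => chi_of (f i)).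
Proof. by apply/cl_eq; apply: ultraS (rep_cl f) => i /= ->. Qed.

Section Los.
Variables (CF CK : Type).

Lemma eval_atomF_upow (cF : CF -> I -> sortF N) m (v : 'I_m -> I -> sortF N)
    (t : rterm (atomF CF m)) :
  eval_rterm (opsF upow) (eval_atomF (M := upow) (fun c => cl (cF c)) (fun j => cl (v j))) t =
  cl (fun i => eval_rterm (opsF N) (eval_atomF (fun c => cF c i) (fun j => v j i)) t).
Proof.
pose e (a : atomF CF m) i := eval_atomF (fun c => cF c i) (fun j => v j i) a.
have -> : eval_atomF (M := upow) (fun c => cl (cF c)) (fun j => cl (v j)) = (fun a => cl (e a)).
  by apply: funext => -[].
exact: eval_upow.
Qed.

Lemma eval_atomK_upow (cF : CF -> I -> sortF N) (cK : CK -> I -> sortK N) m n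
    (v : 'I_m -> I -> sortF N) (w : 'I_n -> I -> sortK N)
    (t : rterm (atomK CF CK m n)) :
  eval_rterm (opsK upow) (eval_atomK (M := upow) (fun c => cl (cF c))
      (fun c => cl (cK c)) (fun j => cl (v j)) (fun j => cl (w j))) t =
  cl (fun i => eval_rterm (opsK N) (eval_atomK (fun c => cF c i) (fun c => cK c i)
      (fun j => v j i) (fun j => w j i)) t).
Proof.
pose e (a : atomK CF CK m n) i := eval_atomK (fun c => cF c i) (fun c => cK c i)
      (fun j => v j i) (fun j => w j i) a.
have -> : eval_atomK (M := upow) (fun c => cl (cF c)) (fun c => cl (cK c))
    (fun j => cl (v j)) (fun j => cl (w j)) = (fun a => cl (e a)).
  apply: funext => -[i|c|u] //.
  by rewrite [LHS]/eval_atomK eval_atomF_upow chi_upow.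
exact: eval_upow.
Qed.

Theorem los (cF : CF -> I -> sortF N) (cK : CK -> I -> sortK N) m n
    (phi : formula CF CK m n) (v : 'I_m -> I -> sortF N) (w : 'I_n -> I -> sortK N) :
  sat (M := upow) (fun c => cl (cF c)) (fun c => cl (cK c)) phi
    (fun j => cl (v j)) (fun j => cl (w j)) <->
  U [set i | sat (fun c => cF c i) (fun c => cK c i) phi (fun j => v j i) (fun j => w j i)].
Proof.
elim: m n / phi v w => /=.
- by move=> m n s t v w; rewrite !eval_atomF_upow; apply: cl_eq.
- by move=> m n s t v w; rewrite !eval_atomK_upow; apply: cl_eq.
- by move=> m n f IH v w; rewrite IH ultraN.
- move=> m n f IHf g IHg v w; rewrite IHf IHg; split=> [[h1 h2]|h].
    by apply: ultraS (ultraI h1 h2).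
  by split; apply: ultraS h => i [].
- move=> m n f IH v w.
  have envE (x : I -> sortF N) : (fun j => cl (env_cons x v j)) = env_cons (cl x) (fun j => cl (v j)).
    by rewrite env_cons_comp.
  have envEi (x : I -> sortF N) i : (fun j => env_cons x v j i) = env_cons (x i) (fun j => v j i).
    by rewrite (env_cons_comp (fun h : I -> sortF N => h i)).
  split=> [[x]|h].
    rewrite -[x]repK -envE => /IH; apply: ultraS => i /=; rewrite envEi.
    by exists (rep x i).
  have /choice[x hx] : forall i, exists x : sortF N,
      [set i | exists x, sat (fun c => cF c i) (fun c => cK c i) f
          (env_cons x (fun j => v j i)) (fun j => w j i)] i ->
      sat (fun c => cF c i) (fun c => cK c i) f
          (env_cons x (fun j => v j i)) (fun j => w j i).
    by move=> i; have [[x hx]|n0] := pselect (exists x, sat (fun c => cF c i) (fun c => cK c i) f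
          (env_cons x (fun j => v j i)) (fun j => w j i)); [exists x|exists (rzero (opsF N))].
  exists (cl x); rewrite -envE; apply/IH; apply: ultraS h => i /hx /=.
  by rewrite envEi.
- move=> m n f IH v w.
  have envE (x : I -> sortK N) : (fun j => cl (env_cons x w j)) = env_cons (cl x) (fun j => cl (w j)).
    by rewrite env_cons_comp.
  have envEi (x : I -> sortK N) i : (fun j => env_cons x w j i) = env_cons (x i) (fun j => w j i).
    by rewrite (env_cons_comp (fun h : I -> sortK N => h i)).
  split=> [[x]|h].
    rewrite -[x]repK -envE => /IH; apply: ultraS => i /=; rewrite envEi.
    by exists (rep x i).
  have /choice[x hx] : forall i, exists x : sortK N,
      [set i | exists x, sat (fun c => cF c i) (fun c => cK c i) f
          (fun j => v j i) (env_cons x (fun j => w j i))] i ->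
      sat (fun c => cF c i) (fun c => cK c i) f
          (fun j => v j i) (env_cons x (fun j => w j i)).
    by move=> i; have [[x hx]|n0] := pselect (exists x, sat (fun c => cF c i) (fun c => cK c i) f
          (fun j => v j i) (env_cons x (fun j => w j i))); [exists x|exists (rzero (opsK N))].
  exists (cl x); rewrite -envE; apply/IH; apply: ultraS h => i /hx /=.
  by rewrite envEi.
Qed.
End Los.

End Ultrapower.

(** The interpretations cF and cK of the constants are arbitrary, so that phi
    may have parameters in M. *)
Definition elementary (M N : lstructure) (dF : sortF M -> sortF N)
    (dK : sortK M -> sortK N) : Prop :=
  forall CF CK (cF : CF -> sortF M) (cK : CK -> sortK M) m n
    (phi : formula CF CK m n) v w,
  sat cF cK phi v w <->
  sat (fun c => dF (cF c)) (fun c => dK (cK c)) phi (fun i => dF (v i)) (fun i => dK (w i)).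

Lemma elementary_upow I (U : set_system I) (UF : UltraFilter U) N :
  @elementary N (upow U N) (fun x => cl U (fun=> x)) (fun x => cl U (fun=> x)).
Proof.
move=> CF CK cF cK m n phi v w.
rewrite (@los _ U UF N _ _ (fun c _ => cF c) (fun c _ => cK c) m n phi (fun j _ => v j) (fun j _ => w j)).
split=> [h|/ultra_ex[]//]; exact: (@filterS _ U _ setT _ (fun _ _ => h) filterT).
Qed.

Lemma elementary_comp M N P (dF : sortF M -> sortF N) dK (eF : sortF N -> sortF P) eK :
  elementary dF dK -> elementary eF eK ->
  elementary (fun x => eF (dF x)) (fun x => eK (dK x)).
Proof. by move=> h1 h2 CF CK cF cK m n phi v w; rewrite h1 h2. Qed.

Lemma elementary_models M N (dF : sortF M -> sortF N) dK T :
  elementary dF dK -> models M T -> models N T.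
Proof.
move=> h MT s Ts; have := MT s Ts; rewrite /sat_sentence h.
have -> : (fun c => dF (of_void _ c)) = @of_void (sortF N) by apply: funext => -[].
have -> : (fun c => dK (of_void _ c)) = @of_void (sortK N) by apply: funext => -[].
by rewrite (env_nilE (fun i => dF (@env_nil _ i)) (@env_nil _))
  (env_nilE (fun i => dK (@env_nil _ i)) (@env_nil _)).
Qed.

(** * Joint embeddings *)

(** The sentences of the elementary diagram suffice here, and they are all
    that compactness provides directly. *)
Definition diagram_map (M N : lstructure) (hF : sortF M -> sortF N)
    (hK : sortK M -> sortK N) : Prop :=
  forall s : sentence (sortF M) (sortK M),
    sat_sentence (fun x : sortF M => x) (fun y : sortK M => y) s ->
    sat_sentence hF hK s.

Section Joint.
Variables (M N : lstructure) (AF : set (sortF M)) (AK : set (sortK M)).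
Variables (cF : {x | AF x} -> sortF N) (cK : {y | AK y} -> sortK N).
Hypothesis thN : forall s, theory_over (AF := AF) (AK := AK) s -> sat_sentence cF cK s.

(** In an elementary diagram that has to be realised over A, the elements of A
    keep their constants, and those of the list l outside A become variables. *)
Lemma name_split T (A : set T) (x0 : T) (l : seq T) :
  exists e : T -> 'I_(size l).+1 + {x | A x},
  let t := fun i : 'I_(size l).+1 => nth x0 l i in
  (forall a : {x | A x}, e (sval a) = inr a) /\
  (forall x, List.In x l -> match e x with inl i => t i | inr a => sval a end = x).
Proof.
pose t (i : 'I_(size l).+1) := nth x0 l i.
have /choice[e he] : forall x, exists z : 'I_(size l).+1 + {x | A x},
   (A x -> exists2 a, z = inr a & sval a = x) /\
   (List.In x l -> match z with inl i => t i | inr a => sval a end = x).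
  move=> x; have [Ax|nAx] := pselect (A x).
    by exists (inr (exist _ x Ax)); split=> // _; exists (exist _ x Ax).
  have [[i ei]|ne] := pselect (exists i, t i = x); first by exists (inl i).
  exists (inl ord0); split=> // xl; case: ne.
  rewrite /t; elim: l xl {t} => //= y l IH [->|/IH[i <-]]; first by exists ord0.
  by exists (lift ord0 i).
exists e; split=> [a|x xl]; last exact: (he x).2.
have [b -> e'] := (he (sval a)).1 (svalP a); congr inr.
by case: a b e' => a Aa [b Ab] /= ?; subst; congr exist; apply: Prop_irrelevance.
Qed.

Lemma sat_nil (P : lstructure) CF CK (dF : CF -> sortF P) (dK : CK -> sortK P)
    (s : sentence CF CK) v w : sat dF dK s v w <-> sat_sentence dF dK s.
Proof. by rewrite /sat_sentence (env_nilE v (@env_nil _)) (env_nilE w (@env_nil _)). Qed.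

(** Existential quantification over the names of the elements outside A turns
    a sentence of the elementary diagram of M into a sentence over A, which N
    satisfies. *)
Lemma finite_assignment (s : sentence (sortF M) (sortK M)) :
  sat_sentence (fun x : sortF M => x) (fun y : sortK M => y) s ->
  exists (f : sortF M -> sortF N) (g : sortK M -> sortK N),
    [/\ forall a, f (sval a) = cF a, forall a, g (sval a) = cK a & sat_sentence f g s].
Proof.
move=> Ms; have [lF [lK sup]] := sat_support s.
have [eF [eF1 eF2]] := @name_split _ AF (rzero (opsF M)) lF.
have [eK [eK1 eK2]] := @name_split _ AK (rzero (opsK M)) lK.
pose phi : formula {x | AF x} {y | AK y} (size lF).+1 (size lK).+1 := abstract eF eK s.
have : sat_sentence cF cK (exF (exK phi)).
  apply: thN; apply: (sat_closure (N := M) sval sval phi).2.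
  exists (fun i => nth (rzero (opsF M)) lF i), (fun i => nth (rzero (opsK M)) lK i).
  apply: (@sat_abstract _ _ _ _ _ _ eF eK M sval sval 0 0 s _ _).2.
  apply/sat_nil/(sup _ _ _ _ _ _ _ _ _).1/Ms => c hc.
    rewrite -[LHS](eF2 c hc) /abstract_val.
    by case: (eF c) => // i; congr nth.
  rewrite -[LHS](eK2 c hc) /abstract_val.
  by case: (eK c) => // i; congr nth.
move=> /(sat_closure _ _ _).1[V [W]].
move=> /(@sat_abstract _ _ _ _ _ _ eF eK N cF cK 0 0 s V W).1 /sat_nil h.
exists (fun c => abstract_val cF (V : 'I_(0 + _) -> _) (eF c)), (fun c => abstract_val cK (W : 'I_(0 + _) -> _) (eK c)); split=> //.
- by move=> a; rewrite eF1.
- by move=> a; rewrite eK1.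
Qed.

(** Compactness, by means of an ultrapower of N. It is indexed by all the
    assignments of elements of N to those of M, and the ultrafilter contains,
    for each sentence of the diagram of M, the set of the assignments under
    which N satisfies it. *)
Theorem joint_embedding : exists (P : lstructure) (dF : sortF N -> sortF P)
    (dK : sortK N -> sortK P) (hF : sortF M -> sortF P) (hK : sortK M -> sortK P),
  [/\ elementary dF dK, diagram_map hF hK,
     forall a, hF (sval a) = dF (cF a) & forall a, hK (sval a) = dK (cK a)].
Proof.
pose I := ((sortF M -> sortF N) * (sortK M -> sortK N))%type.
pose D : set (sentence (sortF M) (sortK M)) :=
  [set s | sat_sentence (fun x : sortF M => x) (fun y : sortK M => y) s].
pose B (s : sentence (sortF M) (sortK M)) : set I := [set fg |
  [/\ forall a, fg.1 (sval a) = cF a, forall a, fg.2 (sval a) = cK a & sat_sentence fg.1 fg.2 s]].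
have FD : Filter (filter_from D B).
  apply: filter_from_filter.
    by exists (FEq _ _ TZero TZero).
  move=> s t Ds Dt; exists (And s t); first by split.
  by move=> fg [h1 h2 [h3 h4]].
have PD : ProperFilter (filter_from D B).
  apply: filter_from_proper => // s /finite_assignment[f [g h]].
  by exists (f, g).
have [U [UU DU]] := ultraFilterLemma PD.
have UB s : D s -> U (B s) by move=> Ds; apply: DU; exists s.
exists (upow U N), (fun x => cl U (fun=> x)), (fun x => cl U (fun=> x)).
exists (fun x => cl U (fun fg => fg.1 x)), (fun x => cl U (fun fg => fg.2 x)); split.
- exact: elementary_upow.
- move=> s /UB h.
  have := (@los _ U UU N _ _ (fun x fg => fg.1 x) (fun y fg => fg.2 y) _ _ s (@env_nil _) (@env_nil _)).2.
  move=> h'; apply: (sat_nil _ _ _ _ _).1 (h' _).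
  by apply: filterS h => fg [_ _ h]; apply/sat_nil.
- have h := UB (FEq _ _ TZero TZero) erefl.
  by move=> a; apply/cl_eq; apply: filterS h => fg [h1 _ _]; apply: h1.
- have h := UB (FEq _ _ TZero TZero) erefl.
  by move=> a; apply/cl_eq; apply: filterS h => fg [_ h1 _]; apply: h1.
Qed.

End Joint.

(** * Ample structures *)

Lemma countable_enum T (C : set T) (x0 : T) : countable C ->
  exists e : nat -> T, forall x, C x -> exists k, e k = x.
Proof.
move=> /countable_injP[f finj].
have /choice[e he] : forall k, exists x, (exists2 y, C y & f y = k) -> C x /\ f x = k.
  move=> k; have [[y Cy ey]|ne] := pselect (exists2 y, C y & f y = k); first by exists y.
  by exists x0.
exists e => x Cx; exists (f x); have [|Ce fe] := he (f x); first by exists x.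
by apply: finj => //; rewrite inE.
Qed.

Definition omega_ultra : {U : set_system nat | UltraFilter U /\ \oo `<=` U}.
Proof. by apply: cid; apply: ultraFilterLemma. Qed.

Section OmegaPower.
Variable (U : set_system nat).
Context {UU : UltraFilter U}.
Hypothesis ooU : \oo `<=` U.

Lemma U_ge k : U [set n | (k <= n)%N].
Proof. by apply: ooU; exists k. Qed.

(** Diagonalisation: x n differs from the n-th coordinates of the first n
    germs. *)
Lemma uncountable_germ (K : closedFieldType) : uncountable (germ U K).
Proof.
move=> C cC; have [e eC] := countable_enum (cl U (fun=> 0 : K)) cC.
have /choice[x hx] : forall n, exists x : K, forall k, (k <= n)%N -> rep (e k) n != x.
  move=> n; pose l := [seq rep (e k) n | k <- iota 0 n.+1].
  have [|x px] := @nonroot K (\prod_(a <- l) ('X - a%:P)).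
    by apply: monic_neq0; apply: monic_prod_XsubC.
  exists x => k kn; apply: contra_neq px => e'.
  apply/rootP; rewrite root_prod_XsubC -e'; apply/mapP; exists k => //.
  by rewrite mem_iota add0n ltnS.
exists (cl U x) => /eC[k ek].
have : cl U (rep (e k)) = cl U x by rewrite repK.
move=> /cl_eq h; have [n [/= kn en]] := ultra_ex (ultraI (U_ge k) h).
by have := hx n k kn; rewrite en eqxx.
Qed.
End OmegaPower.

(** None stands for the unknown of a polynomial, Some x for a coefficient. *)
Definition ev_poly (K : Type) (X : Type) (e : X -> K) (z : K) (a : option X) : K :=
  if a is Some x then e x else z.

Section TermAcl.
Variables (K : fieldType) (X : Type) (e : X -> K).
Implicit Type t : rterm (option X).

Lemma term_poly (S : set K) t :
  (forall x, List.In (Some x) (ratoms t) -> S (e x)) ->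
  exists p : {poly K}, (forall i, rgen S p`_i) /\
    forall z, p.[z] = eval_rterm (ops_of_ring K) (ev_poly e z) t.
Proof.
have coefC (c : K) : rgen S c -> forall i, rgen S (c%:P)`_i.
  by move=> hc i; rewrite coefC; case: ifP => _ //; apply: rgen_0.
elim: t => /= [[x|]|||a IHa b IHb|a IHa|a IHa b IHb] h.
- exists (e x)%:P; split; last by move=> z; rewrite hornerC.
  by apply: coefC; apply: rgen_in; apply: h; left.
- exists 'X; split; last by move=> z; rewrite hornerX.
  by move=> i; rewrite coefX; case: eqP => _; [exact: rgen_1|exact: rgen_0].
- exists 0; split; last by move=> z; rewrite horner0.
  by move=> i; rewrite coef0; exact: rgen_0.
- exists 1%:P; split; last by move=> z; rewrite hornerC.
  by apply: coefC; exact: rgen_1.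
- have [|p [p1 p2]] := IHa; first by move=> x hx; apply: h; apply/In_cat; left.
  have [|q [q1 q2]] := IHb; first by move=> x hx; apply: h; apply/In_cat; right.
  exists (p + q); split; last by move=> z; rewrite hornerD p2 q2.
  by move=> i; rewrite coefD; apply: rgen_D.
- have [//|p [p1 p2]] := IHa.
  exists (- p); split; last by move=> z; rewrite hornerN p2.
  by move=> i; rewrite coefN; apply: rgen_N.
- have [|p [p1 p2]] := IHa; first by move=> x hx; apply: h; apply/In_cat; left.
  have [|q [q1 q2]] := IHb; first by move=> x hx; apply: h; apply/In_cat; right.
  exists (p * q); split; last by move=> z; rewrite hornerM p2 q2.
  by move=> i; rewrite coefM; apply: rgen_sum => j _; apply: rgen_M.
Qed.

Lemma acl_of_term (S : set K) t y z :
  (forall x, List.In (Some x) (ratoms t) -> S (e x)) ->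
  eval_rterm (ops_of_ring K) (ev_poly e y) t = 0 ->
  eval_rterm (ops_of_ring K) (ev_poly e z) t <> 0 -> acl S y.
Proof.
move=> /term_poly[p [p1 p2]]; rewrite -!p2 => py pz; exists p; split=> //.
  by apply/eqP => p0; apply: pz; rewrite p0 horner0.
exact/rootP.
Qed.

Lemma rgen_term (G : set X) c : rgen (e @` G) c ->
  exists t : rterm (option X), (forall a, List.In a (ratoms t) -> exists2 x, a = Some x & G x)
   /\ forall z, eval_rterm (ops_of_ring K) (ev_poly e z) t = c.
Proof.
elim=> [_ [x Gx <-]||a b _ [s [s1 s2]] _ [t [t1 t2]]|a b _ [s [s1 s2]] _ [t [t1 t2]]].
- by exists (TAtom (Some x)); split=> // a /= [<-|//]; exists x.
- by exists TOne; split.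
- exists (TAdd s (TOpp t)); split=> [a'|z] /=; last by rewrite s2 t2.
  by move/In_cat => [/s1|/t1].
- exists (TMul s t); split=> [a'|z] /=; last by rewrite s2 t2.
  by move/In_cat => [/s1|/t1].
Qed.

Lemma acl_term (G : set X) y : acl (e @` G) y ->
  exists t : rterm (option X), [/\ forall x, List.In (Some x) (ratoms t) -> G x,
   eval_rterm (ops_of_ring K) (ev_poly e y) t = 0
   & exists2 p : {poly K}, p != 0 & forall z, eval_rterm (ops_of_ring K) (ev_poly e z) t = p.[z]].
Proof.
move=> [p [p0 hp py]].
have [t [t1 t2]] : exists t : rterm (option X), (forall x, List.In (Some x) (ratoms t) -> G x)
    /\ forall z, eval_rterm (ops_of_ring K) (ev_poly e z) t = p.[z].
  move: hp; clear; elim/poly_ind: p => [|p c IH] hp.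
    by exists TZero; split=> // z; rewrite horner0.
  have hc := hp 0%N; rewrite coefD coefMX eqxx add0r coefC eqxx in hc.
  have [|t [t1 t2]] := IH.
    by move=> i; have := hp i.+1; rewrite coefD coefMX coefC /= addr0.
  have [s [s1 s2]] := rgen_term hc.
  exists (TAdd (TMul t (TAtom None)) s); split=> [x /=|z /=].
    by move=> /In_cat[/In_cat[/t1 //|[]//]|/s1[x' [->]]].
  by rewrite t2 s2 hornerD hornerC hornerM hornerX.
exists t; split=> //; first by rewrite t2; apply/rootP.
by exists p.
Qed.
End TermAcl.

Definition atom_val (N : lstructure) (x : sortK N + sortF N) : sortK N :=
  match x with inl c => c | inr a => chi_of a end.

(** Over every countable set together with the image of the character there is
    a transcendental element. As polynomials make no sense in an arbitrary
    structure, they are replaced by terms, and the zero polynomial by a term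
    that vanishes everywhere. *)
Definition roomy (N : lstructure) := forall C : set (sortK N), countable C ->
  exists y : sortK N, forall t : rterm (option (sortK N + sortF N)),
  (forall c, List.In (Some (inl c)) (ratoms t) -> C c) ->
  eval_rterm (opsK N) (ev_poly (@atom_val N) y) t = rzero (opsK N) ->
  forall z, eval_rterm (opsK N) (ev_poly (@atom_val N) z) t = rzero (opsK N).

Lemma roomyP (F K : closedFieldType) (chi : F -> K) :
  roomy (lstructure_of chi) -> forall C : set K, countable C ->
  exists y, ~ acl (C `|` range chi) y.
Proof.
move=> rm C /rm[y hy]; exists y => hacl.
pose e : K + F -> K := @atom_val (lstructure_of chi).
pose G : set (K + F) := fun x => if x is inl c then C c else True.
have [] := @acl_term K _ e G y.
  by apply: acl_mono hacl => z [Cz|[x _ <-]]; [exists (inl z)|exists (inr x)].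
move=> t [t1 t2 [p p0 t3]].
have [z /eqP] := nonroot p0; apply; rewrite -t3.
by apply: hy t2 z => c; apply: t1.
Qed.

Lemma In_bound A (l : seq A) (P : A -> nat -> Prop) :
  (forall a, List.In a l -> exists k, P a k) ->
  exists k0, forall a, List.In a l -> exists2 k, (k <= k0)%N & P a k.
Proof.
elim: l => [|a l IH] h; first by exists 0%N.
have [|k0 hk0] := IH; first by move=> b hb; apply: h; right.
have [|k Pk] := h a; first by left.
exists (maxn k k0) => b [<-|/hk0[k' le Pk']].
  by exists k; rewrite ?leq_maxl.
by exists k' => //; apply: leq_trans le (leq_maxr _ _).
Qed.

Lemma In_mem (T : eqType) (l : seq T) x : List.In x l -> x \in l.
Proof. by elim: l => //= y l IH [->|/IH h]; rewrite inE ?eqxx ?h ?orbT. Qed.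

Section Roomy.
Variables (F K : closedFieldType) (chi : F -> K).
Hypothesis chiP : is_character chi.
Hypothesis G0 : free_over chi set0 set0.
Hypothesis uncF : uncountable F.
Variable (U : set_system nat).
Context {UU : UltraFilter U}.
Hypothesis ooU : \oo `<=` U.

(** The germ of a sequence y, where y n is chosen by image_small to be
    transcendental over the n-th coordinates of the first elements of C and
    the values of chi on any n elements. A relation for the germ has finitely
    many parameters, so it fails at almost every n. *)
Lemma roomy_upow : roomy (upow U (lstructure_of chi)).
Proof.
move=> C cC; have [e eC] := countable_enum (cl U (fun=> 0 : K)) cC.
have /choice[y hy] : forall n, exists y : K, forall xs : seq F, (size xs <= n)%N ->
    ~ acl ([set` [seq rep (e k) n | k <- iota 0 n.+1]] `|` (chi @` [set` xs])) y.
  by move=> n; apply: image_small.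
exists (cl U y) => t hC ht z; apply: contrapT => hz.
pose at_ (n : nat) (x : germ U K + germ U F) : K :=
  match x with inl c => rep c n | inr a => chi (rep a n) end.
have evE (w : nat -> K) :
    eval_rterm (opsK (upow U (lstructure_of chi)))
      (ev_poly (@atom_val (upow U (lstructure_of chi))) (cl U w)) t =
    cl U (fun n => eval_rterm (ops_of_ring K) (ev_poly (at_ n) (w n)) t).
  have -> : ev_poly (@atom_val (upow U (lstructure_of chi))) (cl U w) =
      (fun a => cl U (fun n => ev_poly (at_ n) (w n) a)).
    by apply: funext => -[[c|a]|] //=; rewrite repK.
  exact: (eval_upow (ops_of_ring K)).
rewrite evE in ht; rewrite -[z]repK evE in hz.
move/cl_eq: ht => h1.
have h2 : U [set n | eval_rterm (ops_of_ring K) (ev_poly (at_ n) (rep z n)) t <> 0].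
  by apply/ultraN => h; apply: hz; apply/cl_eq.
have [k0 hk0] : exists k0, forall a, List.In a (ratoms t) -> exists2 k, (k <= k0)%N &
    if a is Some (inl c) then e k = c else True.
  apply: In_bound => -[[c|a]|] ha; [exact/eC/hC|by exists 0%N|by exists 0%N].
have h3 := @U_ge U ooU (maxn k0 (size (ratoms t))).
have [n [/= [e1 e2]]] := ultra_ex (ultraI (ultraI h1 h2) h3).
rewrite geq_max => /andP[kn tn].
pose xs := pmap (fun a : option (germ U K + germ U F) =>
   if a is Some (inr x) then Some (rep x n) else None) (ratoms t).
apply: (hy n xs); first by rewrite size_pmap; apply: leq_trans (count_size _ _) tn.
apply: (acl_of_term _ e1 e2) => -[c|a] hx.
  left; have [k le <-] := hk0 _ hx; apply: (map_f (fun k => rep (e k) n)).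
  by rewrite mem_iota add0n ltnS (leq_trans le kn).
right; exists (rep a n) => //=; apply: In_mem; exact: In_pmap hx _.
Qed.
End Roomy.

Lemma elementary_diagram M N P (hF : sortF M -> sortF N) hK (dF : sortF N -> sortF P) dK :
  diagram_map hF hK -> elementary dF dK ->
  diagram_map (fun x => dF (hF x)) (fun x => dK (hK x)).
Proof.
move=> h1 h2 s /h1; rewrite /sat_sentence h2 => h.
exact: (sat_nil _ _ _ _ _).1 h.
Qed.

(** Two successive ultrapowers: the first one makes F uncountable, and this is
    what image_small requires to provide room in the second. *)
Lemma big_structure (T : theory) (hT : axiomatizes_ACFC T) (N : lstructure) :
  models N T -> exists (P : lstructure) (dF : sortF N -> sortF P) (dK : sortK N -> sortK P),
  [/\ models P T, uncountable (sortF P), roomy P & elementary dF dK].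
Proof.
move=> N1T; have [U [UU ooU]] := omega_ultra.
have el2 := @elementary_upow _ U UU N.
have el3 := @elementary_upow _ U UU (upow U N).
have [F1 [K1 [chi1 [_ _ _ e1]]]] := (hT N).1 N1T.
have N2T := elementary_models el2 N1T.
have N3T := elementary_models el3 N2T.
have [F2 [K2 [chi2 [_ c2 g2 e2]]]] := (hT _).1 N2T.
exists (upow U (upow U N)), (fun x => cl U (fun=> cl U (fun=> x))),
  (fun x => cl U (fun=> cl U (fun=> x))); split; [exact: N3T| | |exact: elementary_comp el2 el3].
  by rewrite e2; apply: uncountable_germ.
have unc2 : uncountable F2.
  have : uncountable (sortF (upow U N)) by rewrite e1; apply: uncountable_germ.
  by rewrite e2.
by rewrite e2; apply: roomy_upow => //; exact: generic_free.
Qed.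

Theorem big_extension (T : theory) (hT : axiomatizes_ACFC T) (M N : lstructure)
    (AF : set (sortF M)) (AK : set (sortK M))
    (cF : {x | AF x} -> sortF N) (cK : {y | AK y} -> sortK N) :
  models M T ->
  (forall s, theory_over (AF := AF) (AK := AK) s -> sat_sentence cF cK s) ->
  exists (F K : closedFieldType) (chi : F -> K)
    (dF : sortF N -> F) (dK : sortK N -> K) (hF : sortF M -> F) (hK : sortK M -> K),
  [/\ is_character chi, is_generic chi, uncountable F &
      forall C : set K, countable C -> exists y, ~ acl (C `|` range chi) y] /\
  [/\ @elementary N (lstructure_of chi) dF dK,
      @diagram_map M (lstructure_of chi) hF hK,
      forall a, hF (sval a) = dF (cF a) & forall a, hK (sval a) = dK (cK a)].
Proof.
move=> MT thN.
have NT : models N T.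
  move=> s Ts.
  pose s' : sentence {x | AF x} {y | AK y} :=
    @abstract _ _ _ _ 0 0 (@of_void _) (@of_void _) 0 0 s.
  have sat' (P : lstructure) (dF : _ -> sortF P) (dK : _ -> sortK P) :
      sat_sentence dF dK s' <-> sat_sentence (@of_void (sortF P)) (@of_void (sortK P)) s.
    rewrite -(@sat_nil _ _ _ dF dK s' (@env_nil _) (@env_nil _)).
    rewrite (@sat_abstract _ _ _ _ 0 0 _ _ P dF dK 0 0 s (@env_nil _) (@env_nil _)).
    rewrite sat_nil; set f := (fun c : void => _); set g := (fun c : void => _).
    have -> : f = @of_void _ by apply: funext => -[].
    by have -> : g = @of_void _ by apply: funext => -[].
  by apply/sat'/thN/sat'/MT.
have [N1 [d1F [d1K [h1F [h1K [el1 dg1 hc1F hc1K]]]]]] := joint_embedding thN.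
have N1T : models N1 T := elementary_models el1 NT.
have [P [dF [dK [PT uncP rmP el2]]]] := big_structure hT N1T.
have [F [K [chi [_ cP gP eP]]]] := (hT _).1 PT; subst P.
exists F, K, chi, (fun x => dF (d1F x)), (fun x => dK (d1K x)),
  (fun x => dF (h1F x)), (fun x => dK (h1K x)); split.
  by split=> //; apply: roomyP.
split; [exact: elementary_comp el1 el2|exact: elementary_diagram dg1 el2| |].
- by move=> a; rewrite hc1F.
- by move=> a; rewrite hc1K.
Qed.

(** * Freeness along an elementary diagram *)

Section ImageAcl.
Variables (F F' : closedFieldType) (f : {rmorphism F -> F'}).

Lemma acl_image (S : set F) : f @` acl S `<=` acl (f @` S).
Proof.
move=> _ [y [p [p0 hp py]] <-]; exists (map_poly f p); split.
- by rewrite map_poly_eq0.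
- move=> i; rewrite coef_map /=.
  apply: (@rgen_least _ S (fun a => rgen (f @` S) (f a)) _ _ _ _ _ (hp i)).
  + by move=> a Sa; apply: rgen_in; exists a.
  + by rewrite rmorph1; apply: rgen_1.
  + by move=> a b; rewrite rmorphB; apply: rgen_B.
  + by move=> a b; rewrite rmorphM; apply: rgen_M.
- by apply/rootP; rewrite horner_map (rootP py) rmorph0.
Qed.

(** A polynomial over S splits over S, so its image splits over the image of
    S. *)
Lemma image_acl (S : set F) : acl S `<=` S -> acl (f @` S) `<=` f @` S.
Proof.
move=> aS y [p [p0 hp py]].
have /choice[c hc] : forall i, exists x, S x /\ f x = p`_i.
  move=> i; have : (f @` S) p`_i.
    apply: rgen_least (hp i) => //.
    - by exists 1; rewrite ?rmorph1 //; apply: aS; apply: acl_1.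
    - move=> _ _ [a Sa <-] [b Sb <-]; exists (a - b); rewrite ?rmorphB //.
      by apply: aS; apply: acl_B; apply: acl_in.
    - move=> _ _ [a Sa <-] [b Sb <-]; exists (a * b); rewrite ?rmorphM //.
      by apply: aS; apply: acl_M; apply: acl_in.
  by move=> [x Sx e]; exists x.
pose q := \poly_(i < size p) c i.
have eq : map_poly f q = p.
  apply/polyP => i; rewrite coef_map coef_poly /=; case: ifP => [_|]; first exact: (hc i).2.
  by move=> /negbT; rewrite -leqNgt => /(nth_default 0) ->; rewrite rmorph0.
have q0 : q != 0 by apply: contra_neq p0 => e; rewrite -eq e rmorph0.
have [s es] := closed_field_poly_normal q.
move: py; rewrite -eq es linearZ /= rmorph_prod rootZ ?fmorph_eq0 ?lead_coef_eq0 //.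
under eq_bigr do rewrite rmorphB /= map_polyX map_polyC.
rewrite -(big_map f xpredT (fun a => 'X - a%:P)) root_prod_XsubC => /mapP[a as_ ->].
exists a => //; apply: aS; apply: (@acl_root _ _ q) => //.
  move=> i; rewrite coef_poly; case: ifP => _; last exact: acl_0.
  by apply: acl_in; apply: (hc i).1.
by rewrite es rootZ ?lead_coef_eq0 // root_prod_XsubC.
Qed.
End ImageAcl.

Section Transfer.
Variables (F K F' K' : closedFieldType) (chi : F -> K) (chi' : F' -> K').
Hypotheses (chiP : is_character chi) (chiP' : is_character chi').
Variables (f : {rmorphism F -> F'}) (g : {rmorphism K -> K'}).
Hypothesis dg : @diagram_map (lstructure_of chi) (lstructure_of chi') f g.
Hypothesis fg : forall x, chi' (f x) = g (chi x).
Hypothesis G0' : free_over chi' set0 set0.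
Variables (F0 : set F) (K0 : set K).
Hypotheses (aF0 : acl F0 `<=` F0) (aK0 : acl K0 `<=` K0).
Hypotheses (GM : free_over chi F0 K0).

Let iF0 : isolated F0.
Proof.
have -> : F0 = acl F0 by apply/seteqP; split=> //; apply: acl_in.
exact: acl_isolated.
Qed.

Section Relation.
Variable (n : nat) (q : 'I_n -> K).
Hypothesis Kq : forall i, K0 (q i).

Let S := acl_field (chi @` F0).
Let D := sf_type S.
Let v : D -> K := @sfval _ S.

(** The solutions in F0 of the relation q, seen as vectors over the algebraic
    closure D of chi(F0). *)
Definition solution (u : 'rV[D]_n) := exists c : 'I_n -> F,
  [/\ forall i, F0 (c i), \sum_i q i * chi (c i) = 0
    & forall i, v (u 0 i) = chi (c i)].

Lemma max_solution : exists k (A : 'M[D]_(k, n)),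
  (forall i, solution (row i A)) /\ forall u, solution u -> (u <= A)%MS.
Proof.
pose P r := `[< exists k (A : 'M[D]_(k, n)), (forall i, solution (row i A)) /\ \rank A = r >].
have exP : exists r, P r.
  by exists 0%N; apply/asboolP; exists 0%N, 0; split; [case|rewrite mxrank0].
have ubP r : P r -> (r <= n)%N.
  by move=> /asboolP[k [A [_ <-]]]; apply: rank_leq_col.
case: (ex_maxnP exP ubP) => r /asboolP[k [A [hA rA]]] maxr.
exists k, A; split=> // u Su; apply/negPn/negP => nuA.
suff /maxr : P (\rank (col_mx A u)).
  rewrite -rA leqNgt => /negP; apply; apply: rank_ltmx.
  rewrite /ltmx -!addsmxE; apply/andP; split; first exact: addsmxSl.
  by apply: contra nuA => h; apply: submx_trans h; apply: addsmxSr.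
apply/asboolP; exists (k + 1)%N, (col_mx A u); split=> // i.
case: (split_ordP i) => j ->; first by rewrite rowKu.
by rewrite rowKd row_id // ord1.
Qed.

(** The annihilator of a set of vectors is spanned by its points over any
    field containing their coordinates. Hence the relation q is a combination
    of relations over D that have at least the same solutions in F0. *)
Lemma relation_basis : exists (B : 'M[D]_n) (X : 'I_n -> K),
  (forall i, q i = \sum_j X j * v (B j i)) /\
  forall j (c : 'I_n -> F), (forall i, F0 (c i)) ->
    \sum_i q i * chi (c i) = 0 -> \sum_i v (B j i) * chi (c i) = 0.
Proof.
have [k [A [hA maxA]]] := max_solution.
pose B := kermx A^T.
pose qv : 'rV[K]_n := \row_i q i.
have : (qv <= kermx (map_mx v A^T))%MS.
  apply/sub_kermxP/matrixP => i j; rewrite !mxE.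
  have [c [_ sc hc]] := hA j; rewrite -[RHS]sc; apply: eq_bigr => s _.
  by rewrite !mxE -hc mxE.
rewrite -map_kermx => /submxP[X eX].
exists B, (fun j => X 0 j); split=> [i|j c F0c sc].
  have := congr1 (fun M : 'rV_n => M 0 i) eX; rewrite !mxE => ->.
  by apply: eq_bigr => j _; rewrite !mxE.
have Sc i : S (chi (c i)) by apply: acl_in; exists (c i).
pose u : 'rV[D]_n := \row_i sf_sub (Sc i).
have /submxP[Y eu] : (u <= A)%MS.
  by apply: maxA; exists c; split=> // i; rewrite mxE.
have : B *m u^T = 0 by rewrite eu trmx_mul mulmxA mulmx_ker mul0mx.
move=> /(congr1 (fun M : 'cV_n => v (M j 0))); rewrite /v !mxE raddf0 => e.
rewrite -[RHS]e rmorph_sum; apply: eq_bigr => i _.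
by rewrite rmorphM !mxE.
Qed.

(** By free_lin_indep every solution r of q splits along its classes modulo
    F0, and after division by a representative each piece is a solution in F0. *)
Lemma relation_all (l : 'I_n -> K) :
  (forall c : 'I_n -> F, (forall i, F0 (c i)) ->
    \sum_i q i * chi (c i) = 0 -> \sum_i l i * chi (c i) = 0) ->
  forall r : 'I_n -> F, \sum_i q i * chi (r i) = 0 -> \sum_i l i * chi (r i) = 0.
Proof.
move=> hl r; have [N] := ubnP #|[pred i | r i != 0]|; elim: N r => // N IH r.
rewrite ltnS => cardr sumr.
have [a ra|r0] := pickP [pred i | r i != 0]; last first.
  rewrite big1 // => i _; have /negbFE/eqP -> := r0 i.
  by rewrite (chi0 chiP) mulr0.
move: ra => /= ra.
pose P i := `[< F0 (r i / r a) >].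
have supp (m : 'I_n -> K) (Q : pred 'I_n) :
    \sum_(i <- enum [pred i | r i != 0] | Q i) m i * chi (r i) =
    \sum_(i | Q i) m i * chi (r i).
  rewrite big_enum_cond /= [RHS](bigID (fun i => r i != 0)) /= [X in _ + X]big1 ?addr0.
    by apply: eq_bigl => i; rewrite andbC.
  by move=> i /andP[_ /negbNE/eqP ->]; rewrite (chi0 chiP) mulr0.
have sumP : \sum_(i | P i) q i * chi (r i) = 0.
  rewrite -supp; apply: (free_lin_indep chiP iF0 GM) => //.
  - by move=> i; rewrite mem_enum.
  - move=> i j; rewrite !mem_enum !inE => ri rj hij.
    apply/asboolP/asboolP => h; last first.
      have -> : r i / r a = (r i / r j) * (r j / r a) by rewrite mulrA divfK.
      exact: (isoM iF0).
    have -> : r j / r a = (r i / r j)^-1 * (r i / r a) by rewrite invf_div mulrA divfK.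
    by apply: (isoM iF0) => //; apply: (isoV iF0).
  - by rewrite supp.
have sumNP : \sum_(i | ~~ P i) q i * chi (r i) = 0.
  by move: sumr; rewrite (bigID P) /= sumP add0r.
pose c i := if P i then r i / r a else 0.
have cE (m : 'I_n -> K) : \sum_i m i * chi (c i) = (chi (r a))^-1 * \sum_(i | P i) m i * chi (r i).
  rewrite mulr_sumr [RHS]big_mkcond; apply: eq_bigr => i _; rewrite /c.
  case: ifP => _; last by rewrite (chi0 chiP) mulr0.
  by rewrite (chiM chiP) (chiV chiP) [RHS]mulrC mulrA.
have lP : \sum_(i | P i) l i * chi (r i) = 0.
  have : \sum_i l i * chi (c i) = 0.
    apply: hl; last by rewrite cE sumP mulr0.
    by move=> i; rewrite /c; case: ifP => [/asboolP //|_]; apply: (iso0 iF0).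
  by rewrite cE => /eqP; rewrite mulf_eq0 invr_eq0 (negPf (chi_neq0 chiP ra)) /= => /eqP.
pose r2 i := if P i then 0 else r i.
have r2E (m : 'I_n -> K) : \sum_i m i * chi (r2 i) = \sum_(i | ~~ P i) m i * chi (r i).
  rewrite [RHS]big_mkcond; apply: eq_bigr => i _; rewrite /r2.
  by case: ifP => _ //=; rewrite (chi0 chiP) mulr0.
rewrite (bigID P) /= lP add0r -r2E; apply: IH; last by rewrite r2E.
apply: leq_trans cardr; apply: proper_card; apply/properP; split.
  by apply/fintype.subsetP => i; rewrite !inE /r2; case: (P i); rewrite ?eqxx.
exists a; rewrite !inE // /r2 ifT ?eqxx //.
by apply/asboolP; rewrite divff //; apply: (iso1 iF0).
Qed.
End Relation.

Definition lin_term n (c : 'I_n -> K) : rterm (atomK F K n 0) :=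
  foldr (fun i t => TAdd (TMul (TAtom (KConst F n 0 (c i)))
      (TAtom (KChi K 0 (TAtom (FVar F i))))) t) TZero (enum 'I_n).

Lemma eval_lin_term (F1 K1 : closedFieldType) (ch : F1 -> K1) n (c : 'I_n -> K)
    (dF : F -> F1) (dK : K -> K1) (r : 'I_n -> F1) w :
  eval_rterm (opsK (lstructure_of ch))
    (eval_atomK (M := lstructure_of ch) dF dK r w) (lin_term c) =
  \sum_i dK (c i) * ch (r i).
Proof.
rewrite /lin_term -big_enum /=; elim: (enum 'I_n) => [|i l IH] /=.
  by rewrite big_nil.
by rewrite big_cons -IH.
Qed.

Lemma relation_transfer n (q l : 'I_n -> K) :
  (forall r : 'I_n -> F, \sum_i q i * chi (r i) = 0 -> \sum_i l i * chi (r i) = 0) ->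
  forall r : 'I_n -> F', \sum_i g (q i) * chi' (r i) = 0 ->
    \sum_i g (l i) * chi' (r i) = 0.
Proof.
move=> h r hr; apply: contrapT => nr.
pose phi : formula F K n 0 := And (KEq (lin_term q) TZero) (Not (KEq (lin_term l) TZero)).
have /dg nphi : sat_sentence (M := lstructure_of chi) id id (Not (exF phi)).
  by rewrite /sat_sentence /= sat_exF => -[r0 [/=]]; rewrite !eval_lin_term => /h.
apply: nphi; apply: (sat_exF (N := lstructure_of chi') f g phi _ _).2.
by exists r; split=> /=; rewrite eval_lin_term.
Qed.

(** A relation q over K0 is a combination of relations l over the algebraic
    closure of chi(F0), by relation_basis. In M each l is a consequence of q
    by relation_all, and one sentence with parameters says so; hence l is a
    consequence of q in the larger structure too. For l the splitting into
    classes modulo F0 follows from the freeness of chi' over the empty pair,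
    so q splits in the same way. *)
Theorem free_over_transfer : free_over chi' (f @` F0) (g @` K0).
Proof.
have iF : isolated (f @` F0).
  have -> : f @` F0 = acl (f @` F0).
    by apply/seteqP; split; [exact: acl_in|exact: image_acl].
  exact: acl_isolated.
have K0_1 : K0 1 by apply: aK0; apply: acl_1.
apply: (lin_indep_free chiP' iF).
- by exists 1; rewrite ?rmorph1.
- move=> _ _ [a Ka <-] [b Kb <-]; exists (a - b); rewrite ?rmorphB //.
  by apply: aK0; apply: acl_B; apply: acl_in.
- move=> _ _ [a Ka <-] [b Kb <-]; exists (a * b); rewrite ?rmorphM //.
  by apply: aK0; apply: acl_M; apply: acl_in.
move=> T l0 q r P Sq r0 satP sum0.
pose t := in_tuple l0; pose n := size l0.
have tl (i : 'I_n) : tnth t i \in l0 by apply: mem_tnth.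
have /choice[q0 hq0] : forall i : 'I_n, exists y, K0 y /\ g y = q (tnth t i).
  by move=> i; have [y Ky e] := Sq _ (tl i); exists y.
have [B [X [eX hB]]] := relation_basis q0.
pose l j i := sfval (B j i).
have li : lin_indep_mod chi' (f @` F0) (acl (chi' @` (f @` F0))).
  apply: (free_lin_indep chiP' iF); apply: (free_over_extend G0') => //.
  by apply: acl_mono => z; right.
have toord (Q : pred T) (m : 'I_n -> K') (m' : T -> K') : 
    (forall i, m i = m' (tnth t i)) ->
    \sum_(s <- l0 | Q s) m' s * chi' (r s) = \sum_(i < n | Q (tnth t i)) m i * chi' (r (tnth t i)).
  by move=> e; rewrite (big_tnth _ _ l0); apply: eq_bigr => i _; rewrite e.
rewrite (toord P (fun i => g (q0 i)) q); last by move=> i; rewrite (hq0 i).2.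
rewrite (toord xpredT (fun i => g (q0 i)) q) in sum0; last by move=> i; rewrite (hq0 i).2.
have lj j : \sum_(i < n | P (tnth t i)) g (l j i) * chi' (r (tnth t i)) = 0.
  have := li _ (index_enum 'I_n) (fun i => g (l j i)) (fun i => r (tnth t i)) (fun i => P (tnth t i)).
  apply=> //.
  - move=> i _; have := sfP (B j i) => /= h.
    have : acl (g @` (chi @` F0)) (g (l j i)) by apply: acl_image; exists (l j i).
    apply: acl_mono => _ [_ [x Fx <-] <-]; exists (f x); rewrite ?fg //; exists x.
  - by move=> i _; apply: r0; apply: tl.
  - by move=> i i' _ _; apply: satP; apply: tl.
  - apply: (relation_transfer (q := q0)) sum0 => r1.
    apply: (relation_all (fun i => (hq0 i).1)) => c Fc; exact: hB.
transitivity (\sum_j g (X j) * \sum_(i < n | P (tnth t i)) g (l j i) * chi' (r (tnth t i))).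
  under [RHS]eq_bigr do rewrite mulr_sumr.
  rewrite exchange_big /=; apply: eq_bigr => i _.
  rewrite eX rmorph_sum mulr_suml; apply: eq_bigr => j _.
  by rewrite rmorphM mulrA.
by rewrite big1 // => j _; rewrite lj mulr0.
Qed.

End Transfer.

(** * Back and forth *)

Section RelTransfer.
Variables (F K F' K' : closedFieldType) (chi : F -> K) (chi' : F' -> K').
Hypotheses (chiP : is_character chi) (chiP' : is_character chi').
Variables (R R1 : subfield (F * F')%type) (Q : subfield (K * K')%type).
Hypotheses (iR : isolated (dom R)) (G : free_over chi (dom R) (dom Q)).
Hypotheses (RQ : forall x x', R (x, x') -> Q (chi x, chi' x')).
Hypothesis RR1 : forall z, R z -> R1 z.

(** Induction on the number of terms. By free_lin_indep the terms of one class
    modulo dom R sum to zero; divided by the value of chi at a representative,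
    this is a relation inside dom Q, and Q transports it. *)
Lemma rel_transfer (l : seq ((K * K') * (F * F'))) :
  (forall z, z \in l -> Q z.1 /\ R1 z.2) ->
  \sum_(z <- l) z.1.1 * chi z.2.1 = 0 -> \sum_(z <- l) z.1.2 * chi' z.2.2 = 0.
Proof.
have [n] := ubnP (size l); elim: n l => // n IH l; rewrite ltnS => szl hl suml.
have [/hasP[z zl /eqP z0]|/hasPn nz] := boolP (has (fun z => z.2.1 == 0) l).
  have z0' : z.2.2 = 0.
    have [_ h] := hl z zl; move: h z0; case: (z.2) => u u' /= h.
    by case: (graph_0 h) => h1 _ /h1.
  rewrite (big_rem z zl) /= z0' (chi0 chiP') mulr0 add0r; apply: IH.
  - rewrite size_rem //; apply: leq_trans szl; by case: (l) zl.
  - by move=> y /mem_rem /hl.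
  - by move: suml; rewrite (big_rem z zl) /= z0 (chi0 chiP) mulr0 add0r.
have [->|[a al]] : l = [::] \/ exists a, a \in l.
  by case: (l) => [|a l']; [left|right; exists a; rewrite mem_head].
  by rewrite big_nil.
have ra : a.2.1 != 0 := nz a al.
have [Qa R1a] := hl a al.
have ra' : a.2.2 != 0.
  apply: contra_neq ra; move: R1a; case: (a.2) => u u' /= h.
  by case: (graph_0 h) => _ h1 /h1.
pose P (z : (K * K') * (F * F')) := `[< dom R (z.2.1 / a.2.1) >].
have sumP : \sum_(z <- l | P z) z.1.1 * chi z.2.1 = 0.
  apply: (free_lin_indep chiP iR G) suml.
  - by move=> z /hl[h _]; exists z.1.2; case: z h => -[].
  - by move=> z /nz.
  - move=> i j /nz ri /nz rj hij.
    apply/asboolP/asboolP => h; last first.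
      have -> : i.2.1 / a.2.1 = (i.2.1 / j.2.1) * (j.2.1 / a.2.1) by rewrite mulrA divfK.
      exact: (isoM iR).
    have -> : j.2.1 / a.2.1 = (i.2.1 / j.2.1)^-1 * (i.2.1 / a.2.1) by rewrite invf_div mulrA divfK.
    by apply: (isoM iR) => //; apply: (isoV iR).
have sumNP : \sum_(z <- l | ~~ P z) z.1.1 * chi z.2.1 = 0.
  by move: suml; rewrite (bigID P) /= sumP add0r.
have sumP' : \sum_(z <- l | P z) z.1.2 * chi' z.2.2 = 0.
  have : Q (\sum_(z <- l | (z \in l) && P z) z.1.1 * chi (z.2.1 / a.2.1),
            \sum_(z <- l | (z \in l) && P z) z.1.2 * chi' (z.2.2 / a.2.2)).
    apply: graph_sum => z /andP[zl /asboolP [c Rc]].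
    have [Qz R1z] := hl z zl.
    have : R1 (z.2.1 / a.2.1, z.2.2 / a.2.2).
      by apply: graph_div; [case: (z.2) R1z|case: (a.2) R1a].
    move=> /graph_fun /(_ (RR1 Rc)) e; rewrite -e in Rc.
    have Qc := RQ Rc.
    by case: (z.1) Qz => k k' /= Qz; exact: (sf_M Qz Qc).
  rewrite /= => /graph_0[h _]; move: h.
  have E (L : closedFieldType) (M : fieldType) (ch : M -> L) (q : (K * K') * (F * F') -> L)
     (r : (K * K') * (F * F') -> M) (b : M) : (forall x y, ch (x * y) = ch x * ch y) ->
     \sum_(z <- l | (z \in l) && P z) q z * ch (r z / b) =
     ch b^-1 * \sum_(z <- l | P z) q z * ch (r z).
    move=> cM; rewrite mulr_sumr -big_seq_cond.
    by apply: eq_bigr => z _; rewrite cM [RHS]mulrC mulrA.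
  rewrite !E; [|exact: (chiM chiP')|exact: (chiM chiP)].
  rewrite sumP mulr0 => /(_ erefl) /eqP; rewrite mulf_eq0.
  by rewrite (negPf (chi_neq0 chiP' _)) ?invr_neq0 //= => /eqP.
rewrite (bigID P) /= sumP' add0r -big_filter; apply: IH.
- rewrite size_filter; apply: leq_trans szl.
  rewrite -(count_predC P l) -[X in (X < _)%N]add0n ltn_add2r -has_count.
  by apply/hasP; exists a => //; apply/asboolP; rewrite divff //; apply: (iso1 iR).
- by move=> z; rewrite mem_filter => /andP[_ /hl].
- by rewrite big_filter.
Qed.
End RelTransfer.

Section Tame.
Variables (F K : closedFieldType) (chi : F -> K).

(** The pairs between which partial isomorphisms are extended. Countability
    guarantees that an ample structure has further elements outside. *)
Record tame (F0 : set F) (K0 : set K) : Prop := Tame {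
  tame_aF : acl F0 `<=` F0;
  tame_aK : acl K0 `<=` K0;
  tame_cF : countable F0;
  tame_cK : countable K0;
  tame_G : free_over chi F0 K0 }.

Lemma tame_iso F0 K0 : tame F0 K0 -> isolated F0.
Proof.
move=> h; have -> : F0 = acl F0 by apply/seteqP; split; [exact: acl_in|exact: tame_aF h].
exact: acl_isolated.
Qed.

Definition addF (x : F) (s : set F * set K) : set F * set K :=
  (acl (s.1 `|` [set x]), acl (s.2 `|` (chi @` acl (s.1 `|` [set x])))).
Definition addK (y : K) (s : set F * set K) : set F * set K :=
  (s.1, acl (s.2 `|` [set y])).

Lemma tame_addF x s : tame s.1 s.2 -> tame (addF x s).1 (addF x s).2.
Proof.
move=> [aF aK cF cK G]; have cF1 : countable (acl (s.1 `|` [set x])).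
  by apply: acl_countable; apply: countableU.
split=> //=.
- exact: acl_sub.
- exact: acl_sub.
- by apply: acl_countable; apply: countableU => //; apply: countable_image.
- by apply: (free_over_extend G) => // z hz; apply: acl_in; left.
Qed.

Lemma tame_addK y s : ~ acl (s.2 `|` range chi) y ->
  tame s.1 s.2 -> tame (addK y s).1 (addK y s).2.
Proof.
move=> ny [aF aK cF cK G]; split=> //=.
- exact: acl_sub.
- by apply: acl_countable; apply: countableU.
- by apply: (free_over_extend (free_over_adjoin G ny)) => // z; apply: acl_mono; left.
Qed.
End Tame.

Section BackForth.
Variables (F K F' K' : closedFieldType) (chi : F -> K) (chi' : F' -> K').
Hypotheses (chiP : is_character chi) (chiP' : is_character chi').

Record partial_iso (R : subfield (F * F')%type) (Q : subfield (K * K')%type) : Prop := PartialIso {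
  pi_chi : forall x x', R (x, x') -> Q (chi x, chi' x');
  pi_dom : tame chi (dom R) (dom Q);
  pi_ran : tame chi' (ran R) (ran Q) }.

Definition states (R : subfield (F * F')%type) (Q : subfield (K * K')%type) s s' :=
  (dom R, dom Q) = s /\ (ran R, ran Q) = s'.

(** R extends because x and x' are transcendental. By rel_transfer, the
    subring generated by Q and the pairs (chi u, chi' u'), for u and u'
    corresponding under the extension of R, is still a partial isomorphism.
    Algebraic closure is taken at the end in both sorts. *)
Lemma partial_iso_addF R Q s s' x x' : partial_iso R Q -> states R Q s s' -> ~ dom R x -> ~ ran R x' ->
  exists R1 Q1, [/\ partial_iso R1 Q1, (forall z, R z -> R1 z), (forall z, Q z -> Q1 z),
    R1 (x, x') & states R1 Q1 (addF chi x s) (addF chi' x' s')].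
Proof.
move=> B [es es'] nx nx'; have [RQ tD tR] := B.
have [||R' [RR' R'x dR' rR']] := @graph_adjoin_trans _ _ R x x'.
- by move/(tame_aF tD).
- by move/(tame_aF tR).
have [R1 [R'R1 dR1 rR1]] := graph_acl R'.
have RR1 z : R z -> R1 z by move=> /RR' /R'R1.
have eD : dom R1 = acl (dom R `|` [set x]).
  rewrite dR1; apply/seteqP; split; first exact: acl_sub.
  by apply: acl_mono => z [[z' /RR' h]|->]; [exists z'|exists x'].
have eR : ran R1 = acl (ran R `|` [set x']).
  rewrite rR1; apply/seteqP; split; first exact: acl_sub.
  by apply: acl_mono => z [[z' /RR' h]|->]; [exists z'|exists x].
pose X (z : F * F') : (K * K')%type := (chi z.1, chi' z.2).
pose T : set (K * K')%type := [set a | exists l : seq ((K * K') * (F * F')),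
  (forall z, z \in l -> Q z.1 /\ R1 z.2) /\ a = \sum_(z <- l) z.1 * X z.2].
have fstE l : (\sum_(z <- l) z.1 * X z.2).1 = \sum_(z <- l) z.1.1 * chi z.2.1.
  by rewrite (big_morph (@fst K K') (id1 := 0) (op1 := +%R)).
have sndE l : (\sum_(z <- l) z.1 * X z.2).2 = \sum_(z <- l) z.1.2 * chi' z.2.2.
  by rewrite (big_morph (@snd K K') (id1 := 0) (op1 := +%R)).
have X1 : X 1 = 1 by rewrite /X (chi1 chiP) (chi1 chiP').
have XM a b : X (a * b) = X a * X b by rewrite /X (chiM chiP) (chiM chiP').
have QT : (Q : set _) `<=` T.
  move=> a Qa; exists [:: (a, 1)]; rewrite big_seq1 X1 mulr1; split=> // z.
  by rewrite inE => /eqP -> /=; split=> //; apply: (sf_1 R1).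
have XT z : R1 z -> T (X z).
  move=> R1z; exists [:: (1, z)]; rewrite big_seq1 mul1r; split=> // y.
  by rewrite inE => /eqP -> /=; split=> //; apply: (sf_1 Q).
have [||||Q' [TQ' dQ' rQ']] := @frac_graph _ _ T.
- by apply: QT; apply: (sf_1 Q).
- move=> a b [l [hl ->]] [m [hm ->]].
  exists (l ++ [seq (- z.1, z.2) | z <- m]); split.
    move=> z; rewrite mem_cat => /orP[/hl //|/mapP[w /hm [h1 h2] ->]] /=; split=> //.
    by rewrite -sub0r; apply: sf_B h1; apply: graph_0in.
  rewrite big_cat big_map /=; congr (_ + _); rewrite -sumrN.
  by apply: eq_bigr => z _; rewrite mulNr.
- move=> a b [l [hl ->]] [m [hm ->]].
  exists [seq (z.1 * w.1, z.2 * w.2) | z <- l, w <- m]; split.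
    move=> z /allpairsP[[u w] /= [/hl[h1 h2] /hm[h3 h4] ->]] /=.
    by split; apply: sf_M.
  rewrite big_allpairs_dep /= big_distrl /=; apply: eq_bigr => z _.
  rewrite big_distrr /=; apply: eq_bigr => w _.
  by rewrite XM mulrACA.
- move=> a a' [l [hl el]].
  have ea : a = \sum_(z <- l) z.1.1 * chi z.2.1 by rewrite -fstE -el.
  have ea' : a' = \sum_(z <- l) z.1.2 * chi' z.2.2 by rewrite -sndE -el.
  split=> e.
    rewrite ea'; apply: (rel_transfer chiP chiP' (tame_iso tD) (tame_G tD) RQ RR1 hl).
    by rewrite -ea.
  pose sw (z : (K * K') * (F * F')) := ((z.1.2, z.1.1), (z.2.2, z.2.1)).
  have := @rel_transfer _ _ _ _ _ _ chiP' chiP (swap_graph R) (swap_graph R1)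
    (swap_graph Q) (tame_iso tR) (tame_G tR) _ _ [seq sw z | z <- l].
  rewrite !big_map /= -ea' -ea => H; apply: H => //.
  - by move=> z z' /RQ.
  - by move=> z; exact: RR1.
  - by move=> z /mapP[[[k k'] [u u']] /hl[h1 h2] ->].
have [Q1 [Q'Q1 dQ1 rQ1]] := graph_acl Q'.
have eDQ : dom Q1 = acl (dom Q `|` (chi @` dom R1)).
  rewrite dQ1; apply/seteqP; split; apply: acl_sub.
    move=> z hz; apply: acl_sub (dQ' z hz) => y [y' [l [hl el]]].
    have -> : y = \sum_(z <- l) z.1.1 * chi z.2.1 by rewrite -fstE -el.
    rewrite big_seq; apply: acl_sum => w /hl[h1 h2]; apply: acl_M; apply: acl_in.
      by left; exists w.1.2; case: w.1 h1.
    by right; exists w.2.1 => //; exists w.2.2; case: w.2 h2.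
  move=> z [[z' Qz]|[u [u' R1u] <-]]; apply: acl_in.
    by exists z'; apply: TQ'; apply: QT.
  by exists (chi' u'); apply: TQ'; exact: (XT (u, u')).
have eRQ : ran Q1 = acl (ran Q `|` (chi' @` ran R1)).
  rewrite rQ1; apply/seteqP; split; apply: acl_sub.
    move=> z hz; apply: acl_sub (rQ' z hz) => y [y' [l [hl el]]].
    have -> : y = \sum_(z <- l) z.1.2 * chi' z.2.2 by rewrite -sndE -el.
    rewrite big_seq; apply: acl_sum => w /hl[h1 h2]; apply: acl_M; apply: acl_in.
      by left; exists w.1.1; case: w.1 h1.
    by right; exists w.2.2 => //; exists w.2.1; case: w.2 h2.
  move=> z [[z' Qz]|[u' [u R1u] <-]]; apply: acl_in.
    by exists z'; apply: TQ'; apply: QT.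
  by exists (chi u); apply: TQ'; exact: (XT (u, u')).
have st : states R1 Q1 (addF chi x s) (addF chi' x' s').
  by rewrite /states -es -es' /addF /= eD eR eDQ eRQ eD eR.
exists R1, Q1; split=> //.
- case: (st) => [[e1 e2] [e3 e4]]; split.
  + by move=> u u' R1u; apply: Q'Q1; apply: TQ'; exact: (XT (u, u')).
  + by rewrite e1 e2; apply: tame_addF; rewrite -es.
  + by rewrite e3 e4; apply: tame_addF; rewrite -es'.
- by move=> z Qz; apply: Q'Q1; apply: TQ'; apply: QT.
- by apply: R'R1.
Qed.

Lemma partial_iso_addK R Q s s' y y' : partial_iso R Q -> states R Q s s' ->
  ~ acl (dom Q `|` range chi) y -> ~ acl (ran Q `|` range chi') y' ->
  exists Q1, [/\ partial_iso R Q1, (forall z, Q z -> Q1 z),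
    Q1 (y, y') & states R Q1 (addK y s) (addK y' s')].
Proof.
move=> B [es es'] ny ny'; have [RQ tD tR] := B.
have [||Q' [QQ' Q'y dQ' rQ']] := @graph_adjoin_trans _ _ Q y y'.
- by move=> h; apply: ny; apply: acl_mono h; left.
- by move=> h; apply: ny'; apply: acl_mono h; left.
have [Q1 [Q'Q1 dQ1 rQ1]] := graph_acl Q'.
have eD : dom Q1 = acl (dom Q `|` [set y]).
  rewrite dQ1; apply/seteqP; split; first exact: acl_sub.
  by apply: acl_mono => z [[z' /QQ' h]|->]; [exists z'|exists y'].
have eR : ran Q1 = acl (ran Q `|` [set y']).
  rewrite rQ1; apply/seteqP; split; first exact: acl_sub.
  by apply: acl_mono => z [[z' /QQ' h]|->]; [exists z'|exists y].
have st : states R Q1 (addK y s) (addK y' s').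
  by rewrite /states -es -es' /addK /= eD eR.
exists Q1; split=> //.
- case: (st) => [[e1 e2] [e3 e4]]; split.
  + by move=> u u' /RQ /QQ' /Q'Q1.
  + by rewrite e1 e2; apply: tame_addK; rewrite -es.
  + by rewrite e3 e4; apply: tame_addK; rewrite -es'.
- by move=> z /QQ' /Q'Q1.
- exact: Q'Q1.
Qed.

Section Forth.
Variables (pF : set F' -> F') (pK : set K' -> K').
Hypothesis pFP : forall C, countable C -> ~ C (pF C).
Hypothesis pKP : forall C, countable C -> ~ acl (C `|` range chi') (pK C).

(** The range grows by canonical choices only, so it runs through countably
    many states in all. *)
Definition next_state (s : set F' * set K') (b : bool) :=
  if b then addK (pK s.2) s else addF chi' (pF s.1) s.

Definition grows R Q R1 Q1 := [/\ partial_iso R1 Q1, (forall z, R z -> R1 z), (forall z, Q z -> Q1 z)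
  & exists bs, (ran R1, ran Q1) = foldl next_state (ran R, ran Q) bs].

Lemma grows_refl R Q : partial_iso R Q -> grows R Q R Q.
Proof. by move=> B; split=> //; exists [::]. Qed.

Lemma grows_trans R Q R1 Q1 R2 Q2 : grows R Q R1 Q1 -> grows R1 Q1 R2 Q2 ->
  grows R Q R2 Q2.
Proof.
move=> [_ h1 h2 [bs e]] [B h3 h4 [bs' e']]; split=> //.
- by move=> z /h1 /h3.
- by move=> z /h2 /h4.
- by exists (bs ++ bs'); rewrite foldl_cat -e.
Qed.

Lemma forthF R Q x : partial_iso R Q -> exists R1 Q1, grows R Q R1 Q1 /\ dom R1 x.
Proof.
move=> B; have [hx|nx] := pselect (dom R x).
  by exists R, Q; split=> //; apply: grows_refl.
have nx' : ~ ran R (pF (ran R)) by apply: pFP; apply: tame_cF (pi_ran B).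
have [R1 [Q1 [B1 h1 h2 h3 [_ st]]]] := partial_iso_addF B (conj erefl erefl) nx nx'.
exists R1, Q1; split; last by exists (pF (ran R)).
by split=> //; exists [:: false].
Qed.

Lemma forthF_seq R Q (xs : seq F) : partial_iso R Q ->
  exists R1 Q1, grows R Q R1 Q1 /\ forall x, x \in xs -> dom R1 x.
Proof.
elim: xs R Q => [|x xs IH] R Q B.
  by exists R, Q; split=> //; apply: grows_refl.
have [R1 [Q1 [g1 hx]]] := forthF x B.
have [R2 [Q2 [g2 hxs]]] := IH R1 Q1 (let: And4 B1 _ _ _ := g1 in B1).
exists R2, Q2; split; first exact: grows_trans g1 g2.
move=> z; rewrite inE => /orP[/eqP ->|/hxs //].
by case: g2 => _ h _ _; case: hx => x' /h; exists x'.
Qed.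

(** If y is algebraic over dom Q and the image of chi, it enters dom Q once
    finitely many elements of F have been added; otherwise partial_iso_addK
    applies. *)
Lemma forthK R Q y : partial_iso R Q -> exists R1 Q1, grows R Q R1 Q1 /\ dom Q1 y.
Proof.
move=> B; have [hy|ny] := pselect (acl (dom Q `|` range chi) y); last first.
  have ny' : ~ acl (ran Q `|` range chi') (pK (ran Q)).
    by apply: pKP; apply: tame_cK (pi_ran B).
  have [Q1 [B1 h2 h3 [_ st]]] := partial_iso_addK B (conj erefl erefl) ny ny'.
  exists R, Q1; split; last by exists (pK (ran Q)).
  by split=> //; exists [:: true].
have [s sS hs] := acl_fin hy.
have /choice[f fP] : forall z, exists x, range chi z -> chi x = z.
  by move=> z; have [[x _ <-]|n] := pselect (range chi z); [exists x|exists 0 => /n].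
have [R1 [Q1 [g1 hx]]] := forthF_seq (map f s) B.
exists R1, Q1; split=> //; case: g1 => B1 _ QQ1 _.
apply: (tame_aK (pi_dom B1)); apply: acl_mono hs => z /= zs.
case: (sS z zs) => [[z' /QQ1 h]|/fP <-]; first by exists z'.
have [x' /(pi_chi B1) h] := hx (f z) (map_f f zs).
by exists (chi' x').
Qed.

Lemma forth_tuples R Q m n (v : 'I_m -> F) (w : 'I_n -> K) : partial_iso R Q ->
  exists R1 Q1, grows R Q R1 Q1 /\ (forall i, dom R1 (v i)) /\ (forall j, dom Q1 (w j)).
Proof.
move=> B; have [R1 [Q1 [g1 h1]]] := forthF_seq [seq v i | i <- enum 'I_m] B.
have [R2 [Q2 [g2 h2]]] : exists R2 Q2, grows R1 Q1 R2 Q2 /\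
    forall y, y \in [seq w j | j <- enum 'I_n] -> dom Q2 y.
  have B1 : partial_iso R1 Q1 by case: g1.
  elim: [seq w j | j <- enum 'I_n] R1 Q1 B1 {g1 h1} => [|y ys IH] R1 Q1 B1.
    by exists R1, Q1; split=> //; apply: grows_refl.
  have [R2 [Q2 [g2 hy]]] := forthK y B1.
  have [R3 [Q3 [g3 hys]]] := IH R2 Q2 (let: And4 B1 _ _ _ := g2 in B1).
  exists R3, Q3; split; first exact: grows_trans g2 g3.
  move=> z; rewrite inE => /orP[/eqP ->|/hys //].
  by case: g3 => _ _ h _; case: hy => x' /h; exists x'.
exists R2, Q2; split; first exact: grows_trans g1 g2.
split=> [i|j]; last by apply: h2; apply: map_f; rewrite mem_enum.
have [x' hx'] : dom R1 (v i) by apply: h1; apply: map_f; rewrite mem_enum.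
by case: g2 => _ h _ _; exists x'; apply: h.
Qed.
End Forth.

End BackForth.

Lemma partial_iso_swap (F K F' K' : closedFieldType) (chi : F -> K) (chi' : F' -> K') R Q :
  partial_iso chi chi' R Q -> partial_iso chi' chi (swap_graph R) (swap_graph Q).
Proof. by move=> [h1 h2 h3]; split=> // x x' /h1. Qed.

Definition ample (F K : closedFieldType) (chi : F -> K) := [/\ is_character chi,
  uncountable F & forall C : set K, countable C -> exists y, ~ acl (C `|` range chi) y].

Lemma ample_pick (F K : closedFieldType) (chi : F -> K) : ample chi ->
  exists (pF : set F -> F) (pK : set K -> K), (forall C, countable C -> ~ C (pF C)) /\
   (forall C, countable C -> ~ acl (C `|` range chi) (pK C)).
Proof.
move=> [_ hF hK].
have /choice[pF hpF] : forall C : set F, exists x, countable C -> ~ C x.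
  by move=> C; have [/hF[x nx]|n] := pselect (countable C); [exists x|exists 0].
have /choice[pK hpK] : forall C : set K, exists y, countable C -> ~ acl (C `|` range chi) y.
  by move=> C; have [/hK[x nx]|n] := pselect (countable C); [exists x|exists 0].
by exists pF, pK.
Qed.

Lemma ample_forth (F K F' K' : closedFieldType) (chi : F -> K) (chi' : F' -> K') R Q :
  is_character chi -> ample chi' -> partial_iso chi chi' R Q ->
  (forall x, exists R1 Q1 x', [/\ partial_iso chi chi' R1 Q1, (forall z, R z -> R1 z),
      (forall z, Q z -> Q1 z) & R1 (x, x')]) /\
  (forall y, exists R1 Q1 y', [/\ partial_iso chi chi' R1 Q1, (forall z, R z -> R1 z),
      (forall z, Q z -> Q1 z) & Q1 (y, y')]).
Proof.
move=> cP am B; have [cP' _ _] := am; have [pF [pK [hF hK]]] := ample_pick am.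
split=> [x|y].
  have [R1 [Q1 [[B1 h1 h2 _] [x' h3]]]] := forthF cP cP' pK hF x B.
  by exists R1, Q1, x'.
have [R1 [Q1 [[B1 h1 h2 _] [y' h3]]]] := forthK cP cP' hF hK y B.
by exists R1, Q1, y'.
Qed.

Section PreserveFormulas.
Variables (F K F' K' : closedFieldType) (chi : F -> K) (chi' : F' -> K').
Hypotheses (am : ample chi) (am' : ample chi').

Lemma eval_graph (L L' : fieldType) (G : subfield (L * L')%type) X (e : X -> L) (e' : X -> L') t :
  (forall x, G (e x, e' x)) ->
  G (eval_rterm (ops_of_ring L) e t, eval_rterm (ops_of_ring L') e' t).
Proof.
move=> h; elim: t => //= [||a ha b hb|a ha|a ha b hb].
- exact: graph_0in.
- exact: (sf_1 G).
- exact: (graph_D ha hb).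
- by rewrite -[- _]sub0r -[X in G (_, X)]sub0r; exact: (sf_B (graph_0in G) ha).
- exact: (sf_M ha hb).
Qed.

Lemma graph_env_cons (T T' : Type) (G : T * T' -> Prop) x x' m (v : 'I_m -> T) v' :
  G (x, x') -> (forall i, G (v i, v' i)) ->
  forall i, G (env_cons x v i, env_cons x' v' i).
Proof. by move=> h1 h2 i; rewrite /env_cons; case: unlift. Qed.

Theorem partial_iso_sat CF CK (cF : CF -> F) (cK : CK -> K) (cF' : CF -> F') (cK' : CK -> K')
    m n (phi : formula CF CK m n) R Q v w v' w' : partial_iso chi chi' R Q ->
  (forall c, R (cF c, cF' c)) -> (forall c, Q (cK c, cK' c)) ->
  (forall i, R (v i, v' i)) -> (forall j, Q (w j, w' j)) ->
  sat (M := lstructure_of chi) cF cK phi v w <->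
  sat (M := lstructure_of chi') cF' cK' phi v' w'.
Proof.
have cP : is_character chi by case: am.
have cP' : is_character chi' by case: am'.
elim: m n / phi R Q v w v' w' => /=.
- move=> m n s t R Q v w v' w' B hF _ hv _.
  by apply: (@graph_eq _ _ R); apply: eval_graph => -[i|c] /=.
- move=> m n s t R Q v w v' w' B hF hK hv hw.
  apply: (@graph_eq _ _ Q); apply: eval_graph => -[j|c|u] //=;
    apply: (pi_chi B); by apply: eval_graph => -[i|c] /=.
- by move=> m n f IH R Q v w v' w' B hF hK hv hw; rewrite (IH R Q v w v' w').
- move=> m n f IHf g IHg R Q v w v' w' B hF hK hv hw.
  by rewrite (IHf R Q v w v' w') // (IHg R Q v w v' w').
- move=> m n f IH R Q v w v' w' B hF hK hv hw.
  have [fo _] := ample_forth cP am' B.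
  have [ba _] := ample_forth cP' am (partial_iso_swap B).
  split=> -[x hx].
    have [R1 [Q1 [x' [B1 h1 h2 h3]]]] := fo x; exists x'.
    apply: (IH R1 Q1 (env_cons x v) w (env_cons x' v') w' B1 _ _ _ _).1 hx; auto.
    by apply: graph_env_cons => // i; apply: h1.
  have [R1 [Q1 [x' [B1 h1 h2 h3]]]] := ba x; exists x'.
  apply: (IH (swap_graph R1) (swap_graph Q1) (env_cons x' v) w (env_cons x v') w' (partial_iso_swap B1) _ _ _ _).2 hx.
  + by move=> c; exact: (h1 (_, _) (hF c)).
  + by move=> c; exact: (h2 (_, _) (hK c)).
  + by apply: graph_env_cons => // i; exact: (h1 (_, _) (hv i)).
  + by move=> j; exact: (h2 (_, _) (hw j)).
- move=> m n f IH R Q v w v' w' B hF hK hv hw.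
  have [_ fo] := ample_forth cP am' B.
  have [_ ba] := ample_forth cP' am (partial_iso_swap B).
  split=> -[x hx].
    have [R1 [Q1 [x' [B1 h1 h2 h3]]]] := fo x; exists x'.
    apply: (IH R1 Q1 v (env_cons x w) v' (env_cons x' w') B1 _ _ _ _).1 hx; auto.
    by apply: graph_env_cons => // i; apply: h2.
  have [R1 [Q1 [x' [B1 h1 h2 h3]]]] := ba x; exists x'.
  apply: (IH (swap_graph R1) (swap_graph Q1) v (env_cons x' w) v' (env_cons x w') (partial_iso_swap B1) _ _ _ _).2 hx.
  + by move=> c; exact: (h1 (_, _) (hF c)).
  + by move=> c; exact: (h2 (_, _) (hK c)).
  + by move=> j; exact: (h1 (_, _) (hv j)).
  + by apply: graph_env_cons => // i; exact: (h2 (_, _) (hw i)).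
Qed.
End PreserveFormulas.

(** * Counting types *)

Lemma pack_rmorph (R R' : nzRingType) (h : R -> R') :
  (forall a b, h (a - b) = h a - h b) -> h 1 = 1 ->
  (forall a b, h (a * b) = h a * h b) -> exists f : {rmorphism R -> R'}, h = f.
Proof.
move=> hB h1 hM.
pose m1 := GRing.isZmodMorphism.Build R R' h hB.
pose m2 := GRing.isMonoidMorphism.Build R R' h (conj h1 hM).
pose f : {rmorphism R -> R'} := HB.pack h m1 m2.
by exists f.
Qed.

Lemma diagram_rmorph (F K F' K' : closedFieldType) (chi : F -> K) (chi' : F' -> K') hF hK :
  @diagram_map (lstructure_of chi) (lstructure_of chi') hF hK ->
  exists (f : {rmorphism F -> F'}) (g : {rmorphism K -> K'}),
    [/\ hF = f, hK = g & forall x, chi' (f x) = g (chi x)].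
Proof.
move=> dg.
pose cF (x : F) : rterm (atomF F 0) := TAtom (FConst 0 x).
pose cK (y : K) : rterm (atomK F K 0 0) := TAtom (KConst F 0 0 y).
have eF (s t : rterm (atomF F 0)) := dg (FEq K 0 s t).
have eK (s t : rterm (atomK F K 0 0)) := dg (KEq s t).
have [|||f ef] := @pack_rmorph _ _ hF.
- move=> a b; apply: esym; exact: (eF (TAdd (cF a) (TOpp (cF b))) (cF (a - b)) erefl).
- exact: (eF (cF 1) TOne erefl).
- move=> a b; apply: esym; exact: (eF (TMul (cF a) (cF b)) (cF (a * b)) erefl).
have [|||g eg] := @pack_rmorph _ _ hK.
- move=> a b; apply: esym; exact: (eK (TAdd (cK a) (TOpp (cK b))) (cK (a - b)) erefl).
- exact: (eK (cK 1) TOne erefl).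
- move=> a b; apply: esym; exact: (eK (TMul (cK a) (cK b)) (cK (a * b)) erefl).
exists f, g; split=> // x.
by have := eK (TAtom (KChi K 0 (cF x))) (cK (chi x)) erefl; rewrite /sat_sentence /= ef eg.
Qed.

Lemma image_graph (L L1 L2 : fieldType) (f1 : {rmorphism L -> L1})
    (f2 : {rmorphism L -> L2}) (S : subfield L) :
  exists R : subfield (L1 * L2)%type, forall z, R z <-> exists2 x, S x & z = (f1 x, f2 x).
Proof.
unshelve eexists (@Subfield (L1 * L2)%type
  (fun z => exists2 x, S x & z = (f1 x, f2 x)) _ _ _ _ _).
- by exists 1; [exact: (sf_1 S)|rewrite !rmorph1].
- by move=> _ _ [a Sa ->] [b Sb ->]; exists (a - b); [exact: sf_B|rewrite !rmorphB].
- by move=> _ _ [a Sa ->] [b Sb ->]; exists (a * b); [exact: sf_M|rewrite !rmorphM].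
- move=> _ [a Sa ->]; exists a^-1; first exact: sf_V.
  have [->|a0] := eqVneq a 0.
    by rewrite invr0 !rmorph0; exact: (@invr0 (L1 * L2)%type).
  rewrite !fmorphV pairV //.
  by apply/andP; rewrite /= !unitfE !fmorph_eq0.
- move=> _ [a Sa ->] ne.
  have a0 : a != 0 by apply: contra_neq ne => ->; rewrite !rmorph0.
  by apply/andP; rewrite /= !unitfE !fmorph_eq0.
by [].
Qed.

Lemma countable_tuples T (C : set T) m : countable C ->
  countable [set v : 'I_m -> T | forall i, C (v i)].
Proof.
move=> /countable_injP[f finj]; apply/countable_injP.
exists (fun v => pickle [seq f (v i) | i <- enum 'I_m]) => v v'.
rewrite !inE /= => Cv Cv' /(pcan_inj pickleK) /eq_in_map e.
by apply: funext => i; apply: finj; rewrite ?inE //; apply: e; rewrite mem_enum.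
Qed.

Section Counting.
Variables (T : theory) (hT : axiomatizes_ACFC T).
Variables (F K : closedFieldType) (chi : F -> K).
Hypotheses (cP : is_character chi) (gP : is_generic chi).
Let M := lstructure_of chi.
Hypothesis MT : models M T.
Variables (AF : set F) (AK : set K).
Hypotheses (cAF : countable AF) (cAK : countable AK).

Lemma tame_exists : exists (F0 : set F) (K0 : set K),
  [/\ AF `<=` F0, AK `<=` K0, chi @` F0 `<=` K0 & tame chi F0 K0].
Proof.
have [B [cB GB]] := free_over_countable (generic_free cP gP) cAK.
pose F0 := acl (AF `|` B); pose K0 := acl (AK `|` (chi @` F0)).
have cF0 : countable F0 by apply: acl_countable; apply: countableU.
exists F0, K0; split; [|by move=> z h; apply: acl_in; left|by move=> z h; apply: acl_in; right|].
  by move=> z h; apply: acl_in; left.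
split=> //; [exact: acl_sub|exact: acl_sub| |].
- by apply: acl_countable; apply: countableU => //; apply: countable_image.
- by apply: (free_over_extend GB) => // z h; apply: acl_in; right.
Qed.

Lemma tame_transfer F0 K0 (F' K' : closedFieldType) (chi' : F' -> K')
    (f : {rmorphism F -> F'}) (g : {rmorphism K -> K'}) :
  is_character chi' -> is_generic chi' ->
  @diagram_map M (lstructure_of chi') f g -> (forall x, chi' (f x) = g (chi x)) ->
  tame chi F0 K0 -> tame chi' (f @` F0) (g @` K0).
Proof.
move=> cP' gP' dg fg [aF aK cF cK G]; split.
- exact: image_acl.
- exact: image_acl.
- exact: countable_image.
- exact: countable_image.
- exact: (free_over_transfer cP cP' dg fg (generic_free cP' gP')).
Qed.

(** By forth_tuples and partial_iso_sat every type over A is realised in one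
    fixed ample extension of M, by a tuple from a state reached there by
    canonical choices. There are countably many such states, and each of them
    is countable. *)
Theorem countable_types m n : countable (complete_types M AF AK m n).
Proof.
have [F0 [K0 [AF0 AK0 chi0 tm]]] := tame_exists.
have aclF : forall x, acl F0 x -> F0 x := tame_aF tm.
have aclK : forall x, acl K0 x -> K0 x := tame_aK tm.
(* The fixed ample extension of M, in which all types are realised. *)
have [Fs [Ks [chis [_ [_ [hF [hK [[cs gs us rs] [_ dgs _ _]]]]]]]]] :=
  @big_extension T hT M M AF AK sval sval MT (fun s h => h).
have [fs [gsm [ehF ehK fgs]]] := diagram_rmorph dgs; subst hF hK.
have ams : ample chis by [].
have [pF [pK [hpF hpK]]] := ample_pick ams.
pose s0 := (fs @` F0, gsm @` K0).
pose st bs := foldl (next_state chis pF pK) s0 bs.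
have tms : tame chis (fs @` F0) (gsm @` K0) by apply: tame_transfer.
have cst bs : countable (st bs).1 /\ countable (st bs).2.
  elim/last_ind: bs => [|bs b [IH1 IH2]]; first by case: tms.
  rewrite /st foldl_rcons -/(st bs) /next_state; case: b => /=.
    by split=> //; apply: acl_countable; apply: countableU.
  have c1 : countable (acl ((st bs).1 `|` [set pF (st bs).1])).
    by apply: acl_countable; apply: countableU.
  by split=> //; apply: acl_countable; apply: countableU => //; apply: countable_image.
pose UF := \bigcup_(bs in @setT (seq bool)) (st bs).1.
pose UK := \bigcup_(bs in @setT (seq bool)) (st bs).2.
have cUF : countable UF by apply: bigcup_countable => // bs _; case: (cst bs).
have cUK : countable UK by apply: bigcup_countable => // bs _; case: (cst bs).
pose tp (z : ('I_m -> Fs) * ('I_n -> Ks)) : set (formula {x | AF x} {y | AK y} m n) :=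
  [set phi | sat (M := lstructure_of chis) (fun a => fs (sval a)) (fun a => gsm (sval a)) phi z.1 z.2].
have : countable (tp @` ([set v | forall i, UF (v i)] `*` [set w | forall j, UK (w j)])).
  by apply: countable_image; apply: countableX; apply: countable_tuples.
apply: countable_sub => p [[N [cF [cK [v [w [thN pvw]]]]]] pc].
(* A realisation of p, in an ample structure that also contains M. *)
have [F1 [K1 [chi1 [dF [dK [hF [hK [[c1 g1 u1 r1] [el dg hcF hcK]]]]]]]]] :=
  big_extension hT MT thN.
have [f [g [ehF ehK fg]]] := diagram_rmorph dg; subst hF hK.
have am1 : ample chi1 by [].
have [R0 hR0] := image_graph f fs (acl_field F0).
have [Q0 hQ0] := image_graph g gsm (acl_field K0).
have R0E x : F0 x -> R0 (f x, fs x) by move=> h; apply/hR0; exists x => //; apply: acl_in.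
have Q0E x : K0 x -> Q0 (g x, gsm x) by move=> h; apply/hQ0; exists x => //; apply: acl_in.
have dR0 : dom R0 = f @` F0.
  apply/seteqP; split=> x; last by move=> [y Fy <-]; exists (fs y); apply: R0E.
  by move=> [x' /hR0[y /aclF Fy [-> _]]]; exists y.
have rR0 : ran R0 = fs @` F0.
  apply/seteqP; split=> x; last by move=> [y Fy <-]; exists (f y); apply: R0E.
  by move=> [x' /hR0[y /aclF Fy [_ ->]]]; exists y.
have dQ0 : dom Q0 = g @` K0.
  apply/seteqP; split=> x; last by move=> [y Fy <-]; exists (gsm y); apply: Q0E.
  by move=> [x' /hQ0[y /aclK Fy [-> _]]]; exists y.
have rQ0 : ran Q0 = gsm @` K0.
  apply/seteqP; split=> x; last by move=> [y Fy <-]; exists (g y); apply: Q0E.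
  by move=> [x' /hQ0[y /aclK Fy [_ ->]]]; exists y.
have B0 : partial_iso chi1 chis R0 Q0.
  split.
  - move=> x x' /hR0[y /aclF Fy [-> ->]]; rewrite fg fgs; apply: Q0E.
    by apply: chi0; exists y.
  - by rewrite dR0 dQ0; apply: tame_transfer.
  - by rewrite rR0 rQ0.
have [R1 [Q1 [[B1 RR1 QQ1 [bs ebs]] [hv hw]]]] :=
  forth_tuples c1 cs hpF hpK (fun i => dF (v i)) (fun j => dK (w j)) B0.
have [eR eQ] : ran R1 = (st bs).1 /\ ran Q1 = (st bs).2.
  by rewrite /st /s0 -rR0 -rQ0 -ebs.
have [u hu] := choice hv; have [t ht] := choice hw.
have key phi : sat cF cK phi v w <-> tp (u, t) phi.
  rewrite el.
  apply: (@partial_iso_sat _ _ _ _ _ _ am1 ams _ _ (fun a => dF (cF a)) (fun a => dK (cK a))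
    (fun a => fs (sval a)) (fun a => gsm (sval a)) m n phi R1 Q1 _ _ u t B1) => //.
  - by move=> a; rewrite -hcF; apply: RR1; apply: R0E; apply: AF0; apply: (svalP a).
  - by move=> a; rewrite -hcK; apply: QQ1; apply: Q0E; apply: AK0; apply: (svalP a).
exists (u, t).
  split=> /= [i|j]; exists bs => //.
    by rewrite -eR; exists (dF (v i)).
  by rewrite -eQ; exists (dK (w j)).
apply/seteqP; split=> phi.
  move=> /key h; case: (pc phi) => // /pvw /=; by move=> nh; case: nh.
by move=> /pvw /key.
Qed.

End Counting.

Theorem corollary7p5 (ACFC : theory) (hACFC : axiomatizes_ACFC ACFC)
    (p : nat) (hp : prime p \/ p = 0%N) :
  omega_stable (ACFC_char ACFC p).
Proof.
move=> M MT AF AK cAF cAK m n.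
have MT' : models M ACFC by move=> s hs; apply: MT; left.
have [F [K [chi [_ cP gP eM]]]] := (hACFC M).1 MT'; subst M.
exact: (countable_types hACFC).
Qed.
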